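(* Let $\alpha,\beta\in(0,1)$ be constants and, for each $n$, let $W=\{w_{ij}\}_{1\le i,j\le n}$ be weights with $w_{ij}=w_{ji}\in[\beta,1]$ for $i\ne j$ and $w_{ii}=0$. For the heterogeneous random graph $\mathcal{G}_n(\alpha,\beta,W)$ with average closure coefficient $\overline{\mathcal{H}}_n$, we have, as $n\to\infty$, \[\frac{\overline{\mathcal{H}}_n-\mathbb{E}[\overline{\mathcal{H}}_n]}{\sigma_n}\Rightarrow \mathcal{N}(0,1),\] where $\sigma_n>0$, $\sigma_n^2=\sigma_{1n}^2+\sigma_{2n}^2$ and \[\sigma_{1n}^2=\frac{4}{n^2}\sum_{i<j<k}\left(\frac{1}{\nu_i}+\frac{1}{\nu_j}+\frac{1}{\nu_k}\right)^2p_nw_{ij}(1-p_nw_{ij})\,p_nw_{jk}(1-p_nw_{jk})\,p_nw_{ki}(1-p_nw_{ki}),\] \[\sigma_{2n}^2=\frac{1}{n^2}\sum_{i<j}\bigl(2b_{ij}+2c_{ij}+2c_{ji}-(a_i+a_j)-(e_{ij}+e_{ji})\bigr)^2p_nw_{ij}(1-p_nw_{ij}),\] \[\nu_i=\sum_{j=1}^n\sum_{k=1}^np_n^2w_{ij}w_{jk},\qquad b_{ij}=\sum_{k}\frac{p_nw_{ik}\,p_nw_{jk}}{\nu_k},\qquad c_{ij}=\sum_{k}\frac{p_nw_{ik}\,p_nw_{jk}}{\nu_i},\] \[a_s=\sum_{i,j,k}\frac{p_nw_{ij}\,p_nw_{jk}\,p_nw_{ki}\,p_nw_{is}}{\nu_i^2},\qquad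 e_{is}=\sum_{j,k,t}\frac{p_nw_{ij}\,p_nw_{jk}\,p_nw_{ki}\,p_nw_{st}}{\nu_i^2},\] all summation indices ranging over $[n]=\{1,\dots,n\}$.
   Context: Random graph: put $p_n=n^{-\alpha}$. $\mathcal{G}_n(\alpha,\beta,W)$ is the random undirected graph on node set $[n]=\{1,\dots,n\}$ with symmetric adjacency matrix $A$ ($A_{ij}=A_{ji}\in\{0,1\}$, $A_{ii}=0$), where the $A_{ij}$ ($1\le i<j\le n$) are independent with $\mathbb{P}(A_{ij}=1)=p_nw_{ij}$. The weights $W$ may depend on $n$. Average closure coefficient: \[\overline{\mathcal{H}}_n=\frac1n\sum_{i=1}^n\frac{\sum_{j\ne k}A_{ij}A_{jk}A_{ki}}{\sum_{j\neq k}A_{ij}A_{jk}},\] where for each $i$ the inner sums are over $j,k\in[n]\setminus\{i\}$ with $j\ne k$ (so the denominator is the number of 2-paths starting at node $i$, and the numerator is twice the number of triangles containing $i$), and any summand with denominator zero is set to be zero. $\sum_{i<j<k}$ and $\sum_{i<j}$ denote sums over all indices in $[n]$ with the indicated ordering. $\Rightarrow$ denotes convergence in distribution as $n\to\infty$ and $\mathcal{N}(0,1)$ is the standard normal distribution. *)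

(* Defs.v *)
From HB Require Import structures.
From mathcomp Require Import all_boot all_order all_algebra.
From mathcomp Require Import all_classical all_reals all_analysis.
From mathcomp Require Import measurable_realfun.

Set Implicit Arguments.
Unset Strict Implicit.
Unset Printing Implicit Defensive.

Import Order.TTheory GRing.Theory Num.Theory.
Import numFieldNormedType.Exports.

Local Open Scope classical_set_scope.
Local Open Scope ring_scope.

Section Probability.
Context {R : realType}.

Definition mutually_independent {d d'} {Omega : measurableType d}
    {T : measurableType d'} {P : probability Omega R} {I : finType}
    (D : {set I}) (X : I -> {RV P >-> T}) : Prop :=
  forall (S : {set I}) (B : I -> set T), S \subset D ->
    (forall i, measurable (B i)) ->
    P (\bigcap_(i in [set` S]) X i @^-1` B i) =
      (\prod_(i in S) P (X i @^-1` B i))%E.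

(* The spaces carrying the [X n] may vary with [n]. *)
Definition converges_in_distribution {d : nat -> measure_display}
    {Omega : forall n, measurableType (d n)}
    {P : forall n, probability (Omega n) R}
    (X : forall n, {RV (P n) >-> R}) (mu : probability (measurableTypeR R) R) : Prop :=
  forall x : R, {for x, continuous (fun t : R => mu [set` `]-oo, t]])} ->
    cdf (X n) x @[n --> \oo] --> mu [set` `]-oo, x]].

Definition standardize {d} {Omega : measurableType d}
    (P : probability Omega R) (X : {RV P >-> R}) (s : R) (o : Omega) : R :=
  (X o - fine 'E_P[X]) / s.

Lemma measurable_standardize {d} {Omega : measurableType d}
    (P : probability Omega R) (X : {RV P >-> R}) (s : R) :
  measurable_fun setT (standardize X s).
Proof.
apply: measurable_funM; last exact: measurable_cst.
by apply: measurable_funB; [exact: measurable_funPT | exact: measurable_cst].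
Qed.

HB.instance Definition _ {d} {Omega : measurableType d}
    (P : probability Omega R) (X : {RV P >-> R}) (s : R) :=
  isMeasurableFun.Build _ _ _ _ (standardize X s)
    (measurable_standardize X s).

End Probability.

Section RandomGraph.
Context {R : realType}.

Definition edge_prob (alpha : R) {n} (w : 'M[R]_n) : 'M[R]_n :=
  \matrix_(i, j) (n%:R `^ (- alpha) * w i j).

Record heterogeneous_random_graph {d} {Omega : measurableType d}
    {P : probability Omega R} {n} (q : 'M[R]_n)
    (A : 'I_n -> 'I_n -> {RV P >-> bool}) : Prop := {
  adjacency_sym : forall i j o, A i j o = A j i o ;
  adjacency_irrefl : forall i o, A i i o = false ;
  adjacency_prob : forall i j : 'I_n, (i < j)%N ->
    P (A i j @^-1` [set true]) = (q i j)%:E ;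
  adjacency_indep :
    mutually_independent [set e : 'I_n * 'I_n | (e.1 < e.2)%N]%SET
      (fun e => A e.1 e.2)
}.

(* As [x / 0 = 0] in [R], vertices starting no 2-path contribute 0. *)
Definition average_closure {n} (a : 'I_n -> 'I_n -> bool) : R :=
  n%:R^-1 * \sum_(i < n)
    ((\sum_(j < n | j != i) \sum_(k < n | (k != i) && (j != k))
        (a i j)%:R * (a j k)%:R * (a k i)%:R) /
     (\sum_(j < n | j != i) \sum_(k < n | (k != i) && (j != k))
        (a i j)%:R * (a j k)%:R)).

Definition average_closure_rv {d} {Omega : measurableType d} {n}
    (A : 'I_n -> 'I_n -> {mfun Omega >-> bool}) (o : Omega) : R :=
  average_closure (fun i j => A i j o).

Lemma measurable_average_closure_rv {d} {Omega : measurableType d} {n}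
    (A : 'I_n -> 'I_n -> {mfun Omega >-> bool}) :
  measurable_fun setT (average_closure_rv A).
Proof.
pose g (a : {ffun 'I_n * 'I_n -> bool}) := average_closure (fun i j => a (i, j)).
rewrite (_ : average_closure_rv A = fun o =>
    \sum_(a : {ffun 'I_n * 'I_n -> bool})
      g a * \prod_(e : 'I_n * 'I_n) (A e.1 e.2 o == a e)%:R); last first.
  apply/funext => o; pose a0 := [ffun e : 'I_n * 'I_n => A e.1 e.2 o].
  rewrite (bigD1 a0)//= [X in _ + X]big1 ?addr0 => [|a aa0].
    rewrite big1 ?mulr1 => [|e _]; last by rewrite ffunE eqxx.
    by congr average_closure; apply/funext => i; apply/funext => j; rewrite ffunE.
  have [e ae] : exists e, A e.1 e.2 o != a e.
    apply/existsP; apply: contraNT aa0 => /existsPn aA.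
    by apply/eqP/ffunP => e; rewrite ffunE; apply/esym/eqP; have := aA e; rewrite negbK.
  by rewrite (bigD1 e)//= (negbTE ae) mul0r mulr0.
apply: measurable_sum => a; apply: measurable_funM; first exact: measurable_cst.
apply: measurable_prod => e _.
exact: (measurableT_comp (f := fun b : bool => (b == a e)%:R : R)).
Qed.

HB.instance Definition _ {d} {Omega : measurableType d} {n}
    (A : 'I_n -> 'I_n -> {mfun Omega >-> bool}) :=
  isMeasurableFun.Build _ _ _ _ (average_closure_rv A)
    (measurable_average_closure_rv A).

(* Below, [q i j] stands for the product of [p_n] and [w_ij]. *)
Section Variance.
Context {n : nat} (q : 'M[R]_n).

Definition nu (i : 'I_n) : R := \sum_(j < n) \sum_(k < n) q i j * q j k.

Definition coef_b (i j : 'I_n) : R := \sum_(k < n) q i k * q j k / nu k.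

Definition coef_c (i j : 'I_n) : R := \sum_(k < n) q i k * q j k / nu i.

Definition coef_a (s : 'I_n) : R :=
  \sum_(i < n) \sum_(j < n) \sum_(k < n)
    q i j * q j k * q k i * q i s / nu i ^+ 2.

Definition coef_e (i s : 'I_n) : R :=
  \sum_(j < n) \sum_(k < n) \sum_(t < n)
    q i j * q j k * q k i * q s t / nu i ^+ 2.

Definition sigma1_sq : R :=
  4 / n%:R ^+ 2 *
  \sum_(i < n) \sum_(j < n | (i < j)%N) \sum_(k < n | (j < k)%N)
    ((nu i)^-1 + (nu j)^-1 + (nu k)^-1) ^+ 2 *
    (q i j * (1 - q i j)) * (q j k * (1 - q j k)) * (q k i * (1 - q k i)).

Definition sigma2_sq : R :=
  1 / n%:R ^+ 2 *
  \sum_(i < n) \sum_(j < n | (i < j)%N)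
    (2 * coef_b i j + 2 * coef_c i j + 2 * coef_c j i
      - (coef_a i + coef_a j) - (coef_e i j + coef_e j i)) ^+ 2 *
    (q i j * (1 - q i j)).

Definition sigma : R := Num.sqrt (sigma1_sq + sigma2_sq).

End Variance.
End RandomGraph.

(* Main.v *)
Require Import Defs.
From HB Require Import structures.
From mathcomp Require Import all_boot all_order all_algebra.
From mathcomp Require Import all_classical all_reals all_analysis.
From mathcomp Require Import measurable_realfun ring lra.

Set Implicit Arguments.
Unset Strict Implicit.
Unset Printing Implicit Defensive.

Import Order.TTheory GRing.Theory Num.Theory.
Import numFieldNormedType.Exports.

Local Open Scope classical_set_scope.
Local Open Scope ring_scope.

(** Write [H] for the average closure coefficient. Joining [s] and [t] changes
   the numbers of triangles and of 2-paths at every vertex by quantities which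
   are explicit in the other edges. When the graph is typical, degrees, numbers
   of 2-paths and numbers of triangles may be replaced by their means in the
   resulting increment of [H]; only the common neighbours of [s] and [t]
   fluctuate too much, and expanding their number in the centred edge
   indicators [xi] turns the increment into
   [l s t + \sum_k C s t k * xi s k * xi t k] with deterministic [l] and [C].
   This is exactly the increment of the polynomial
   [Z = \sum_(s < t) l s t * xi s t + \sum_(s < t < k) C s t k * xi s t * xi s k * xi t k],
   called [chaos] below. Its monomials are uncorrelated, so its variance is a
   sum of two terms, and these are [sigma1_sq] and [sigma2_sq] ([sigma_sqE]).

   The first half of the proof compares [H - E H] with [Z]. By the Efron-Stein
   inequality ([poincare]) the second moment of the difference is bounded by
   those of its increments. On typical graphs the increments are close by
   Taylor's formula for the quotient ([closure_diff_approx]); the others have an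
   exponentially small probability by Chernoff's bound ([atypical_prob]). The
   result, [Ex_remainder_sqr], is small compared with the variance, whose order
   is at least that of the number of triangles ([chaos_var_lower]).

   The second half shows that [Z] is asymptotically normal by Stein's method.
   A Bernoulli variable satisfies an exact integration by parts ([Ex_ibp]), and
   hence [E (Z f(Z))] is [E (T f'(Z))] up to a second-order Taylor term, where
   the kernel [T] is again a polynomial in the edges, with mean [E Z^2]
   ([chaos_stein]). The Efron-Stein inequality bounds the fluctuation of [T]
   ([variance_stein_kernel]), and moments up to order four bound the Taylor term
   ([chaos_third_order]). Stein's equation is solved for Lipschitz
   approximations of indicators of half-lines ([stein_equation]), its solutions
   being controlled by Mills' ratio.

   Both halves are combined for a fixed number of vertices in [clt_bound]; with
   [p = n^-alpha] all error terms are bounded by a power of [n] with negative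
   exponent ([error_rate_le]), and sandwiching an indicator between two ramps gives the
   convergence of the distribution functions ([cdf_clt]). *)

(** * Functions of independent Bernoulli variables *)

Lemma eq_ler (R : numDomainType) (x y : R) : x = y -> x <= y.
Proof. by move=> ->. Qed.

(** Nonnegativity by following the syntax of the expression: applying the
   lemmas by plain unification would unfold powers and variances. *)
Ltac nonneg :=
  repeat first
  [ match goal with H : ?G |- ?G => exact H end
  | lazymatch goal with
    | |- is_true (@Order.le _ _ _ (@Algebra.add _ _ _)) => apply: addr_ge0
    | |- is_true (@Order.le _ _ _ (@GRing.mul _ _ _)) => apply: mulr_ge0
    | |- is_true (@Order.le _ _ _ (@GRing.inv _ _)) => rewrite invr_ge0
    | |- is_true (@Order.le _ _ _ (@GRing.exp _ _ 2)) => apply: sqr_ge0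
    | |- is_true (@Order.le _ _ _ (@GRing.exp _ _ 4)) => apply: exprn_even_ge0
    | |- is_true (@Order.le _ _ _ (@GRing.exp _ _ _)) => apply: exprn_ge0
    | |- is_true (@Order.le _ _ _ (@Algebra.natmul _ _ _)) => apply: ler0n
    | |- is_true (@Order.le _ _ _ (@Num.norm _ _ _)) => apply: normr_ge0
    | |- is_true (@Order.le _ _ _ (@bigop.body _ _ _ _ _)) =>
        apply: sumr_ge0 => ? _
    end
  | assumption
  | by apply: ltW
  | done ].

Section BernoulliProduct.
Context {R : realFieldType} {I : finType} (q : I -> R).
Local Notation config := {ffun I -> bool}.
Implicit Types (a : config) (F G : config -> R) (e : I).

Definition weight a : R := \prod_e (if a e then q e else 1 - q e).

Definition Ex F : R := \sum_a weight a * F a.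

Definition upd e (b : bool) a : config := [ffun i => if i == e then b else a i].

Definition diff e F a : R := F (upd e true a) - F (upd e false a).

Definition ignores e F : Prop := forall b a, F (upd e b a) = F a.

Definition resample e F a : R :=
  q e * F (upd e true a) + (1 - q e) * F (upd e false a).

Definition bvar e : R := q e * (1 - q e).

Definition centered e a : R := (a e)%:R - q e.

Definition variance F : R := Ex (fun a => F a ^+ 2) - Ex F ^+ 2.

Lemma eq_Ex F G : F =1 G -> Ex F = Ex G.
Proof. by move=> FG; apply: eq_bigr => a _; rewrite FG. Qed.

Lemma ExD F G : Ex (fun a => F a + G a) = Ex F + Ex G.
Proof. by rewrite /Ex -big_split; apply: eq_bigr => a _; rewrite mulrDr. Qed.

Lemma ExZ (c : R) F : Ex (fun a => c * F a) = c * Ex F.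
Proof. by rewrite /Ex big_distrr; apply: eq_bigr => a _; rewrite mulrCA. Qed.

Lemma ExZr (c : R) F : Ex (fun a => F a * c) = Ex F * c.
Proof. by rewrite mulrC -ExZ; apply: eq_Ex => a; rewrite mulrC. Qed.

Lemma ExN F : Ex (fun a => - F a) = - Ex F.
Proof. by rewrite -mulN1r -ExZ; apply: eq_Ex => a; rewrite mulN1r. Qed.

Lemma ExB F G : Ex (fun a => F a - G a) = Ex F - Ex G.
Proof. by rewrite ExD ExN. Qed.

Lemma Ex_sum (J : Type) (r : seq J) (P : pred J) (F : J -> config -> R) :
  Ex (fun a => \sum_(j <- r | P j) F j a) = \sum_(j <- r | P j) Ex (F j).
Proof.
by rewrite /Ex exchange_big; apply: eq_bigr => a _; rewrite big_distrr.
Qed.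

Lemma Ex1 : Ex (fun=> 1) = 1.
Proof.
rewrite /Ex (eq_bigr weight) => [|a _]; last by rewrite mulr1.
rewrite /weight -(bigA_distr_bigA (fun e b => if b then q e else 1 - q e)).
by rewrite big1// => e _; rewrite big_bool/= subrKC.
Qed.

Lemma Ex_cst (c : R) : Ex (fun=> c) = c.
Proof. by rewrite -[RHS]mulr1 -Ex1 -ExZ; apply: eq_Ex => a; rewrite mulr1. Qed.

Lemma updE e b a i : upd e b a i = if i == e then b else a i.
Proof. by rewrite ffunE. Qed.

Lemma upd_upd e b b' a : upd e b (upd e b' a) = upd e b a.
Proof. by apply/ffunP => i; rewrite !updE; case: eqP. Qed.

Lemma upd_id e a : upd e (a e) a = a.
Proof. by apply/ffunP => i; rewrite !updE; case: eqP => // ->. Qed.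

Lemma updC e e' b b' a : e != e' -> upd e b (upd e' b' a) = upd e' b' (upd e b a).
Proof.
move=> ee'; apply/ffunP => i; rewrite !updE.
by case: eqP => // ->; rewrite (negbTE ee').
Qed.

Let wrest e a := \prod_(i | i != e) (if a i then q i else 1 - q i).

Let weight_split e a : weight a = (if a e then q e else 1 - q e) * wrest e a.
Proof. by rewrite /weight (bigD1 e). Qed.

Let wrest_upd e b a : wrest e (upd e b a) = wrest e a.
Proof. by apply: eq_bigr => i ie; rewrite updE (negbTE ie). Qed.

(** Redrawing one coordinate does not change the law. *)
Lemma Ex_resample e F : Ex (resample e F) = Ex F.
Proof.
have sum_upd (b : bool) (H : config -> R) :
    \sum_(a : config | a e != b) H a = \sum_(a : config | a e == b) H (upd e (~~ b) a).
  rewrite (reindex_onto (upd e (~~ b)) (upd e b)); last first.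
    by move=> a; rewrite upd_upd => aeb; rewrite -[RHS](upd_id e); congr upd; case: (a e) b aeb => [] [].
  apply: eq_bigl => a; rewrite updE eqxx upd_upd; case: b => /=; apply/eqP/eqP => [<-|<-//].
  - by rewrite updE eqxx.
  - exact: upd_id.
  - by rewrite updE eqxx.
  - exact: upd_id.
rewrite /Ex (bigID (fun a : config => a e == true))/= sum_upd [RHS](bigID (fun a : config => a e == true))/=.
rewrite [X in _ = _ + X]sum_upd -!big_split; apply: eq_bigr => a /eqP ae.
rewrite /resample !upd_upd -[in X in _ = weight X * _ + _](upd_id e a) -[in X in _ = _ * F X + _](upd_id e a).
rewrite -[in X in weight X * _ + _ = _](upd_id e a).
rewrite !(weight_split e) !wrest_upd !updE eqxx ae /=; ring.
Qed.

Lemma ignores_resample e F : ignores e (resample e F).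
Proof. by move=> b a; rewrite /resample !upd_upd. Qed.

Lemma ignores_diff e F : ignores e (diff e F).
Proof. by move=> b a; rewrite /diff !upd_upd. Qed.

Lemma Ex_bernoulli_mul e (g : bool -> R) F : ignores e F ->
  Ex (fun a => g (a e) * F a) = (q e * g true + (1 - q e) * g false) * Ex F.
Proof.
move=> Fe; rewrite -(Ex_resample e) -ExZ; apply: eq_Ex => a.
by rewrite /resample !updE eqxx !Fe; ring.
Qed.

(** A function is affine in each coordinate, so its covariance with a Bernoulli
   variable is exactly the variance times the discrete derivative. This replaces
   Gaussian integration by parts in Stein's method. *)
Lemma Ex_ibp e F : Ex (fun a => centered e a * F a) = bvar e * Ex (diff e F).
Proof.
rewrite -(Ex_resample e) -ExZ; apply: eq_Ex => a.
by rewrite /resample /centered /bvar /diff !updE eqxx /=; ring.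
Qed.

Lemma diff_sub_cst e F G (c : R) a :
  diff e (fun a => F a - G a - c) a = diff e F a - diff e G a.
Proof. by rewrite /diff; ring. Qed.

Lemma diff_ignores_mul e F G a : ignores e F ->
  diff e (fun a => F a * G a) a = F a * diff e G a.
Proof. by move=> Fe; rewrite /diff !Fe; ring. Qed.

Hypothesis q01 : forall e, 0 <= q e <= 1.

Lemma weight_ge0 a : 0 <= weight a.
Proof.
by apply: prodr_ge0 => e _; have /andP[? ?] := q01 e; case: ifP => _; lra.
Qed.

Lemma bvar_ge0 e : 0 <= bvar e.
Proof. by have /andP[? ?] := q01 e; rewrite mulr_ge0// subr_ge0. Qed.

Lemma bvar_le e : bvar e <= q e.
Proof. by have /andP[? ?] := q01 e; rewrite /bvar; nra. Qed.

Lemma le_Ex F G : (forall a, F a <= G a) -> Ex F <= Ex G.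
Proof. by move=> FG; apply: ler_sum => a _; rewrite ler_wpM2l// weight_ge0. Qed.

Lemma Ex_ge0 F : (forall a, 0 <= F a) -> 0 <= Ex F.
Proof. by move=> F0; rewrite -(Ex_cst 0); exact: le_Ex. Qed.

Lemma Ex_norm F : `|Ex F| <= Ex (fun a => `|F a|).
Proof.
rewrite (le_trans (ler_norm_sum _ _ _))//; apply: ler_sum => a _.
by rewrite normrM (ger0_norm (weight_ge0 a)).
Qed.

Lemma Ex_sqr_add2 F G : Ex (fun a => (F a + G a) ^+ 2) <=
  2 * Ex (fun a => F a ^+ 2) + 2 * Ex (fun a => G a ^+ 2).
Proof.
rewrite -!ExZ -ExD; apply: le_Ex => a.
by have := sqr_ge0 (F a - G a); nra.
Qed.

Lemma varianceE F : variance F = Ex (fun a => (F a - Ex F) ^+ 2).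
Proof.
transitivity (Ex (fun a => F a ^+ 2 - (2 * Ex F) * F a + Ex F ^+ 2)).
  by rewrite ExD ExB ExZ Ex_cst /variance; ring.
by apply: eq_Ex => a; ring.
Qed.

Lemma Ex_centered_sqr_mul e F : ignores e F ->
  Ex (fun a => centered e a ^+ 2 * F a) = bvar e * Ex F.
Proof.
by move=> Fe; rewrite (Ex_bernoulli_mul (fun b => (b%:R - q e) ^+ 2))//= /bvar; ring.
Qed.

Let Ex_sqr_resample e F : Ex (fun a => F a ^+ 2) - Ex (fun a => resample e F a ^+ 2)
  = bvar e * Ex (fun a => diff e F a ^+ 2).
Proof.
rewrite -ExZ -[in LHS](Ex_resample e (fun a => F a ^+ 2)) -ExB; apply: eq_Ex => a.
by rewrite /resample /bvar /diff; ring.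
Qed.

Let Ex_sqr_diff_resample e e' F : e != e' ->
  Ex (fun a => diff e (resample e' F) a ^+ 2) <= Ex (fun a => diff e F a ^+ 2).
Proof.
move=> ee'.
have -> : Ex (fun a => diff e (resample e' F) a ^+ 2) =
          Ex (fun a => resample e' (diff e F) a ^+ 2).
  apply: eq_Ex => a; congr (_ ^+ 2); rewrite /diff /resample.
  by rewrite !(updC _ _ _ (_ : e' != e)) 1?eq_sym//; ring.
rewrite -subr_ge0 Ex_sqr_resample mulr_ge0 ?bvar_ge0//.
by apply: Ex_ge0 => a; exact: sqr_ge0.
Qed.

(** Averaging out the coordinates one after the other decreases the second
   moment from that of [F] to that of its mean, and each step costs the second
   moment of a discrete derivative, which the earlier averagings only shrink. *)
Lemma poincare F :
  variance F <= \sum_e bvar e * Ex (fun a => diff e F a ^+ 2).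
Proof.
pose G (s : seq I) := foldr resample F s.
have step s : uniq s -> Ex (fun a => F a ^+ 2) - Ex (fun a => G s a ^+ 2)
    <= \sum_(e <- s) bvar e * Ex (fun a => diff e F a ^+ 2).
  elim: s => [_|e s IHs /= /andP[es us]]; first by rewrite big_nil subrr.
  rewrite big_cons; have := IHs us.
  suff: Ex (fun a => G s a ^+ 2) - Ex (fun a => resample e (G s) a ^+ 2) <= bvar e * Ex (fun a => diff e F a ^+ 2) by lra.
  rewrite Ex_sqr_resample ler_wpM2l ?bvar_ge0//.
  elim: s es {IHs us} => [//|e' s IHs]; rewrite inE negb_or => /andP[ee' es].
  by rewrite (le_trans (Ex_sqr_diff_resample _ ee'))// IHs.
have ExG s : Ex (G s) = Ex F by elim: s => //= e s IHs; rewrite Ex_resample.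
have ignoresG s e : e \in s -> ignores e (G s).
  elim: s => //= e' s IHs; rewrite inE; have [-> _|ee' /= es] := eqVneq e e'.
    exact: ignores_resample.
  by move=> b a; rewrite /resample !(updC _ _ _ (_ : e' != e)) 1?eq_sym// !IHs.
have Gcst a : G (enum I) a = Ex F.
  rewrite -(ExG (enum I)) -(Ex_cst (G (enum I) a)); apply: eq_Ex => a'.
  have upds (s : seq I) : {subset s <= enum I} ->
      G (enum I) a' = G (enum I) (foldr (fun e a'' => upd e (a e) a'') a' s).
    elim: s => //= e s IHs ss; rewrite ignoresG; last by rewrite ss ?mem_head.
    by rewrite -IHs// => x xs; rewrite ss// inE xs orbT.
  rewrite (upds (enum I))//; congr G; apply/ffunP => e.
  have : e \in enum I by rewrite mem_enum.
  elim: (enum I) => //= e' s IHs; rewrite inE updE; have [->//|_ /= es] := eqVneq e e'.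
  by rewrite IHs.
have := step _ (enum_uniq I); rewrite big_enum /=; apply: le_trans.
by rewrite /variance -(Ex_cst (Ex F ^+ 2)) lerD2l lerN2; apply: le_Ex => a; rewrite Gcst.
Qed.

End BernoulliProduct.

(** * The edges of a random graph *)

Section SymmetricSums.
Context {R : realFieldType} {n : nat}.

Lemma sum_lt_half (G : 'I_n -> 'I_n -> R) :
  (forall i j, G i j = G j i) -> (forall i, G i i = 0) ->
  \sum_(i < n) \sum_(j < n | (i < j)%N) G i j = 2^-1 * \sum_(i < n) \sum_(j < n) G i j.
Proof.
move=> Gsym G0; apply: (mulfI (_ : 2 != 0 :> R)); first by rewrite pnatr_eq0.
rewrite mulrA divff ?mul1r ?pnatr_eq0//.
have -> : \sum_(i < n) \sum_(j < n) G i j =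
    \sum_(i < n) \sum_(j < n | (i < j)%N) G i j + \sum_(i < n) \sum_(j < n | (j < i)%N) G i j.
  rewrite -big_split/=; apply: eq_bigr => i _.
  rewrite (bigID (fun j : 'I_n => (i < j)%N))/=; congr (_ + _).
  rewrite (bigD1 i) ?ltnn//= G0 add0r; apply: eq_bigl => j.
  by rewrite -leqNgt ltn_neqAle andbC.
rewrite mulr_natl mulr2n; congr (_ + _).
rewrite (exchange_big_dep xpredT)//=; apply: eq_bigr => i _.
by apply: eq_bigr => j _; rewrite Gsym.
Qed.

Lemma sum_lt_sixth (G : 'I_n -> 'I_n -> 'I_n -> R) :
  (forall i j k, G i j k = G j i k) -> (forall i j k, G i j k = G i k j) ->
  (forall i j, G i i j = 0) ->
  \sum_(i < n) \sum_(j < n | (i < j)%N) \sum_(k < n | (j < k)%N) G i j k =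
  6^-1 * \sum_(i < n) \sum_(j < n) \sum_(k < n) G i j k.
Proof.
move=> G12 G23 G0.
pose f (i j k : 'I_n) : R := ((i < j) && (j < k))%N%:R.
pose T := \sum_(i < n) \sum_(j < n) \sum_(k < n) f i j k * G i j k.
have -> : \sum_(i < n) \sum_(j < n | (i < j)%N) \sum_(k < n | (j < k)%N) G i j k = T.
  apply: eq_bigr => i _; rewrite big_mkcond; apply: eq_bigr => j _; rewrite /f.
  case: ifP => ij /=; last by rewrite big1// => k _; rewrite mul0r.
  by rewrite big_mkcond; apply: eq_bigr => k _; case: ifP => _; rewrite ?mul1r ?mul0r.
have G0' i j : G i j j = 0 by rewrite G12 G23 G0.
have G0'' i j : G i j i = 0 by rewrite G23 G0.
have fE i j k : G i j k = f i j k * G i j k + f i k j * G i k j + f j i k * G j i k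
    + f j k i * G j k i + f k i j * G k i j + f k j i * G k j i.
  rewrite (G23 i k j) (G12 j i k) (G23 j k i) (G12 j i k) (G12 k i j) (G23 i k j).
  rewrite (G23 k j i) (G12 k i j) (G23 i k j) /f.
  case: (ltngtP i j) => [ij|ij|/val_inj->]; last by rewrite G0; ring.
  - case: (ltngtP j k) => [jk|jk|/val_inj->]; last by rewrite G0'; ring.
    + by rewrite (ltn_trans ij jk) (ltnNge k i) (ltnW (ltn_trans ij jk))/=; ring.
    + case: (ltngtP i k) => [ik|ik|/val_inj->]; last by rewrite G0''; ring.
      * by rewrite /=; ring.
      * by rewrite /=; ring.
  - case: (ltngtP i k) => [ik|ik|/val_inj->]; last by rewrite G0''; ring.
    + by rewrite (ltn_trans ij ik) (ltnNge k j) (ltnW (ltn_trans ij ik))/=; ring.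
    + case: (ltngtP j k) => [jk|jk|/val_inj->]; last by rewrite G0'; ring.
      * by rewrite /=; ring.
      * by rewrite /=; ring.
have -> : \sum_(i < n) \sum_(j < n) \sum_(k < n) G i j k = 6 * T.
  under eq_bigr => i _ do under eq_bigr => j _ do
    (under eq_bigr => k _ do rewrite fE); rewrite ?big_split/=.
  under eq_bigr => i _ do (under eq_bigr => j _ do rewrite !big_split/=).
  under eq_bigr => i _ do rewrite !big_split/=.
  rewrite !big_split/=.
  have T2 : \sum_(i < n) \sum_(j < n) \sum_(k < n) f i k j * G i k j = T.
    by apply: eq_bigr => i _; rewrite exchange_big.
  have T3 : \sum_(i < n) \sum_(j < n) \sum_(k < n) f j i k * G j i k = T by rewrite exchange_big.
  have T4 : \sum_(i < n) \sum_(j < n) \sum_(k < n) f j k i * G j k i = T.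
    by rewrite exchange_big; apply: eq_bigr => i _; rewrite exchange_big.
  have T5 : \sum_(i < n) \sum_(j < n) \sum_(k < n) f k i j * G k i j = T.
    under eq_bigr => i _ do rewrite exchange_big.
    by rewrite exchange_big.
  have T6 : \sum_(i < n) \sum_(j < n) \sum_(k < n) f k j i * G k j i = T.
    under eq_bigr => i _ do rewrite exchange_big.
    rewrite exchange_big; apply: eq_bigr => i _.
    by rewrite exchange_big.
  by rewrite T2 T3 T4 T5 T6 -/T; ring.
by rewrite mulrA mulVf ?mul1r// pnatr_eq0.
Qed.

End SymmetricSums.

Section Edges.
Context {R : realFieldType} {n : nat} (q : 'M[R]_n).
Local Notation config := {ffun 'I_n * 'I_n -> bool}.
Implicit Types (a : config) (F : config -> R) (i j k s t : 'I_n).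

Definition edge i j := if (i < j)%N then (i, j) else (j, i).

(** A configuration has one bit for each ordered pair. Pairs that are not
   increasing get weight 0, so that edges need no index type of their own. *)
Definition edge_weight (e : 'I_n * 'I_n) : R := if (e.1 < e.2)%N then q e.1 e.2 else 0.

Definition adj i j a : R := ((i != j) && a (edge i j))%:R.

Definition cadj i j a : R := adj i j a - q i j.

Definition evar i j : R := q i j * (1 - q i j).

Lemma edgeC i j : edge i j = edge j i.
Proof. by rewrite /edge; case: ltngtP => // /val_inj->. Qed.

Lemma edge_eq i j s t :
  (edge i j == edge s t) = ((i == s) && (j == t)) || ((i == t) && (j == s)).
Proof.
rewrite /edge; case: ltngtP => [ij|ij|/val_inj <-]; case: ltngtP => [st|st|/val_inj <-];
  rewrite xpair_eqE ?orbb //; apply/idP/idP.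
all: try by move=> /andP[-> ->]; rewrite ?orbT.
all: try by move=> /andP[/eqP <- /eqP <-]; rewrite !eqxx ?orbT.
all: try by move=> /orP[/andP[/eqP ? /eqP ?]|/andP[/eqP ? /eqP ?]]; subst;
     rewrite ?eqxx//; first [by rewrite ltnn in ij|by rewrite ltnn in st|
     by have := ltn_trans ij st; rewrite ltnn].
all: by move=> /orP[] /andP[/eqP -> /eqP ->]; rewrite !eqxx.
Qed.

Lemma adjC i j a : adj i j a = adj j i a.
Proof. by rewrite /adj edgeC eq_sym. Qed.

Lemma adj_irrefl i a : adj i i a = 0.
Proof. by rewrite /adj eqxx. Qed.

Lemma adj_sqr i j a : adj i j a ^+ 2 = adj i j a.
Proof. by rewrite /adj expr2; case: (_ && _); rewrite ?mul1r ?mul0r. Qed.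

Lemma adj_ge0 i j a : 0 <= adj i j a.
Proof. exact: ler0n. Qed.

Lemma adj_le1 i j a : adj i j a <= 1.
Proof. by rewrite /adj; case: (_ && _); rewrite ?ler01. Qed.

Lemma adj_upd s t i j b a : s != t ->
  adj i j (upd (edge s t) b a) = if edge i j == edge s t then b%:R else adj i j a.
Proof.
move=> st; rewrite /adj updE; case: (edge i j =P _) => // ijst.
suff -> : i != j by [].
apply: contra st => /eqP ij; move: ijst; rewrite ij => /eqP; rewrite edge_eq.
by move=> /orP[] /andP[/eqP <- /eqP <-].
Qed.

Lemma edge_irrefl_neq s t i : s != t -> (edge i i == edge s t) = false.
Proof.
move=> st; rewrite edge_eq; apply/negbTE; apply: contra st.
by move=> /orP[] /andP[/eqP <- /eqP <-].
Qed.

Lemma diff_adj s t i j a : s != t ->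
  diff (edge s t) (adj i j) a = (edge i j == edge s t)%:R.
Proof. by move=> st; rewrite /diff !adj_upd//; case: eqP; rewrite ?subr0 ?subrr. Qed.

Lemma diff_cadj s t i j a : s != t ->
  diff (edge s t) (cadj i j) a = (edge i j == edge s t)%:R.
Proof. by move=> st; rewrite -(diff_adj _ _ a st) /diff /cadj; ring. Qed.

Lemma ignores_adj i j s t : s != t -> edge i j != edge s t -> ignores (edge s t) (adj i j).
Proof. by move=> st ij b a; rewrite adj_upd// (negbTE ij). Qed.

Lemma ignores_cadj i j s t : s != t -> edge i j != edge s t -> ignores (edge s t) (cadj i j).
Proof. by move=> st ij b a; rewrite /cadj ignores_adj. Qed.

Lemma cadj_upd s t i j b a : s != t ->
  cadj i j (upd (edge s t) b a) =
  if edge i j == edge s t then b%:R - q i j else cadj i j a.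
Proof. by move=> st; rewrite /cadj adj_upd//; case: ifP. Qed.

Lemma edge_selects s t (F : 'I_n -> 'I_n -> R) : s != t ->
  \sum_i \sum_j (edge i j == edge s t)%:R * F i j = F s t + F t s.
Proof.
move=> st.
have sel u (G : 'I_n -> R) : \sum_i (i == u)%:R * G i = G u.
  by rewrite (bigD1 u)//= eqxx mul1r big1 ?addr0// => i /negbTE->; rewrite mul0r.
transitivity (\sum_i ((i == s)%:R * F i t + (i == t)%:R * F i s)).
  apply: eq_bigr => i _; rewrite -(sel t (F i)) -(sel s (F i)) !big_distrr/= -big_split/=.
  apply: eq_bigr => j _; rewrite edge_eq.
  have [->|_] := eqVneq i s; rewrite ?(negbTE st)/= ?orbF ?mul1r ?mul0r ?addr0 ?add0r//.
  by case: (i == t); rewrite ?mul1r ?mul0r.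
by rewrite big_split/= !sel.
Qed.

Hypothesis q_sym : forall i j, q i j = q j i.
Hypothesis q_diag : forall i, q i i = 0.
Hypothesis q01 : forall i j, 0 <= q i j <= 1.

Lemma edge_weight01 e : 0 <= edge_weight e <= 1.
Proof. by rewrite /edge_weight; case: ifP => // _; rewrite lexx ler01. Qed.

Lemma edge_weightE i j : edge_weight (edge i j) = q i j.
Proof.
by rewrite /edge_weight /edge; case: (ltngtP i j) => /= [->|->|/val_inj <-];
  rewrite ?ltnn ?q_diag// q_sym.
Qed.

Lemma bvar_edge i j : bvar edge_weight (edge i j) = evar i j.
Proof. by rewrite /bvar edge_weightE. Qed.

Lemma evarC i j : evar i j = evar j i.
Proof. by rewrite /evar q_sym. Qed.

Lemma evar_diag i : evar i i = 0.
Proof. by rewrite /evar q_diag mul0r. Qed.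

Lemma evar_ge0 i j : 0 <= evar i j.
Proof. by rewrite -bvar_edge bvar_ge0//; exact: edge_weight01. Qed.

Lemma evar_le i j : evar i j <= q i j.
Proof. by rewrite -bvar_edge -edge_weightE bvar_le//; exact: edge_weight01. Qed.

Lemma cadjC i j a : cadj i j a = cadj j i a.
Proof. by rewrite /cadj adjC q_sym. Qed.

Lemma cadj_irrefl i a : cadj i i a = 0.
Proof. by rewrite /cadj adj_irrefl q_diag subr0. Qed.

Lemma cadjE i j a : i != j -> cadj i j a = centered edge_weight (edge i j) a.
Proof. by move=> ij; rewrite /cadj /centered edge_weightE /adj ij. Qed.

Lemma cadj_sqr i j a : cadj i j a ^+ 2 = evar i j + (1 - 2 * q i j) * cadj i j a.
Proof.
rewrite /cadj sqrrB adj_sqr /evar; ring.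
Qed.

Lemma cadj_norm i j a : `|cadj i j a| <= 1.
Proof.
have /andP[? ?] := q01 i j; have ? := adj_ge0 i j a; have ? := adj_le1 i j a.
by rewrite /cadj ler_norml; lra.
Qed.

Local Notation Eq := (Ex edge_weight).

Lemma Ex_adj_mul i j F : ignores (edge i j) F ->
  Eq (fun a => adj i j a * F a) = q i j * Eq F.
Proof.
have [<- _|ij Fij] := eqVneq i j.
  rewrite q_diag mul0r -[RHS](Ex_cst edge_weight); apply: eq_Ex => a.
  by rewrite adj_irrefl mul0r.
have := Ex_bernoulli_mul edge_weight (fun b : bool => b%:R) Fij.
rewrite edge_weightE /= mulr0 addr0 mulr1 => <-.
by apply: eq_Ex => a; rewrite /adj ij.
Qed.

Lemma Ex_adj i j : Eq (adj i j) = q i j.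
Proof.
rewrite -[RHS]mulr1 -(Ex_cst edge_weight 1) -Ex_adj_mul//.
by apply: eq_Ex => a; rewrite mulr1.
Qed.

Lemma Ex_cadj_mul i j F : i != j ->
  Eq (fun a => cadj i j a * F a) = evar i j * Eq (diff (edge i j) F).
Proof.
move=> ij; rewrite -bvar_edge -Ex_ibp; apply: eq_Ex => a.
by rewrite cadjE.
Qed.

Lemma Ex_cadj_ignores i j F : i != j -> ignores (edge i j) F ->
  Eq (fun a => cadj i j a * F a) = 0.
Proof.
move=> ij Fij; rewrite Ex_cadj_mul// -[RHS](mulr0 (evar i j)); congr (_ * _).
by rewrite -(Ex_cst edge_weight 0); apply: eq_Ex => a; rewrite /diff !Fij subrr.
Qed.

Lemma Ex_cadj_sqr i j F : ignores (edge i j) F ->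
  Eq (fun a => cadj i j a ^+ 2 * F a) = evar i j * Eq F.
Proof.
have [<- _|ij] := eqVneq i j.
  rewrite evar_diag mul0r -[RHS](Ex_cst edge_weight); apply: eq_Ex => a.
  by rewrite cadj_irrefl expr0n mul0r.
move=> Fij; rewrite -bvar_edge -Ex_centered_sqr_mul//; apply: eq_Ex => a.
by rewrite cadjE.
Qed.

(** Conditionally on the other edges, the summands are independent and centred,
   since they use distinct edges at [k]. *)
Lemma Ex_star_sqr k (Y : 'I_n -> config -> R) :
  (forall t t', t' != k -> ignores (edge k t') (Y t)) ->
  Eq (fun a => (\sum_t cadj k t a * Y t a) ^+ 2) =
  \sum_t evar k t * Eq (fun a => Y t a ^+ 2).
Proof.
move=> YF.
transitivity (\sum_t \sum_t' Eq (fun a => cadj k t a * Y t a * (cadj k t' a * Y t' a))).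
  under [RHS]eq_bigr => t _ do rewrite -Ex_sum.
  rewrite -Ex_sum; apply: eq_Ex => a; rewrite expr2 big_distrl/=.
  by apply: eq_bigr => t _; rewrite big_distrr.
apply: eq_bigr => t _; rewrite (bigD1 t)//= [X in _ + X]big1 ?addr0.
- have [->|tk] := eqVneq t k.
    rewrite evar_diag mul0r -[RHS](Ex_cst edge_weight); apply: eq_Ex => a.
    by rewrite cadj_irrefl !mul0r.
  rewrite -Ex_cadj_sqr; first by apply: eq_Ex => a; ring.
  by move=> b a; rewrite YF.
- move=> t' t't.
  have [->|tk] := eqVneq t k.
    by rewrite -[RHS](Ex_cst edge_weight); apply: eq_Ex => a; rewrite cadj_irrefl !mul0r.
  rewrite (eq_Ex _ (_ : _ =1 (fun a => cadj k t a * (Y t a * (cadj k t' a * Y t' a))))).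
    rewrite Ex_cadj_ignores 1?eq_sym// => b a.
    rewrite !YF// ignores_cadj 1?eq_sym// edge_eq eqxx/= eq_sym (negbTE t't)/=.
    by rewrite (negbTE tk) andbF.
  by move=> a; ring.
Qed.

Lemma poincare_edges F :
  variance edge_weight F <=
  2^-1 * \sum_s \sum_t evar s t * Eq (fun a => diff (edge s t) F a ^+ 2).
Proof.
rewrite (le_trans (poincare edge_weight01 F))//.
rewrite -sum_lt_half; first last.
- by move=> i; rewrite evar_diag mul0r.
- by move=> i j; rewrite evarC edgeC.
rewrite -(pair_bigA _ (fun i j => bvar edge_weight (i, j) * Eq (fun a => diff (i, j) F a ^+ 2)))/=.
apply: ler_sum => i _; rewrite [leRHS]big_mkcond/=; apply: ler_sum => j _.
case: ifP => ij; first by rewrite -bvar_edge /edge ij.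
by rewrite /bvar /edge_weight/= ij !mul0r.
Qed.

End Edges.

Section TriangleCalculus.
Context {R : realFieldType} {n : nat} (c : 'M[R]_n).
Local Notation config := {ffun 'I_n * 'I_n -> bool}.
Implicit Types (a : config) (i j k s t : 'I_n).
Hypothesis c_diag : forall i, c i i = 0.

(** At most one of the three edges of a triangle can be the one that is
   flipped. *)
Lemma diff_triangle s t i j k a : s != t ->
  diff (edge s t) (fun a => cadj c i j a * cadj c i k a * cadj c j k a) a =
  (edge i j == edge s t)%:R * (cadj c i k a * cadj c j k a) +
  (edge i k == edge s t)%:R * (cadj c i j a * cadj c j k a) +
  (edge j k == edge s t)%:R * (cadj c i j a * cadj c i k a).
Proof.
move=> st; rewrite /diff !cadj_upd//.
have two x y z : edge x y = edge s t -> edge x z = edge s t -> y = z.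
  move=> /eqP + /eqP; rewrite !edge_eq.
  move=> /orP[] /andP[/eqP xs /eqP ys] /orP[] /andP[/eqP xs' /eqP zs]; rewrite ?ys ?zs//.
  - by move: st; rewrite -xs -xs' eqxx.
  - by move: st; rewrite -xs -xs' eqxx.
have irr x : edge x x == edge s t -> False by rewrite edge_irrefl_neq.
have [ij|ij] := eqVneq (edge i j) (edge s t); have [ik|ik] := eqVneq (edge i k) (edge s t);
  have [jk|jk] := eqVneq (edge j k) (edge s t); try by rewrite /=; ring.
- by have := two _ _ _ ij ik => jk'; rewrite -jk' in jk; case: (irr j); apply/eqP.
- have := two _ _ _ ij ik => <-.
  by rewrite /cadj adj_irrefl c_diag /=; ring.
- have jk' : i = k by apply: (two j); rewrite // edgeC.
  by rewrite -jk' /cadj adj_irrefl c_diag /=; ring.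
- have jk' : i = j by apply: (two k); rewrite edgeC.
  by rewrite -jk' /cadj adj_irrefl c_diag /=; ring.
Qed.

End TriangleCalculus.

(** * A polynomial of degree three in the edges and Stein's identity *)

Section Chaos.
Context {R : realFieldType} {n : nat} (q : 'M[R]_n).
Context (l : 'I_n -> 'I_n -> R) (C : 'I_n -> 'I_n -> 'I_n -> R).
Local Notation config := {ffun 'I_n * 'I_n -> bool}.
Implicit Types (a : config) (F : config -> R) (i j k s t : 'I_n).

Hypothesis q_sym : forall i j, q i j = q j i.
Hypothesis q_diag : forall i, q i i = 0.
Hypothesis q01 : forall i j, 0 <= q i j <= 1.
Hypothesis l_sym : forall i j, l i j = l j i.
Hypothesis C_sym12 : forall i j k, C i j k = C j i k.
Hypothesis C_sym23 : forall i j k, C i j k = C i k j.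

Local Notation Eq := (Ex (edge_weight q)).
Local Notation xi := (cadj q).
Local Notation v := (evar q).
Let ew01 := edge_weight01 q01.

Definition path_sum s t a : R := \sum_k C s t k * xi s k a * xi t k a.

Definition path_sum_but k s t a : R := \sum_(j | j != k) C s t j * xi s j a * xi t j a.

(** The factors undo the repetitions: a pair of vertices occurs in two orders,
   and a triangle is met from each of its three edges. *)
Definition chaos a : R :=
  2^-1 * \sum_s \sum_t xi s t a * (l s t + 3^-1 * path_sum s t a).

(** Integration by parts at an edge multiplies its variance, the factor of the
   edge in [chaos], and the derivative of [chaos] along the edge. *)
Definition stein_kernel a : R :=
  2^-1 * \sum_s \sum_t
    v s t * ((l s t + 3^-1 * path_sum s t a) * (l s t + path_sum s t a)).

Definition chaos_var : R :=
  2^-1 * \sum_s \sum_t v s t * l s t ^+ 2 +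
  6^-1 * \sum_s \sum_t \sum_k C s t k ^+ 2 * (v s t * v s k * v t k).

Lemma path_sumC s t a : path_sum s t a = path_sum t s a.
Proof. by apply: eq_bigr => k _; rewrite C_sym12 mulrAC. Qed.

(** Isolates the only summand that involves the edges between [k] and [s], [t]. *)
Lemma path_sum_split k s t a :
  path_sum s t a = path_sum_but k s t a + xi s k a * (C s t k * xi t k a).
Proof. by rewrite /path_sum (bigD1 k)//= addrC; congr (_ + _); ring. Qed.

Lemma path_sum_but_upd s t k b a : t != s -> t != k -> s != k ->
  path_sum_but k s t (upd (edge s k) b a) = path_sum_but k s t a.
Proof.
move=> ts tk sk; apply: eq_bigr => j jk.
rewrite !cadj_upd// !edge_eq eqxx (negbTE jk) (negbTE sk) (negbTE ts) (negbTE tk).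
by rewrite andbF !andFb.
Qed.

Lemma ignores_cadj_edge s t k : t != s -> t != k -> s != k -> ignores (edge s k) (xi t k).
Proof.
move=> ts tk sk; apply: ignores_cadj => //.
by rewrite edge_eq (negbTE ts) (negbTE tk).
Qed.

Lemma path_sum_upd s t k b a : t != s -> t != k -> s != k ->
  path_sum s t (upd (edge s k) b a) =
  path_sum_but k s t a + (b%:R - q s k) * (C s t k * xi t k a).
Proof.
move=> ts tk sk; rewrite (path_sum_split k) path_sum_but_upd//.
by rewrite (ignores_cadj_edge ts tk sk) cadj_upd// eqxx.
Qed.

Lemma ignores_path_sum_disjoint s k i j : s != k ->
  i != s -> i != k -> j != s -> j != k -> ignores (edge s k) (path_sum i j).
Proof.
move=> sk is_ ik js jk b a; apply: eq_bigr => m _.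
by rewrite !cadj_upd// !edge_eq (negbTE is_) (negbTE ik) (negbTE js) (negbTE jk).
Qed.

Lemma ignores_path_sum s t : s != t -> ignores (edge s t) (path_sum s t).
Proof.
move=> st b a; apply: eq_bigr => k _; rewrite !cadj_upd// !edge_eq !eqxx (negbTE st) /=.
rewrite orbF [t == s]eq_sym (negbTE st)/=.
have [->|kt] := eqVneq k t.
  by rewrite [t == s]eq_sym (negbTE st) !(cadj_irrefl q_diag) !mulr0.
by have [->|//] := eqVneq k s; rewrite !(cadj_irrefl q_diag) !mulr0 !mul0r.
Qed.

(** The polynomial is multilinear and symmetric: an edge occurs twice in the
   double sum and each triangle on it six times, which the factors cancel. *)
Lemma diff_chaos s t a : s != t ->
  diff (edge s t) chaos a = l s t + path_sum s t a.
Proof.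
move=> st.
have -> : chaos = fun a => \sum_i \sum_j ((2^-1 * l i j) * xi i j a) +
    \sum_i \sum_j \sum_k ((6^-1 * C i j k) * (xi i j a * xi i k a * xi j k a)).
  apply: boolp.funext => a'; rewrite /chaos big_distrr -big_split/=.
  apply: eq_bigr => i _; rewrite big_distrr -big_split/=.
  apply: eq_bigr => j _; rewrite mulrDr mulrDr; congr (_ + _); first by ring.
  rewrite /path_sum !big_distrr/=; apply: eq_bigr => k _.
  by field.
rewrite /diff opprD addrACA; congr (_ + _).
  rewrite -sumrB (eq_bigr (fun i => \sum_j (edge i j == edge s t)%:R * (2^-1 * l i j))).
    by rewrite edge_selects// [l t s]l_sym; field.
  move=> i _; rewrite -sumrB; apply: eq_bigr => j _.
  by rewrite -mulrBr -[_ - _]/(diff (edge s t) (xi i j) a) diff_cadj// mulrC.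
transitivity (\sum_i \sum_j \sum_k ((edge i j == edge s t)%:R * (6^-1 * C i j k * (xi i k a * xi j k a))
    + (edge i k == edge s t)%:R * (6^-1 * C i j k * (xi i j a * xi j k a))
    + (edge j k == edge s t)%:R * (6^-1 * C i j k * (xi i j a * xi i k a)))).
  rewrite -sumrB; apply: eq_bigr => i _; rewrite -sumrB; apply: eq_bigr => j _.
  rewrite -sumrB; apply: eq_bigr => k _; rewrite -mulrBr.
  rewrite -[_ - _]/(diff (edge s t) (fun a => xi i j a * xi i k a * xi j k a) a).
  by rewrite diff_triangle//; ring.
under eq_bigr => i _ do (under eq_bigr => j _ do rewrite !big_split/=).
under eq_bigr => i _ do rewrite !big_split/=.
rewrite !big_split/=.
have T1 : \sum_i \sum_j \sum_k (edge i j == edge s t)%:R * (6^-1 * C i j k * (xi i k a * xi j k a))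
   = 3^-1 * path_sum s t a.
  under eq_bigr => i _ do (under eq_bigr => j _ do rewrite -big_distrr/=).
  rewrite edge_selects// -big_split/= /path_sum big_distrr/=; apply: eq_bigr => k _.
  by rewrite [C t s k]C_sym12; field.
have T2 : \sum_i \sum_j \sum_k (edge i k == edge s t)%:R * (6^-1 * C i j k * (xi i j a * xi j k a))
   = 3^-1 * path_sum s t a.
  rewrite -T1; apply: eq_bigr => i _; rewrite exchange_big/=; apply: eq_bigr => j _.
  by apply: eq_bigr => k _; rewrite C_sym23 (cadjC q_sym k j).
rewrite T1 T2.
have -> : \sum_i \sum_j \sum_k (edge j k == edge s t)%:R * (6^-1 * C i j k * (xi i j a * xi i k a))
   = 3^-1 * path_sum s t a.
  rewrite -T1 exchange_big/=; apply: eq_bigr => i _; rewrite exchange_big/=.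
  apply: eq_bigr => j _; apply: eq_bigr => k _.
  by rewrite C_sym12 C_sym23 (cadjC q_sym k i) (cadjC q_sym k j).
by field.
Qed.

Lemma Ex_chaos_mul F : Eq (fun a => chaos a * F a) =
  2^-1 * \sum_s \sum_t v s t *
    Eq (fun a => (l s t + 3^-1 * path_sum s t a) * diff (edge s t) F a).
Proof.
transitivity (Eq (fun a => 2^-1 * \sum_s \sum_t
    xi s t a * ((l s t + 3^-1 * path_sum s t a) * F a))).
  apply: eq_Ex => a; rewrite /chaos -mulrA; congr (_ * _).
  rewrite big_distrl; apply: eq_bigr => s _; rewrite big_distrl.
  by apply: eq_bigr => t _; rewrite mulrA.
rewrite ExZ Ex_sum; congr (_ * _); apply: eq_bigr => s _.
rewrite Ex_sum; apply: eq_bigr => t _.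
have [->|st] := eqVneq s t.
  rewrite evar_diag// mul0r -[RHS](Ex_cst (edge_weight q)); apply: eq_Ex => a.
  by rewrite (cadj_irrefl q_diag) mul0r.
rewrite Ex_cadj_mul//; congr (_ * _); apply: eq_Ex => a.
by rewrite diff_ignores_mul// => b a'; rewrite ignores_path_sum.
Qed.

Lemma Ex_chaos : Eq chaos = 0.
Proof.
rewrite (eq_Ex _ (_ : _ =1 (fun a => chaos a * 1))) => [|a]; last by rewrite mulr1.
rewrite Ex_chaos_mul big1 ?mulr0// => s _; rewrite big1// => t _.
rewrite [Ex _ _](_ : _ = 0) ?mulr0// -[RHS](Ex_cst (edge_weight q)).
by apply: eq_Ex => a; rewrite /diff subrr mulr0.
Qed.

Lemma Ex_path_sum s t : s != t -> Eq (path_sum s t) = 0.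
Proof.
move=> st; rewrite /path_sum Ex_sum big1// => k _.
have [<-|sk] := eqVneq s k.
  rewrite -[RHS](Ex_cst (edge_weight q)); apply: eq_Ex => a.
  by rewrite (cadj_irrefl q_diag) !mulr0 mul0r.
have [<-|tk] := eqVneq t k.
  rewrite -[RHS](Ex_cst (edge_weight q)); apply: eq_Ex => a.
  by rewrite (cadj_irrefl q_diag) !mulr0.
rewrite (eq_Ex _ (_ : _ =1 (fun a => xi s k a * (C s t k * xi t k a)))) => [|a]; last by ring.
rewrite Ex_cadj_ignores// => b a; rewrite ignores_cadj_edge// eq_sym//.
Qed.

(** Paths through different third vertices are uncorrelated. *)
Lemma Ex_path_sum_sqr_gen (P : pred 'I_n) s t : s != t ->
  Eq (fun a => (\sum_(k | P k) C s t k * xi s k a * xi t k a) ^+ 2) =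
  \sum_(k | P k) C s t k ^+ 2 * (v s k * v t k).
Proof.
move=> st.
pose Y k a := if P k && (k != s) then C s t k * xi t k a else 0.
transitivity (Eq (fun a => (\sum_k xi s k a * Y k a) ^+ 2)).
  apply: eq_Ex => a; congr (_ ^+ 2); rewrite big_mkcond/=; apply: eq_bigr => k _.
  rewrite /Y; case: (P k) => /=; last by rewrite mulr0.
  have [->|ks] := eqVneq k s; first by rewrite (cadj_irrefl q_diag) /= !mulr0 mul0r.
  by rewrite /=; ring.
rewrite Ex_star_sqr//; last first.
  move=> k k' k's b a; rewrite /Y; case: ifP => // /andP[_ ks].
  congr (_ * _); apply: ignores_cadj; first by rewrite eq_sym.
  by rewrite edge_eq (eq_sym t s) (negbTE st) (negbTE ks) andbF.
rewrite [RHS]big_mkcond/=; apply: eq_bigr => k _; rewrite /Y.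
case: (P k) => /=; last first.
  by rewrite expr0n/= Ex_cst mulr0.
have [->|ks] := eqVneq k s; first by rewrite evar_diag// !mul0r mulr0.
rewrite /= (eq_Ex _ (_ : _ =1 (fun a => C s t k ^+ 2 * (xi t k a ^+ 2 * 1)))) => [|a]; last by ring.
by rewrite ExZ Ex_cadj_sqr// Ex_cst; ring.
Qed.

Lemma Ex_path_sum_sqr s t : s != t ->
  Eq (fun a => path_sum s t a ^+ 2) = \sum_k C s t k ^+ 2 * (v s k * v t k).
Proof. exact: Ex_path_sum_sqr_gen. Qed.

Lemma Ex_stein_kernel : Eq stein_kernel = chaos_var.
Proof.
rewrite /stein_kernel ExZ Ex_sum /chaos_var.
rewrite (eq_bigr (fun s => \sum_t v s t * l s t ^+ 2 +
     3^-1 * \sum_t \sum_k C s t k ^+ 2 * (v s t * v s k * v t k))).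
  by rewrite big_split/= -big_distrr/=; field.
move=> s _; rewrite Ex_sum big_distrr/= -big_split/=; apply: eq_bigr => t _.
have [<-|st] := eqVneq s t.
  rewrite evar_diag// mul0r big1 ?mulr0 ?addr0; last first.
    by move=> k _; rewrite !mul0r mulr0.
  by rewrite -[RHS](Ex_cst (edge_weight q)); apply: eq_Ex => a; rewrite mul0r.
rewrite ExZ (eq_Ex _ (_ : _ =1 (fun a => l s t ^+ 2 + (4 / 3 * l s t) * path_sum s t a +
   3^-1 * path_sum s t a ^+ 2))) => [|a]; last by field.
rewrite !ExD !ExZ Ex_cst Ex_path_sum// mulr0 addr0 Ex_path_sum_sqr// mulrDr.
congr (_ + _); rewrite mulrCA; congr (_ * _); rewrite big_distrr/=.
by apply: eq_bigr => k _; ring.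
Qed.

(** Integration by parts at every edge replaces [Z f(Z)] by the kernel times
   difference quotients of [f], which are [f'(Z)] up to a Taylor term of second
   order. The first error comes from replacing the kernel by its mean. *)
Lemma chaos_stein (f f' : R -> R) (K s : R) : 0 < s -> s ^+ 2 = chaos_var ->
  (forall x, `|f' x| <= K) ->
  (forall x y, `|f y - f x - f' x * (y - x)| <= K * (y - x) ^+ 2) ->
  `|Eq (fun a => f' (chaos a / s) - chaos a / s * f (chaos a / s))| <=
  K * (Eq (fun a => `|stein_kernel a - chaos_var|) / s ^+ 2 +
       2^-1 * (\sum_i \sum_j v i j * Eq (fun a =>
         `|l i j + 3^-1 * path_sum i j a| * (l i j + path_sum i j a) ^+ 2)) / s ^+ 3).
Proof.
move=> s0 s2 f'K fK.
have K0 : 0 <= K by rewrite (le_trans _ (f'K 0)).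
pose g i j a := l i j + 3^-1 * path_sum i j a.
pose h i j a := l i j + path_sum i j a.
pose F a := f (chaos a / s).
(* [f] may be expanded at either end of the increment, and thus at the
   configuration itself, whatever the state of the edge. *)
have fdiff (x x1 x0 : R) : x = x1 \/ x = x0 ->
    `|f x1 - f x0 - f' x * (x1 - x0)| <= K * (x1 - x0) ^+ 2.
  case=> ->; last exact: fK.
  have := fK x1 x0; rewrite -normrN.
  have -> : - (f x0 - f x1 - f' x1 * (x0 - x1)) = f x1 - f x0 - f' x1 * (x1 - x0) by ring.
  by rewrite -[(x0 - x1) ^+ 2]sqrrN opprB.
have step i j a : i != j ->
    `|diff (edge i j) F a - f' (chaos a / s) * (h i j a / s)| <= K * (h i j a / s) ^+ 2.
  move=> ij; rewrite /h -(diff_chaos a ij) /diff -[F (upd _ true a)]/(f _) -[F (upd _ false a)]/(f _).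
  rewrite mulrBl; apply: fdiff; rewrite -[in chaos a](upd_id (edge i j) a).
  by case: (a (edge i j)); [left|right].
have -> : Eq (fun a => f' (chaos a / s) - chaos a / s * f (chaos a / s)) =
   Eq (fun a => f' (chaos a / s) * (1 - stein_kernel a / s ^+ 2)) -
   s^-1 * (2^-1 * \sum_i \sum_j v i j * Eq (fun a =>
      g i j a * (diff (edge i j) F a - f' (chaos a / s) * (h i j a / s)))).
  rewrite ExB (eq_Ex _ (_ : (fun a => chaos a / s * f (chaos a / s)) =1
      (fun a => s^-1 * (chaos a * F a)))) => [|a]; last by rewrite /F; ring.
  rewrite ExZ Ex_chaos_mul.
  transitivity (Eq (fun a => f' (chaos a / s)) - s^-1 * (2^-1 * \sum_i \sum_j v i j *
      (Eq (fun a => f' (chaos a / s) * (g i j a * (h i j a / s))) +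
       Eq (fun a => g i j a * (diff (edge i j) F a - f' (chaos a / s) * (h i j a / s)))))).
    congr (_ - _ * (_ * _)); apply: eq_bigr => i _; apply: eq_bigr => j _.
    by congr (_ * _); rewrite -ExD; apply: eq_Ex => a; rewrite /g; ring.
  under eq_bigr => i _ do (under eq_bigr => j _ do rewrite mulrDr).
  under eq_bigr => i _ do rewrite big_split/=.
  rewrite big_split/= !mulrDr opprD addrA; congr (_ - _).
  rewrite (eq_Ex _ (_ : (fun a => f' (chaos a / s) * (1 - stein_kernel a / s ^+ 2)) =1
      (fun a => f' (chaos a / s) - s^-1 * (2^-1 * \sum_i \sum_j
         v i j * (f' (chaos a / s) * (g i j a * (h i j a / s))))))) => [|a]; last first.
    rewrite mulrBr mulr1; congr (_ - _); rewrite /stein_kernel.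
    rewrite (_ : \sum_i \sum_j v i j * (f' (chaos a / s) * (g i j a * (h i j a / s))) =
       f' (chaos a / s) / s * \sum_i \sum_j v i j * (g i j a * h i j a)).
      by rewrite expr2 invfM; ring.
    rewrite big_distrr/=; apply: eq_bigr => i _; rewrite big_distrr/=.
    by apply: eq_bigr => j _; ring.
  rewrite ExB; congr (_ - _); rewrite !ExZ; congr (_ * (_ * _)).
  by rewrite Ex_sum; apply: eq_bigr => i _; rewrite Ex_sum; apply: eq_bigr => j _; rewrite ExZ.
rewrite (le_trans (ler_normB _ _))// mulrDr lerD//.
  rewrite (le_trans (Ex_norm ew01 _))// -ExZr -ExZ; apply: le_Ex => // a.
  rewrite normrM ler_pM// -s2 (_ : 1 - _ = - ((stein_kernel a - s ^+ 2) / s ^+ 2)).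
    by rewrite normrN normrM [ `|_^-1|]ger0_norm ?invr_ge0 ?sqr_ge0.
  by field; rewrite gt_eqF.
pose Y := \sum_i \sum_j v i j * Eq (fun a => `|g i j a| * h i j a ^+ 2).
rewrite -/Y; apply: (@le_trans _ _ (s^-1 * (2^-1 * (K / s ^+ 2 * Y)))); last first.
  by apply: eq_ler; rewrite /Y; field; rewrite gt_eqF.
have s0' : 0 <= s^-1 by rewrite invr_ge0 ltW.
rewrite normrM (ger0_norm s0') ler_wpM2l// normrM ger0_norm ?invr_ge0// ler_wpM2l ?invr_ge0//.
rewrite /Y.
rewrite (le_trans (ler_norm_sum _ _ _))// big_distrr/=; apply: ler_sum => i _.
rewrite (le_trans (ler_norm_sum _ _ _))// big_distrr/=; apply: ler_sum => j _.
have [->|ij] := eqVneq i j; first by rewrite evar_diag// !mul0r mulr0 normr0.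
rewrite normrM ger0_norm ?evar_ge0// mulrCA ler_wpM2l ?evar_ge0//.
rewrite (le_trans (Ex_norm ew01 _))// -ExZ; apply: le_Ex => // a.
rewrite normrM [leRHS](_ : _ = `|g i j a| * (K * (h i j a / s) ^+ 2)).
  by rewrite ler_wpM2l// step.
by field; rewrite gt_eqF.
Qed.

End Chaos.

(** * Fluctuations of the Stein kernel *)

Section Elementary.
Context {R : realFieldType}.

Lemma sumr_const_ord n (c : R) : \sum_(i < n) c = n%:R * c.
Proof. by rewrite sumr_const card_ord mulr_natl. Qed.

Lemma ler_sum_const n (F : 'I_n -> R) (M : R) :
  (forall i, F i <= M) -> \sum_i F i <= n%:R * M.
Proof.
move=> FM; rewrite (le_trans (ler_sum _ (fun i _ => FM i)))//.
by rewrite sumr_const card_ord mulr_natl.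
Qed.

Lemma ler_sum_const_cond n (P : pred 'I_n) (F : 'I_n -> R) (M : R) : 0 <= M ->
  (forall i, P i -> F i <= M) -> \sum_(i | P i) F i <= n%:R * M.
Proof.
move=> M0 FM; rewrite big_mkcond ler_sum_const// => i.
by case: ifP => // /FM.
Qed.

Lemma ler_norm_sum_const n (F : 'I_n -> R) (M : R) :
  (forall i, `|F i| <= M) -> `|\sum_i F i| <= n%:R * M.
Proof. by move=> FM; rewrite (le_trans (ler_norm_sum _ _ _))// ler_sum_const. Qed.

Lemma sqr_add2 (x y : R) : (x + y) ^+ 2 <= 2 * x ^+ 2 + 2 * y ^+ 2.
Proof. by have := sqr_ge0 (x - y); nra. Qed.

Lemma sqr_add3 (x y z : R) :
  (x + y + z) ^+ 2 <= 3 * x ^+ 2 + 3 * y ^+ 2 + 3 * z ^+ 2.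
Proof.
by have := sqr_ge0 (x - y); have := sqr_ge0 (x - z); have := sqr_ge0 (y - z); nra.
Qed.

Lemma sqr_le_norm (x M : R) : `|x| <= M -> x ^+ 2 <= M ^+ 2.
Proof. by move=> xM; rewrite -(real_normK (num_real x)) ler_pXn2r// nnegrE (le_trans (normr_ge0 x)). Qed.

(** Used with a free parameter [m] in place of the Cauchy-Schwarz inequality,
   which would bring in square roots. *)
Lemma norm_le_sqr (x m : R) : 0 < m -> `|x| <= 2^-1 * (m + x ^+ 2 / m).
Proof.
move=> m0; have -> : x ^+ 2 = `|x| ^+ 2 by rewrite real_normK ?num_real.
have : 0 <= (`|x| - m) ^+ 2 / m by rewrite divr_ge0 ?sqr_ge0// ltW.
have -> : (`|x| - m) ^+ 2 / m = `|x| ^+ 2 / m - 2 * `|x| + m by field; rewrite gt_eqF.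
lra.
Qed.

Lemma sum_indicator n (u : 'I_n) (G : 'I_n -> R) : \sum_i (i == u)%:R * G i = G u.
Proof.
by rewrite (bigD1 u)//= eqxx mul1r big1 ?addr0// => i /negbTE->; rewrite mul0r.
Qed.

(** The summands in the Efron-Stein inequality for a function of the edges at
   [s] and [t] vanish on pairs that avoid both vertices. *)
Lemma sum_edges_touching n (H : 'I_n -> 'I_n -> R) (s t : 'I_n) :
  (forall i j, 0 <= H i j) -> (forall i j, H i j = H j i) ->
  (forall i j, i != s -> i != t -> j != s -> j != t -> H i j = 0) ->
  2^-1 * (\sum_i \sum_j H i j) <= \sum_b H s b + \sum_b H t b.
Proof.
move=> H0 HC Hst.
apply: (@le_trans _ _ (2^-1 * \sum_i \sum_j ((i == s)%:R * H i j + (i == t)%:R * H i j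
    + (j == s)%:R * H j i + (j == t)%:R * H j i))).
  rewrite ler_wpM2l ?invr_ge0//; apply: ler_sum => i _; apply: ler_sum => j _.
  have [->|is_] := eqVneq i s; first by rewrite mul1r -!addrA lerDl; nonneg.
  have [->|it] := eqVneq i t; first by rewrite mul1r mul0r add0r -!addrA lerDl; nonneg.
  have [->|js] := eqVneq j s; first by rewrite mul1r !mul0r !add0r HC lerDl; nonneg.
  have [->|jt] := eqVneq j t; first by rewrite mul1r !mul0r !add0r HC.
  by rewrite !mul0r !addr0 Hst.
under eq_bigr => i _ do rewrite !big_split/=.
rewrite !big_split/=.
have S1 u : \sum_i \sum_j (i == u)%:R * H i j = \sum_b H u b.
  by under eq_bigr => i _ do rewrite -big_distrr/=; rewrite sum_indicator.
have S2 u : \sum_i \sum_j (j == u)%:R * H j i = \sum_b H u b.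
  by rewrite exchange_big S1.
by rewrite !S1 !S2; lra.
Qed.

(** Moments of even order are computable; the cubic term in [y] is split between
   the orders 2 and 4 with weight [lam]. *)
Lemma cubic_bound (x y L lam : R) : `|x| <= L -> 0 < lam ->
  `|x + 3^-1 * y| * (x + y) ^+ 2 <=
  4 * L * x ^+ 2 + 2 * lam * y ^+ 2 + 2 / lam * y ^+ 4.
Proof.
move=> xL lam0.
rewrite -addrA -[x ^+ 2](real_normK (num_real x)) (_ : y ^+ 4 = (`|y| ^+ 2) ^+ 2); last first.
  by rewrite real_normK ?num_real// -exprM.
rewrite -[y ^+ 2](real_normK (num_real y)).
have gxy : `|x + 3^-1 * y| <= `|x| + `|y|.
  rewrite (le_trans (ler_normD _ _))// lerD2l normrM ger0_norm ?invr_ge0//.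
  by rewrite ler_piMl// invf_le1 ?ler1n.
have hxy : (x + y) ^+ 2 <= 2 * `|x| ^+ 2 + 2 * `|y| ^+ 2.
  by rewrite !real_normK ?num_real// sqr_add2.
move: xL; move: (normr_ge0 x) (normr_ge0 y) gxy hxy.
set X := `|x|; set Y := `|y| => X0 Y0 gxy hxy XL.
apply: (le_trans (ler_pM (normr_ge0 _) (sqr_ge0 _) gxy hxy)).
have XY : (X + Y) * (2 * X ^+ 2 + 2 * Y ^+ 2) <= 4 * (X ^+ 2 * X) + 4 * Y ^+ 3.
  have : 0 <= 2 * (X + Y) * (X - Y) ^+ 2 by nonneg.
  have -> : 2 * (X + Y) * (X - Y) ^+ 2 =
      4 * (X ^+ 2 * X) + 4 * Y ^+ 3 - (X + Y) * (2 * X ^+ 2 + 2 * Y ^+ 2) by ring.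
  by rewrite subr_ge0.
rewrite (le_trans XY)// lerD//.
  by rewrite -mulrA ler_wpM2l// mulrC ler_wpM2r ?sqr_ge0.
have : 0 <= 2 * Y ^+ 2 / lam * (lam - Y) ^+ 2.
  by nonneg.
have -> : 2 * Y ^+ 2 / lam * (lam - Y) ^+ 2 =
    2 * lam * Y ^+ 2 + 2 / lam * (Y ^+ 2) ^+ 2 - 4 * Y ^+ 3.
  by field; rewrite gt_eqF.
by rewrite subr_ge0.
Qed.

End Elementary.

Section ChaosBounds.
Local Opaque evar.
Context {R : realFieldType} {n : nat} (q : 'M[R]_n).
Context (l : 'I_n -> 'I_n -> R) (C : 'I_n -> 'I_n -> 'I_n -> R) (p c L : R).
Local Notation config := {ffun 'I_n * 'I_n -> bool}.
Implicit Types (a : config) (F : config -> R) (i j k s t : 'I_n).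

Hypothesis q_sym : forall i j, q i j = q j i.
Hypothesis q_diag : forall i, q i i = 0.
Hypothesis q01 : forall i j, 0 <= q i j <= 1.
Hypothesis q_le : forall i j, q i j <= p.
Hypothesis p_ge0 : 0 <= p.
Hypothesis l_sym : forall i j, l i j = l j i.
Hypothesis C_sym12 : forall i j k, C i j k = C j i k.
Hypothesis C_sym23 : forall i j k, C i j k = C i k j.
Hypothesis l_le : forall i j, `|l i j| <= L.
Hypothesis C_le : forall i j k, `|C i j k| <= c.

Local Notation Eq := (Ex (edge_weight q)).
Local Notation xi := (cadj q).
Local Notation v := (evar q).
Local Notation N := (n%:R : R).
Local Notation Q := (path_sum q C).
Let ew01 := edge_weight01 q01.

Let v_ge0 i j : 0 <= v i j. Proof. exact: evar_ge0. Qed.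
Let v_le i j : v i j <= p. Proof. by rewrite (le_trans (evar_le _ _ _ _ _)). Qed.
Let vv_ge0 i j s t : 0 <= v i j * v s t. Proof. exact: mulr_ge0. Qed.
Let vv_le i j s t : v i j * v s t <= p * p. Proof. exact: ler_pM. Qed.
Let N_ge0 : 0 <= N. Proof. exact: ler0n. Qed.
Let C_sqr i j k : C i j k ^+ 2 <= c ^+ 2. Proof. exact: sqr_le_norm. Qed.
Let l_sqr i j : l i j ^+ 2 <= L ^+ 2. Proof. exact: sqr_le_norm. Qed.
Let q_twice i j : (1 - 2 * q i j) ^+ 2 <= 1.
Proof. by have /andP[? ?] := q01 i j; nra. Qed.

Lemma Ex_path_sum_sqr_le s t : s != t -> Eq (fun a => Q s t a ^+ 2) <= N * (c ^+ 2 * (p * p)).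
Proof.
move=> st; rewrite Ex_path_sum_sqr//; apply: ler_sum_const => k.
by apply: ler_pM; rewrite ?sqr_ge0.
Qed.

Lemma Ex_path_sum_but_sqr_le k s t : s != t ->
  Eq (fun a => path_sum_but q C k s t a ^+ 2) <= N * (c ^+ 2 * (p * p)).
Proof.
move=> st; rewrite Ex_path_sum_sqr_gen//; apply: ler_sum_const_cond => [|j _].
  by nonneg.
by apply: ler_pM; rewrite ?sqr_ge0.
Qed.

Definition kernel_term s t a : R := (l s t + 3^-1 * Q s t a) * (l s t + Q s t a).

(** The part of the increment of the kernel along [{s,k}] that comes from pairs
   at [s]; the kernel term of [{s,k}] itself does not change. *)
Definition kernel_diff s k a : R := \sum_b
  v s b * (if (b != s) && (b != k) then diff (edge s k) (kernel_term s b) a else 0).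

Let kernel_termC s t a : kernel_term s t a = kernel_term t s a.
Proof. by rewrite /kernel_term (path_sumC _ C_sym12) l_sym. Qed.

Lemma diff_stein_kernel s k a : s != k ->
  diff (edge s k) (stein_kernel q l C) a = kernel_diff s k a + kernel_diff k s a.
Proof.
move=> sk; pose e := edge s k; pose dG i j := diff e (kernel_term i j) a.
pose H i b := v i b * (if (b != s) && (b != k) then dG i b else 0).
have -> : diff e (stein_kernel q l C) a = 2^-1 * \sum_i \sum_j v i j * dG i j.
  rewrite /diff /stein_kernel -mulrBr; congr (_ * _).
  rewrite -sumrB; apply: eq_bigr => i _; rewrite -sumrB; apply: eq_bigr => j _.
  by rewrite -mulrBr.
have dG0 i j : ignores e (Q i j) -> dG i j = 0.
  by move=> iQ; rewrite /dG /diff /kernel_term !iQ subrr.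
have dGC i j : dG i j = dG j i by rewrite /dG /diff ![kernel_term i j _]kernel_termC.
have dGsk : dG s k = 0 by apply: dG0; exact: ignores_path_sum.
have dGks : dG k s = 0 by rewrite dGC.
have term i j : v i j * dG i j =
    (i == s)%:R * H i j + (i == k)%:R * H i j + (j == s)%:R * H j i + (j == k)%:R * H j i.
  have ks := sk; rewrite eq_sym in ks; rewrite /H.
  have [->|is_] := eqVneq i s; have [->|js] := eqVneq j s;
    rewrite ?evar_diag ?(negbTE sk) ?(negbTE ks)//=; try ring.
  - have [->|jk] := eqVneq j k; rewrite /= ?dGsk; ring.
  - have [->|ik] := eqVneq i k; rewrite /= ?dGks; try ring.
    by rewrite (evarC q_sym i s) (dGC i s); ring.
  - have [->|ik] := eqVneq i k; have [->|jk] := eqVneq j k; rewrite ?evar_diag//=; try ring.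
      by rewrite (evarC q_sym i k) (dGC i k); ring.
    by rewrite dG0; [ring|exact: ignores_path_sum_disjoint].
under eq_bigr => i _ do (under eq_bigr => j _ do rewrite term).
under eq_bigr => i _ do rewrite !big_split/=.
rewrite !big_split/=.
have S1 u : \sum_i \sum_j (i == u)%:R * H i j = \sum_b H u b.
  by under eq_bigr => i _ do rewrite -big_distrr/=; rewrite sum_indicator.
have S2 u : \sum_i \sum_j (j == u)%:R * H j i = \sum_b H u b.
  by rewrite exchange_big S1.
rewrite !S1 !S2 /kernel_diff (edgeC k s) -/e.
rewrite (eq_bigr (H s)) => [|b _]; last by [].
rewrite [X in _ = _ + X](eq_bigr (H k)) => [|b _]; last by rewrite /H andbC.
by field.
Qed.

Let star_coef s k b a : R := if (b != s) && (b != k) then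
   v s b * (4 / 3 * l s b * C s b k + 2 / 3 * C s b k * path_sum_but q C k s b a +
      3^-1 * (1 - 2 * q s k) * C s b k ^+ 2 * (1 - 2 * q k b)) else 0.

Let star_cst s k : R := \sum_b if (b != s) && (b != k) then
   v s b * (3^-1 * (1 - 2 * q s k) * C s b k ^+ 2 * v k b) else 0.

(** As a function of the edges at [k], the increment is a sum of independent
   centred terms, whose coefficients do not involve these edges, plus a
   constant: its second moment follows from [Ex_star_sqr]. *)
Let kernel_diff_star s k a : s != k ->
  kernel_diff s k a = \sum_b xi k b a * star_coef s k b a + star_cst s k.
Proof.
move=> sk; rewrite /kernel_diff /star_cst -big_split/=; apply: eq_bigr => b _.
rewrite /star_coef; case: ifP => [/andP[bs bk]|_]; last by rewrite !mulr0 addr0.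
rewrite /diff /kernel_term !path_sum_upd//.
have -> : v k b = xi k b a ^+ 2 - (1 - 2 * q k b) * xi k b a by rewrite cadj_sqr//; ring.
by rewrite (cadjC q_sym b k) /=; field.
Qed.

Let ignores_star s k b t : s != k -> t != k -> ignores (edge k t) (star_coef s k b).
Proof.
move=> sk tk b' a; rewrite /star_coef; case: ifP => // /andP[bs bk].
congr (_ * (_ + _ + _)); congr (_ * _); apply: eq_bigr => j jk.
have kt : k != t by rewrite eq_sym.
rewrite !cadj_upd// !edge_eq (negbTE sk) (negbTE jk) (negbTE bk) /=.
by rewrite !andbF.
Qed.

Definition kernel_diff_bound : R :=
  2 * (N * (p * (p ^+ 2 * (6 * L ^+ 2 * c ^+ 2 + 3 * c ^+ 2 * (N * (c ^+ 2 * (p * p)))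
    + 3 * c ^+ 4)))) + 2 * (N * (p * (c ^+ 2 * p))) ^+ 2.

Lemma Ex_kernel_diff_sqr s k : s != k ->
  Eq (fun a => kernel_diff s k a ^+ 2) <= kernel_diff_bound.
Proof.
move=> sk.
have c2 : 0 <= c ^+ 2 by rewrite sqr_ge0.
have L2 : 0 <= L ^+ 2 by rewrite sqr_ge0.
apply: (@le_trans _ _ (2 * Eq (fun a => (\sum_b xi k b a * star_coef s k b a) ^+ 2)
   + 2 * star_cst s k ^+ 2)).
  rewrite -[2 * star_cst _ _ ^+ 2](Ex_cst (edge_weight q)) -ExZ -ExD; apply: le_Ex => // a.
  by rewrite kernel_diff_star// sqr_add2.
rewrite lerD//; last first.
  rewrite ler_wpM2l//; apply: sqr_le_norm; apply: ler_norm_sum_const => b.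
  case: ifP => _; last by rewrite normr0; nonneg.
  rewrite normrM (ger0_norm (v_ge0 _ _)); apply: ler_pM => //.
  rewrite normrM (ger0_norm (v_ge0 _ _)); apply: ler_pM => //.
  rewrite normrM [ `|C _ _ _ ^+ 2|]ger0_norm ?sqr_ge0// -[leRHS]mul1r; apply: ler_pM => //.
    exact: sqr_ge0.
  by rewrite ler_norml; have /andP[? ?] := q01 s k; lra.
rewrite ler_wpM2l// Ex_star_sqr//; last by move=> t t' t'k; exact: ignores_star.
apply: ler_sum_const => b; apply: ler_pM => //; first by apply: Ex_ge0 => // a; exact: sqr_ge0.
case bsk : ((b != s) && (b != k)); last first.
  rewrite (eq_Ex _ (_ : _ =1 (fun=> 0))) => [|a]; last by rewrite /star_coef bsk expr0n.
  by rewrite Ex_cst; nonneg.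
have /andP[bs bk] := bsk.
apply: (@le_trans _ _ (Eq (fun a => p ^+ 2 * (6 * L ^+ 2 * c ^+ 2 + 3 * c ^+ 2 * path_sum_but q C k s b a ^+ 2 + 3 * c ^+ 4)))).
  apply: le_Ex => // a; rewrite /star_coef bsk exprMn; apply: ler_pM; rewrite ?sqr_ge0//.
    by rewrite ler_pXn2r// nnegrE.
  rewrite (le_trans (sqr_add3 _ _ _))//.
  have lC : (l s b * C s b k) ^+ 2 <= L ^+ 2 * c ^+ 2.
    by rewrite exprMn; apply: ler_pM; rewrite ?sqr_ge0.
  rewrite lerD ?lerD//.
  - rewrite (_ : 3 * _ ^+ 2 = 16 / 3 * (l s b * C s b k) ^+ 2); last by field.
    rewrite (_ : 6 * _ * _ = 6 * (L ^+ 2 * c ^+ 2)); last by ring.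
    by move: lC (sqr_ge0 (l s b * C s b k)); set X := (l s b * C s b k) ^+ 2; set Y := L ^+ 2 * c ^+ 2; lra.
  - rewrite (_ : 3 * _ ^+ 2 = 4 / 3 * (C s b k ^+ 2 * path_sum_but q C k s b a ^+ 2)); last by field.
    rewrite -[3 * _ * _]mulrA; have := ler_wpM2r (sqr_ge0 (path_sum_but q C k s b a)) (C_sqr s b k).
    have := mulr_ge0 (sqr_ge0 (C s b k)) (sqr_ge0 (path_sum_but q C k s b a)).
    by set X := C s b k ^+ 2 * _; set Y := c ^+ 2 * _; lra.
  - rewrite ler_wpM2l// !exprMn.
    have C4 : (C s b k ^+ 2) ^+ 2 <= c ^+ 4.
      have -> : c ^+ 4 = (c ^+ 2) ^+ 2 by ring.
      by rewrite ler_pXn2r ?nnegrE ?sqr_ge0.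
    have : (1 - 2 * q s k) ^+ 2 * (1 - 2 * q k b) ^+ 2 <= 1 * 1.
      by apply: ler_pM; rewrite ?sqr_ge0.
    have : 0 <= (1 - 2 * q s k) ^+ 2 * (1 - 2 * q k b) ^+ 2 by nonneg.
    move: C4 (sqr_ge0 (C s b k ^+ 2)).
    rewrite [X in _ -> _ -> _ -> _ -> X <= _](_ : _ = 9^-1 * ((C s b k ^+ 2) ^+ 2 * ((1 - 2 * q s k) ^+ 2 * (1 - 2 * q k b) ^+ 2))); last by field.
    set X := _ ^+ 2; set Y := _ * _; set Z := c ^+ 4 => XZ X0 Y0 Y1.
    by have := ler_pM X0 Y0 XZ Y1; nra.
rewrite ExZ ler_wpM2l ?sqr_ge0// !ExD !Ex_cst ExZ lerD// lerD// ler_wpM2l//; try by nonneg.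
by apply: Ex_path_sum_but_sqr_le; rewrite eq_sym.
Qed.

Lemma variance_stein_kernel :
  variance (edge_weight q) (stein_kernel q l C) <= 2 * N ^+ 2 * p * kernel_diff_bound.
Proof.
have B0 : 0 <= kernel_diff_bound.
  by rewrite /kernel_diff_bound; nonneg.
rewrite (le_trans (poincare_edges q_sym q_diag q01 _))//.
rewrite (_ : _ * kernel_diff_bound = 2^-1 * (N * (N * (p * (4 * kernel_diff_bound))))); last by field.
rewrite ler_wpM2l ?invr_ge0//; apply: ler_sum_const => s; apply: ler_sum_const => k.
have [->|sk] := eqVneq s k; first by rewrite evar_diag// mul0r; nonneg.
apply: ler_pM => //; first by apply: Ex_ge0 => // a; exact: sqr_ge0.
have -> : Eq (fun a => diff (edge s k) (stein_kernel q l C) a ^+ 2) =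
    Eq (fun a => (kernel_diff s k a + kernel_diff k s a) ^+ 2).
  by apply: eq_Ex => a; rewrite (diff_stein_kernel a sk).
apply: (le_trans (Ex_sqr_add2 ew01 (kernel_diff s k) (kernel_diff k s))).
have ks : k != s by rewrite eq_sym.
have := lerD (ler_wpM2l (ler0n R 2) (Ex_kernel_diff_sqr sk)) (ler_wpM2l (ler0n R 2) (Ex_kernel_diff_sqr ks)).
move/le_trans; apply; apply: eq_ler; ring.
Qed.

Let Ex_diff_path_sqr s t k : s != t -> s != k ->
  Eq (fun a => diff (edge s k) (fun a => Q s t a ^+ 2) a ^+ 2) <=
    2 * c ^+ 4 * p + 8 * c ^+ 2 * (p * (N * (c ^+ 2 * (p * p)))).
Proof.
move=> st sk.
have c2 : 0 <= c ^+ 2 by rewrite sqr_ge0.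
have c4 : 0 <= c ^+ 4 by rewrite exprn_even_ge0.
have ts : t != s by rewrite eq_sym.
have [tk|tk] := eqVneq t k.
  rewrite -tk (eq_Ex _ (_ : _ =1 (fun=> 0))).
    by rewrite Ex_cst; nonneg.
  by move=> a; rewrite /diff !ignores_path_sum// subrr expr0n.
apply: (@le_trans _ _ (Eq (fun a => 2 * c ^+ 4 * (xi t k a ^+ 2 * 1) + 8 * c ^+ 2 * (xi t k a ^+ 2 * path_sum_but q C k s t a ^+ 2)))).
  apply: le_Ex => // a; rewrite /diff !path_sum_upd//=.
  set x := xi t k a; set y := path_sum_but _ _ _ _ _ _; set d := C s t k; set r := q s k.
  have -> : (y + (1 - r) * (d * x)) ^+ 2 - (y + (0 - r) * (d * x)) ^+ 2 =
     (1 - 2 * r) * (d * x) ^+ 2 + 2 * (d * x) * y by ring.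
  rewrite (le_trans (sqr_add2 _ _))// lerD//.
    have x1 : x ^+ 2 <= 1 by rewrite -(expr1n _ 2); apply: sqr_le_norm; exact: cadj_norm.
    have x0 : 0 <= x ^+ 2 by exact: sqr_ge0.
    have d4 : d ^+ 4 <= c ^+ 4.
      have -> : d ^+ 4 = (d ^+ 2) ^+ 2 by ring.
      have -> : c ^+ 4 = (c ^+ 2) ^+ 2 by ring.
      by rewrite ler_pXn2r ?nnegrE ?sqr_ge0// C_sqr.
    have d0 : 0 <= d ^+ 4 by exact: exprn_even_ge0.
    have r1 := q_twice s k.
    have r0 : 0 <= (1 - 2 * r) ^+ 2 by exact: sqr_ge0.
    have -> : 2 * ((1 - 2 * r) * (d * x) ^+ 2) ^+ 2 =
        2 * ((1 - 2 * r) ^+ 2 * (d ^+ 4 * (x ^+ 2 * x ^+ 2))) by ring.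
    have -> : 2 * c ^+ 4 * (x ^+ 2 * 1) = 2 * (1 * (c ^+ 4 * (x ^+ 2 * 1))) by ring.
    rewrite ler_wpM2l//; apply: ler_pM => //; first by nonneg.
    by apply: ler_pM => //; [nonneg|exact: ler_wpM2l].
  rewrite (_ : 2 * (2 * (d * x) * y) ^+ 2 = 8 * d ^+ 2 * (x ^+ 2 * y ^+ 2)); last by ring.
  by apply: ler_pM => //; try nonneg; rewrite ler_wpM2l// C_sqr.
have kt : k != t by rewrite eq_sym.
rewrite ExD !ExZ !Ex_cadj_sqr// ?Ex_cst ?mulr1; last first.
  move=> b a; congr (_ ^+ 2); apply: eq_bigr => j jk.
  rewrite !(cadj_upd _ _ _ _ _ tk) !edge_eq (negbTE st) (negbTE sk) eqxx (negbTE jk) /=.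
  by rewrite (negbTE tk).
rewrite lerD// ler_wpM2l//; try by nonneg.
apply: ler_pM => //; first by apply: Ex_ge0 => // a; exact: sqr_ge0.
exact: Ex_path_sum_but_sqr_le.
Qed.

(** The fourth moment is the square of the second one plus the variance of the
   square, to which the Efron-Stein inequality applies. *)
Lemma Ex_path_sum_pow4 s t : s != t -> Eq (fun a => Q s t a ^+ 4) <=
  c ^+ 4 * (17 * N ^+ 2 * p ^+ 4 + 4 * N * p ^+ 2).
Proof.
move=> st; have ts : t != s by rewrite eq_sym.
pose B := 2 * c ^+ 4 * p + 8 * c ^+ 2 * (p * (N * (c ^+ 2 * (p * p)))).
have c4 : 0 <= c ^+ 4 by rewrite exprn_even_ge0.
have B0 : 0 <= B by rewrite /B; nonneg.
have -> : Eq (fun a => Q s t a ^+ 4) = variance (edge_weight q) (fun a => Q s t a ^+ 2) +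
    Eq (fun a => Q s t a ^+ 2) ^+ 2.
  by rewrite /variance subrK; apply: eq_Ex => a; rewrite -exprM.
apply: (@le_trans _ _ (2 * (N * (p * B)) + (N * (c ^+ 2 * (p * p))) ^+ 2)); last first.
  by rewrite /B; apply: eq_ler; ring.
rewrite lerD//; last first.
  rewrite ler_pXn2r ?Ex_path_sum_sqr_le// nnegrE.
    by apply: Ex_ge0 => // a; exact: sqr_ge0.
  by nonneg.
rewrite (le_trans (poincare_edges q_sym q_diag q01 _))//.
pose H i j := v i j * Eq (fun a => diff (edge i j) (fun a => Q s t a ^+ 2) a ^+ 2).
have H0 i j : 0 <= H i j.
  by rewrite /H; nonneg; apply: Ex_ge0 => // a; exact: sqr_ge0.
have HC i j : H i j = H j i by rewrite /H edgeC (evarC q_sym).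
have HsB k : H s k <= p * B.
  have [->|sk] := eqVneq s k; first by rewrite /H evar_diag// mul0r; nonneg.
  apply: ler_pM => //; last exact: Ex_diff_path_sqr.
  by apply: Ex_ge0 => // a; exact: sqr_ge0.
have HtB k : H t k <= p * B.
  have [->|tk] := eqVneq t k; first by rewrite /H evar_diag// mul0r; nonneg.
  apply: ler_pM => //; first by apply: Ex_ge0 => // a; exact: sqr_ge0.
  rewrite (eq_Ex _ (_ : _ =1 (fun a => diff (edge t k) (fun a => Q t s a ^+ 2) a ^+ 2))).
    exact: Ex_diff_path_sqr.
  by move=> a; rewrite /diff !(path_sumC _ C_sym12 s t).
apply: (le_trans (sum_edges_touching (s := s) (t := t) H0 HC _)).
  move=> i j is_ it js jt; rewrite /H.
  have [ij|ij] := eqVneq i j; first by rewrite ij evar_diag// mul0r.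
  rewrite [Ex _ _](_ : _ = 0) ?mulr0// -[RHS](Ex_cst (edge_weight q)); apply: eq_Ex => a.
  have iQ : ignores (edge i j) (Q s t).
    by apply: ignores_path_sum_disjoint => //; rewrite eq_sym.
  by rewrite /diff !iQ subrr expr0n.
have := lerD (ler_sum_const HsB) (ler_sum_const HtB).
by move/le_trans; apply; apply: eq_ler; ring.
Qed.

Lemma chaos_third_order (s2 lam : R) : s2 = chaos_var q l C -> 0 <= L -> 0 < lam ->
  2^-1 * (\sum_i \sum_j v i j * Eq (fun a =>
         `|l i j + 3^-1 * Q i j a| * (l i j + Q i j a) ^+ 2)) <=
  (4 * L + 6 * lam) * s2 +
  N ^+ 2 * p * (c ^+ 4 * (17 * N ^+ 2 * p ^+ 4 + 4 * N * p ^+ 2)) / lam.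
Proof.
move=> s2E L0 lam0.
pose B := c ^+ 4 * (17 * N ^+ 2 * p ^+ 4 + 4 * N * p ^+ 2).
have c4 : 0 <= c ^+ 4 by rewrite exprn_even_ge0.
have p4 : 0 <= p ^+ 4 by rewrite exprn_even_ge0.
have B0 : 0 <= B by rewrite /B; nonneg.
have term i j : v i j * Eq (fun a => `|l i j + 3^-1 * Q i j a| * (l i j + Q i j a) ^+ 2) <=
    4 * L * (v i j * l i j ^+ 2) + 2 * lam * (\sum_k C i j k ^+ 2 * (v i j * v i k * v j k))
    + 2 / lam * (p * B).
  have [->|ij] := eqVneq i j.
    by rewrite evar_diag// !mul0r mulr0 add0r big1 ?mulr0 ?add0r; [nonneg|move=> k _; rewrite !mul0r mulr0].
  apply: (@le_trans _ _ (v i j * (4 * L * l i j ^+ 2 + 2 * lam * Eq (fun a => Q i j a ^+ 2) + 2 / lam * Eq (fun a => Q i j a ^+ 4)))).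
    rewrite ler_wpM2l// -[4 * L * _](Ex_cst (edge_weight q)) -!ExZ -!ExD; apply: le_Ex => // a.
    exact: cubic_bound.
  have -> : Eq (fun a => Q i j a ^+ 2) = \sum_k C i j k ^+ 2 * (v i k * v j k).
    exact: Ex_path_sum_sqr.
  rewrite !mulrDr; apply: lerD; first apply: lerD.
  - by rewrite mulrCA.
  - rewrite mulrCA; apply: ler_wpM2l; first by nonneg.
    rewrite big_distrr/=; apply: eq_ler.
    by apply: eq_bigr => k _; ring.
  - rewrite mulrCA; apply: ler_wpM2l; first by nonneg.
    apply: ler_pM; [exact: v_ge0| |exact: v_le|exact: Ex_path_sum_pow4].
    by apply: Ex_ge0; [exact: ew01|move=> a; exact: exprn_even_ge0].
apply: (@le_trans _ _ (2^-1 * \sum_i \sum_j (4 * L * (v i j * l i j ^+ 2) + 2 * lam * (\sum_k C i j k ^+ 2 * (v i j * v i k * v j k))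
    + 2 / lam * (p * B)))).
  rewrite ler_wpM2l ?invr_ge0//; apply: ler_sum => i _; apply: ler_sum => j _; exact: term.
under eq_bigr => i _ do rewrite !big_split/= -!big_distrr/=.
rewrite !big_split/= -!big_distrr/= s2E /chaos_var !sumr_const_ord -/B.
have S10 : 0 <= \sum_i \sum_j v i j * l i j ^+ 2 by nonneg.
have S20 : 0 <= \sum_i \sum_j \sum_k C i j k ^+ 2 * (v i j * v i k * v j k) by nonneg.
move: S10 S20; move: (\sum_i \sum_j v i j * _) (\sum_i \sum_j \sum_k _) => S1 S2 S10 S20.
have LS : 0 <= L * S2 by exact: mulr_ge0.
have lS : 0 <= lam * S1 by nonneg.
rewrite -subr_ge0 [X in 0 <= X](_ : _ = 2 / 3 * (L * S2) + 3 * (lam * S1)); first by nonneg.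
by rewrite /B; field; rewrite gt_eqF.
Qed.

End ChaosBounds.

(** * Degrees, triangles and 2-paths *)

Section LocalStatistics.
Context {R : realFieldType} {n : nat}.
Local Notation config := {ffun 'I_n * 'I_n -> bool}.
Implicit Types (a : config) (F : config -> R) (i j k s t : 'I_n).
Local Notation x := (@adj R n).

Definition deg i a : R := \sum_j x i j a.

Definition common s t a : R := \sum_k x s k a * x t k a.

Definition triangles i a : R := \sum_j \sum_k x i j a * x j k a * x k i a.

Definition two_paths i a : R := \sum_j \sum_(k | k != i) x i j a * x j k a.

Let x_ge0 i j a : 0 <= x i j a. Proof. exact: adj_ge0. Qed.
Let x_le1 i j a : x i j a <= 1. Proof. exact: adj_le1. Qed.

Lemma deg_ge0 i a : 0 <= deg i a.
Proof. by apply: sumr_ge0. Qed.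

Lemma common_ge0 s t a : 0 <= common s t a.
Proof. by apply: sumr_ge0 => k _; exact: mulr_ge0. Qed.

Lemma triangles_ge0 i a : 0 <= triangles i a.
Proof. by apply: sumr_ge0 => j _; apply: sumr_ge0 => k _; rewrite !mulr_ge0. Qed.

Lemma two_paths_ge0 i a : 0 <= two_paths i a.
Proof. by apply: sumr_ge0 => j _; apply: sumr_ge0 => k _; rewrite mulr_ge0. Qed.

Lemma triangles_le_two_paths i a : triangles i a <= two_paths i a.
Proof.
apply: ler_sum => j _; rewrite (bigD1 i)//= adj_irrefl mulr0 add0r.
by apply: ler_sum => k _; rewrite ler_piMr ?mulr_ge0.
Qed.

Lemma two_pathsE i a : two_paths i a = \sum_j x i j a * deg j a - deg i a.
Proof.
rewrite /two_paths /deg -sumrB; apply: eq_bigr => j _.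
rewrite -big_distrr/= [in RHS](bigD1 i)//= mulrDr (adjC j i) -expr2 adj_sqr; ring.
Qed.

Lemma diff_adj_triangle s t i j k a : s != t ->
  diff (edge s t) (fun a => x i j a * x i k a * x j k a) a =
  (edge i j == edge s t)%:R * (x i k a * x j k a) +
  (edge i k == edge s t)%:R * (x i j a * x j k a) +
  (edge j k == edge s t)%:R * (x i j a * x i k a).
Proof.
move=> st; have c0 (u w : 'I_n) a' : cadj (0 : 'M[R]_n) u w a' = x u w a'.
  by rewrite /cadj mxE subr0.
have := @diff_triangle R n 0 (fun i => mxE _ _ _ _) s t i j k a st.
by rewrite /diff !c0.
Qed.

Lemma diff_triangles s t i a : s != t ->
  diff (edge s t) (triangles i) a =
  2 * ((i == s)%:R + (i == t)%:R) * common s t a + 2 * (x i s a * x i t a).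
Proof.
move=> st; rewrite /triangles /diff -sumrB.
transitivity (\sum_j \sum_k ((edge i j == edge s t)%:R * (x i k a * x j k a) +
  (edge i k == edge s t)%:R * (x i j a * x j k a) +
  (edge j k == edge s t)%:R * (x i j a * x i k a))).
  apply: eq_bigr => j _; rewrite -sumrB; apply: eq_bigr => k _.
  rewrite -diff_adj_triangle// /diff; congr (_ - _); by rewrite (adjC k i); ring.
under eq_bigr => j _ do rewrite !big_split/=.
rewrite !big_split/=.
have ind j : (edge i j == edge s t)%:R = (i == s)%:R * (j == t)%:R + (i == t)%:R * (j == s)%:R :> R.
  rewrite edge_eq; have [->|_] := eqVneq i s; rewrite ?(negbTE st)/= ?orbF ?mul1r ?mul0r ?addr0 ?add0r//.
  by case: (i == t); rewrite /= ?mul1r ?mul0r.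
have T1 : \sum_j \sum_k (edge i j == edge s t)%:R * (x i k a * x j k a) =
    ((i == s)%:R + (i == t)%:R) * common s t a.
  under eq_bigr => j _ do (rewrite -big_distrr/= ind mulrDl -!mulrA).
  rewrite big_split/= -!big_distrr/= !sum_indicator mulrDl /common.
  have [->|is_] := eqVneq i s; first by rewrite (negbTE st) !mul0r.
  have [->|it] := eqVneq i t; rewrite ?mul0r// !mul1r; congr (_ + _).
  by apply: eq_bigr => k _; rewrite mulrC.
have T2 : \sum_j \sum_k (edge i k == edge s t)%:R * (x i j a * x j k a) =
    ((i == s)%:R + (i == t)%:R) * common s t a.
  rewrite exchange_big/= -T1; apply: eq_bigr => j _; apply: eq_bigr => k _.
  by rewrite (adjC k j).
have T3 : \sum_j \sum_k (edge j k == edge s t)%:R * (x i j a * x i k a) =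
    2 * (x i s a * x i t a).
  by rewrite edge_selects// [x i t a * _]mulrC; ring.
by rewrite T1 T2 T3; ring.
Qed.

(** The right-hand side is to be read without the edge [{s,t}], which [deg] would
   count, while the increment does not depend on it. *)
Lemma diff_two_paths s t i a : s != t -> x s t a = 0 ->
  diff (edge s t) (two_paths i) a =
  (i == s)%:R * deg t a + (i == t)%:R * deg s a + x i s a + x i t a.
Proof.
move=> st xst; rewrite /two_paths /diff -sumrB.
have ts : t != s by rewrite eq_sym.
transitivity (\sum_j \sum_k ((edge i j == edge s t)%:R * ((k != i)%:R * x j k a) +
  (edge j k == edge s t)%:R * ((k != i)%:R * x i j a))).
  apply: eq_bigr => j _; rewrite -sumrB [LHS]big_mkcond/=; apply: eq_bigr => k _.
  case: eqVneq => [->|ki] /=; first by rewrite !mul0r !mulr0 addr0.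
  rewrite !mul1r !adj_upd//.
  case: (eqVneq (edge i j)) => [ij|ij]; case: (eqVneq (edge j k)) => [jk|jk]; rewrite /=; try ring.
  move: ij jk => /eqP + /eqP; rewrite !edge_eq.
  move=> /orP[] /andP[/eqP i1 /eqP j1] /orP[] /andP[/eqP j2 /eqP k2].
  - by rewrite -j1 -j2 eqxx in st.
  - by rewrite i1 k2 eqxx in ki.
  - by rewrite i1 k2 eqxx in ki.
  - by rewrite -j1 -j2 eqxx in st.
under eq_bigr => j _ do rewrite big_split/=.
rewrite big_split/= edge_selects//.
have ind j : (edge i j == edge s t)%:R = (i == s)%:R * (j == t)%:R + (i == t)%:R * (j == s)%:R :> R.
  rewrite edge_eq; have [->|_] := eqVneq i s; rewrite ?(negbTE st)/= ?orbF ?mul1r ?mul0r ?addr0 ?add0r//.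
  by case: (i == t); rewrite /= ?mul1r ?mul0r.
under eq_bigr => j _ do (rewrite -big_distrr/= ind mulrDl -!mulrA).
rewrite big_split/= -!big_distrr/= !sum_indicator.
have degE u w : x u w a = 0 -> \sum_k (k != w)%:R * x u k a = deg u a.
  move=> uw; apply: eq_bigr => k _; case: eqVneq => [->|_]; rewrite /= ?mul1r// uw.
  by rewrite mul0r.
have xts : x t s a = 0 by rewrite adjC.
have [->|is_] := eqVneq i s.
  rewrite (negbTE st) ts /= (degE t s)// adj_irrefl xst; ring.
have [->|it] := eqVneq i t.
  by rewrite /= (degE s t)// adj_irrefl xts; ring.
by rewrite /=; ring.
Qed.

Definition mean_closure a : R := n%:R^-1 * \sum_i triangles i a / two_paths i a.

Lemma local_closure01 i a : 0 <= triangles i a / two_paths i a <= 1.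
Proof.
have T0 := triangles_ge0 i a; have TV := triangles_le_two_paths i a.
have V0 := two_paths_ge0 i a; rewrite divr_ge0//=.
have [V00|V00] := eqVneq (two_paths i a) 0; first by rewrite V00 invr0 mulr0.
by rewrite ler_pdivrMr ?mul1r// lt_neqAle eq_sym V00.
Qed.

End LocalStatistics.

Section Moments.
Context {R : realFieldType} {n : nat} (q : 'M[R]_n) (p : R).
Local Notation config := {ffun 'I_n * 'I_n -> bool}.
Implicit Types (a : config) (F : config -> R) (i j k s t : 'I_n).
Local Notation x := (@adj R n).
Local Notation N := (n%:R : R).

Hypothesis q_sym : forall i j, q i j = q j i.
Hypothesis q_diag : forall i, q i i = 0.
Hypothesis q01 : forall i j, 0 <= q i j <= 1.
Hypothesis q_le : forall i j, q i j <= p.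
Hypothesis p_ge0 : 0 <= p.

Local Notation Eq := (Ex (edge_weight q)).
Local Notation v := (evar q).
Let ew01 := edge_weight01 q01.
Let v_ge0 i j : 0 <= v i j. Proof. exact: evar_ge0. Qed.
Let v_le i j : v i j <= p. Proof. by rewrite (le_trans (evar_le _ _ _ _ _)). Qed.
Let q_ge0 i j : 0 <= q i j. Proof. by have /andP[] := q01 i j. Qed.

Definition triangle_mean i : R := \sum_j \sum_k q i j * q j k * q k i.

Lemma triangle_mean_ge0 i : 0 <= triangle_mean i.
Proof. by apply: sumr_ge0 => j _; apply: sumr_ge0 => k _; rewrite !mulr_ge0. Qed.

Lemma triangle_mean_le i : triangle_mean i <= N * (N * p ^+ 3).
Proof.
apply: ler_sum_const => j; apply: ler_sum_const => k.
by rewrite !exprSr expr0 mul1r !ler_pM ?mulr_ge0.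
Qed.

Lemma Ex_triangles i : Eq (triangles i) = triangle_mean i.
Proof.
rewrite Ex_sum; apply: eq_bigr => j _; rewrite Ex_sum; apply: eq_bigr => k _.
have [<-|ij] := eqVneq i j.
  rewrite q_diag !mul0r -[RHS](Ex_cst (edge_weight q)); apply: eq_Ex => a.
  by rewrite adj_irrefl !mul0r.
have [<-|jk] := eqVneq j k.
  rewrite q_diag mulr0 mul0r -[RHS](Ex_cst (edge_weight q)); apply: eq_Ex => a.
  by rewrite adj_irrefl mulr0 mul0r.
have [<-|ki] := eqVneq k i.
  rewrite q_diag mulr0 -[RHS](Ex_cst (edge_weight q)); apply: eq_Ex => a.
  by rewrite adj_irrefl mulr0.
rewrite (eq_Ex _ (_ : _ =1 (fun a => x i j a * (x j k a * x k i a)))) => [|a]; last by ring.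
rewrite Ex_adj_mul//; last first.
  move=> b a; rewrite !adj_upd// !edge_eq (eq_sym j i) (negbTE ij) (negbTE ki) /= !andbF.
  by rewrite (eq_sym k j) (negbTE jk).
rewrite Ex_adj_mul//; first by rewrite Ex_adj//; ring.
move=> b a; rewrite adj_upd// edge_eq (eq_sym k j) (negbTE jk) (eq_sym i j).
by rewrite (eq_sym j i) (negbTE ij) andbF.
Qed.

Definition common_bound : R := N * p ^+ 2 + N ^+ 2 * p ^+ 4.

Lemma Ex_common_sqr s t : s != t -> Eq (fun a => common s t a ^+ 2) <= common_bound.
Proof.
move=> st; have ts : t != s by rewrite eq_sym.
have pair k F : ignores (edge s k) F -> ignores (edge t k) F ->
    Eq (fun a => x s k a * x t k a * F a) = q s k * q t k * Eq F.
  move=> sF tF; have [<-|sk] := eqVneq s k.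
    rewrite q_diag !mul0r -[RHS](Ex_cst (edge_weight q)); apply: eq_Ex => a.
    by rewrite adj_irrefl !mul0r.
  have [<-|tk] := eqVneq t k.
    rewrite q_diag mulr0 !mul0r -[RHS](Ex_cst (edge_weight q)); apply: eq_Ex => a.
    by rewrite adj_irrefl mulr0 mul0r.
  rewrite (eq_Ex _ (_ : _ =1 (fun a => x s k a * (x t k a * F a)))) => [|a]; last by ring.
  rewrite Ex_adj_mul//; first by rewrite Ex_adj_mul// mulrA.
  by move=> b a; rewrite sF adj_upd// edge_eq (negbTE ts) (negbTE tk).
have diag k : Eq (fun a => x s k a * x t k a * 1) <= p ^+ 2.
  rewrite pair// Ex_cst mulr1 expr2; exact: ler_pM.
have off k k' : k != k' -> Eq (fun a => x s k a * x t k a * (x s k' a * x t k' a)) <= p ^+ 4.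
  move=> kk'.
  have [sk|sk] := eqVneq s k.
    rewrite [Ex _ _](_ : _ = 0) ?exprn_even_ge0// -[RHS](Ex_cst (edge_weight q)).
    by apply: eq_Ex => a; rewrite sk adj_irrefl !mul0r.
  have [tk|tk] := eqVneq t k.
    rewrite [Ex _ _](_ : _ = 0) ?exprn_even_ge0// -[RHS](Ex_cst (edge_weight q)).
    by apply: eq_Ex => a; rewrite tk adj_irrefl mulr0 !mul0r.
  rewrite pair.
  - rewrite (eq_Ex _ (_ : _ =1 (fun a => x s k' a * x t k' a * 1))) => [|a]; last by rewrite mulr1.
    rewrite (_ : p ^+ 4 = p * p * p ^+ 2); last by ring.
    apply: ler_pM => //; [exact: mulr_ge0| |exact: ler_pM].
    by apply: Ex_ge0 => // a; rewrite mulr1 mulr_ge0 ?adj_ge0.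
  - move=> b a; rewrite !(adj_upd _ _ _ _ sk) !edge_eq eqxx (eq_sym k' k) (negbTE kk').
    by rewrite (negbTE sk) (negbTE ts) (negbTE tk).
  - move=> b a; rewrite !(adj_upd _ _ _ _ tk) !edge_eq eqxx (eq_sym k' k) (negbTE kk').
    by rewrite (negbTE tk) (negbTE st) (negbTE sk).
apply: (@le_trans _ _ (\sum_k \sum_k' (p ^+ 2 * (k' == k)%:R + p ^+ 4))).
  rewrite (eq_Ex _ (_ : _ =1 (fun a => \sum_k \sum_k' x s k a * x t k a * (x s k' a * x t k' a)))).
    rewrite Ex_sum; apply: ler_sum => k _; rewrite Ex_sum; apply: ler_sum => k' _.
    have [->|k'k] := eqVneq k' k; last by rewrite mulr0 add0r off// eq_sym.
    rewrite (eq_Ex _ (_ : _ =1 (fun a => x s k a * x t k a * 1))).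
      by rewrite mulr1 (le_trans (diag k))// lerDl exprn_even_ge0.
    by move=> a; rewrite mulr1 mulrACA -!expr2 !adj_sqr.
  by move=> a; rewrite expr2 /common big_distrl; apply: eq_bigr => k _; rewrite big_distrr.
apply: eq_ler.
under eq_bigr => k _ do rewrite big_split/= -big_distrr/= -[\sum_i _](eq_bigr _ (fun _ _ => mulr1 _)) sum_indicator.
by rewrite big_split/= !sumr_const_ord /common_bound; ring.
Qed.

(** Once the edge is forced to be present, [F] is independent of its indicator;
   forcing it changes [F] by at most its increment. *)
Lemma Ex_adj_mul_sqr s t F : s != t ->
  Eq (fun a => x s t a * F a ^+ 2) <=
  2 * q s t * (Eq (fun a => F a ^+ 2) + Eq (fun a => diff (edge s t) F a ^+ 2)).
Proof.
move=> st; pose F1 a := F (upd (edge s t) true a).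
rewrite (eq_Ex _ (_ : _ =1 (fun a => x s t a * F1 a ^+ 2))); last first.
  move=> a; rewrite /F1 -[in LHS](upd_id (edge s t) a) /adj st /= updE eqxx.
  by case: (a (edge s t)); rewrite ?mul0r ?mul1r.
rewrite Ex_adj_mul//; last by move=> b a; rewrite /F1 upd_upd.
rewrite [2 * _]mulrC -mulrA ler_wpM2l// mulrDr -!ExZ -ExD; apply: le_Ex => // a.
rewrite /F1 /diff -[F a](congr1 F (upd_id (edge s t) a)).
set u := F (upd _ true _); set w := F (upd _ false _).
case: (a (edge s t)); rewrite -?/u -?/w.
  by have := sqr_ge0 u; have := sqr_ge0 (u - w); set A := (u - w) ^+ 2; lra.
by have := sqr_ge0 (u - w - w); nra.
Qed.

Definition triangles_bound : R := 12 * N * p * common_bound + 6 * N ^+ 2 * p ^+ 3.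

Lemma common_bound_ge0 : 0 <= common_bound.
Proof. by rewrite /common_bound; nonneg. Qed.

Lemma variance_triangles i :
  Eq (fun a => (triangles i a - triangle_mean i) ^+ 2) <= triangles_bound.
Proof.
rewrite -Ex_triangles -(varianceE (edge_weight q)).
rewrite (le_trans (poincare_edges q_sym q_diag q01 _))//.
have B0 := common_bound_ge0.
have step s t : s != t -> Eq (fun a => diff (edge s t) (triangles i) a ^+ 2) <=
    12 * ((i == s)%:R + (i == t)%:R) * common_bound + 12 * (q i s * q i t).
  move=> st.
  apply: (@le_trans _ _ (Eq (fun a => 12 * ((i == s)%:R + (i == t)%:R) * common s t a ^+ 2
      + 12 * (x i s a * x i t a)))).
    apply: le_Ex => // a; rewrite (diff_triangles i a st).
    have xx : (x i s a * x i t a) ^+ 2 = x i s a * x i t a by rewrite exprMn !adj_sqr.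
    have := sqr_add2 (2 * ((i == s)%:R + (i == t)%:R) * common s t a) (2 * (x i s a * x i t a)).
    have : 0 <= x i s a * x i t a by rewrite mulr_ge0 ?adj_ge0.
    rewrite [(2 * (x i s a * _)) ^+ 2]exprMn xx; set X := x i s a * _.
    have := sqr_ge0 (common s t a : R); rewrite [(2 * (_ + _) * _) ^+ 2]exprMn.
    set Y := common s t a ^+ 2.
    have [->|is_] := eqVneq i s; first by rewrite (negbTE st) /=; lra.
    by case: (i == t); rewrite /=; lra.
  rewrite ExD !ExZ lerD//.
    by rewrite ler_wpM2l ?Ex_common_sqr//; nonneg.
  rewrite ler_wpM2l//.
  have [->|is_] := eqVneq i s.
    rewrite q_diag mul0r [Ex _ _](_ : _ = 0)// -[RHS](Ex_cst (edge_weight q)); apply: eq_Ex => a.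
    by rewrite adj_irrefl mul0r.
  rewrite Ex_adj_mul//; last first.
    move=> b a; rewrite (adj_upd _ _ _ _ is_) edge_eq eqxx (eq_sym t s) (negbTE st) /=.
    by rewrite (negbTE is_).
  by rewrite Ex_adj.
apply: (@le_trans _ _ (2^-1 * \sum_s \sum_t (p * (12 * ((i == s)%:R + (i == t)%:R) * common_bound + 12 * (p * p))))).
  rewrite ler_wpM2l ?invr_ge0//; apply: ler_sum => s _; apply: ler_sum => t _.
  have [->|st] := eqVneq s t; first by rewrite evar_diag// mul0r; nonneg.
  apply: ler_pM => //; first by apply: Ex_ge0 => // a; exact: sqr_ge0.
  rewrite (le_trans (step s t st))// lerD2l ler_wpM2l//; exact: ler_pM.
have -> : \sum_s \sum_t (p * (12 * ((i == s)%:R + (i == t)%:R) * common_bound + 12 * (p * p))) =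
   24 * N * p * common_bound + 12 * N ^+ 2 * p ^+ 3.
  have S1 : \sum_s (i == s)%:R = 1 :> R.
    rewrite -[RHS](sum_indicator i (fun=> 1)); apply: eq_bigr => s _.
    by rewrite mulr1 eq_sym.
  transitivity (\sum_s \sum_t (12 * p * common_bound * (i == s)%:R + (12 * p * common_bound * (i == t)%:R + 12 * p ^+ 3))).
    by apply: eq_bigr => s _; apply: eq_bigr => t _; ring.
  under eq_bigr => s _ do rewrite !big_split/= -!big_distrr/= S1.
  rewrite !big_split/= !sumr_const_ord.
  under eq_bigr => s _ do rewrite sumr_const_ord.
  by rewrite -!big_distrr/= S1; ring.
by rewrite /triangles_bound; apply: eq_ler; field.
Qed.

End Moments.

(** * Linearization of the closure coefficient *)

Section ScalarBounds.
Context {R : realFieldType}.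

(** Errors in [V^-1] and [V^-2] when [V] is replaced by its mean [nu]. *)
Lemma inv_perturb (d nu V V1 : R) : 0 < nu -> d <= nu / 2 ->
  `|V - nu| <= d -> `|V1 - nu| <= d ->
  [/\ 0 < V, 0 < V1, `|V1^-1 - nu^-1| <= 2 * d * nu^-1 ^+ 2 &
      `|(V * V1)^-1 - nu^-1 ^+ 2| <= 6 * d * nu^-1 ^+ 3].
Proof.
move=> nu0 dnu Vnu V1nu.
have /andP[V2 V3] : - d <= V - nu <= d by rewrite -ler_norml.
have /andP[V12 V13] : - d <= V1 - nu <= d by rewrite -ler_norml.
have d0 : 0 <= d by lra.
have V0 : 0 < V by lra.
have V10 : 0 < V1 by lra.
have iV : V^-1 <= 2 * nu^-1.
  by rewrite -[2]invrK -invfM lef_pV2 ?posrE//; lra.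
have iV1 : V1^-1 <= 2 * nu^-1.
  by rewrite -[2]invrK -invfM lef_pV2 ?posrE//; lra.
have i0 : 0 < nu^-1 by rewrite invr_gt0.
have iV0 : 0 < V^-1 by rewrite invr_gt0.
have iV10 : 0 < V1^-1 by rewrite invr_gt0.
have Vd : `|nu - V| <= d by rewrite ler_norml; lra.
have V1d : `|nu - V1| <= d by rewrite ler_norml; lra.
split=> //.
  have -> : V1^-1 - nu^-1 = (nu - V1) * (V1^-1 * nu^-1).
    by field; rewrite !gt_eqF.
  rewrite normrM [ `|_ * nu^-1|]ger0_norm; last by nonneg.
  have -> : 2 * d * nu^-1 ^+ 2 = d * (2 * nu^-1 * nu^-1) by ring.
  apply: ler_pM => //; first by nonneg.
  by apply: ler_wpM2r => //; exact: ltW.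
have -> : (V * V1)^-1 - nu^-1 ^+ 2 =
    (nu - V) * (V^-1 * (V1^-1 * nu^-1)) + (nu - V1) * (V1^-1 * nu^-1 ^+ 2).
  by field; rewrite !gt_eqF.
rewrite (le_trans (ler_normD _ _))// !normrM.
rewrite (ger0_norm (ltW i0)) (ger0_norm (ltW iV0)) (ger0_norm (ltW iV10)).
have -> : 6 * d * nu^-1 ^+ 3 = d * (2 * nu^-1 * (2 * nu^-1 * nu^-1)) + d * (2 * nu^-1 * nu^-1 ^+ 2).
  by ring.
have i0' := ltW i0; have iV0' := ltW iV0; have iV10' := ltW iV10.
have iV1n : V1^-1 * nu^-1 <= 2 * nu^-1 * nu^-1 by exact: ler_wpM2r.
apply: lerD; apply: ler_pM => //; try by nonneg.
- by apply: ler_pM => //; nonneg.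
- by apply: ler_wpM2r => //; exact: sqr_ge0.
Qed.

Lemma sqr_add5 (a b c d e : R) : (a + b + c + d + e) ^+ 2 <=
  5 * (a ^+ 2 + b ^+ 2 + c ^+ 2 + d ^+ 2 + e ^+ 2).
Proof.
rewrite -subr_ge0.
have -> : 5 * (a ^+ 2 + b ^+ 2 + c ^+ 2 + d ^+ 2 + e ^+ 2) - (a + b + c + d + e) ^+ 2 =
  (a - b) ^+ 2 + (a - c) ^+ 2 + (a - d) ^+ 2 + (a - e) ^+ 2 + (b - c) ^+ 2 +
  (b - d) ^+ 2 + (b - e) ^+ 2 + (c - d) ^+ 2 + (c - e) ^+ 2 + (d - e) ^+ 2 by ring.
by nonneg.
Qed.

Lemma sqr_add4 (a b c d : R) : (a + b + c + d) ^+ 2 <=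
  4 * (a ^+ 2 + b ^+ 2 + c ^+ 2 + d ^+ 2).
Proof.
rewrite -subr_ge0.
have -> : 4 * (a ^+ 2 + b ^+ 2 + c ^+ 2 + d ^+ 2) - (a + b + c + d) ^+ 2 =
  (a - b) ^+ 2 + (a - c) ^+ 2 + (a - d) ^+ 2 + (b - c) ^+ 2 +
  (b - d) ^+ 2 + (c - d) ^+ 2 by ring.
by nonneg.
Qed.

Lemma sqr_weighted_sum n (F G : 'I_n -> R) : (forall i, 0 <= G i) ->
  (\sum_i F i * G i) ^+ 2 <= (\sum_i G i) * \sum_i F i ^+ 2 * G i.
Proof.
move=> G0; rewrite -subr_ge0.
have -> : (\sum_i G i) * (\sum_i F i ^+ 2 * G i) - (\sum_i F i * G i) ^+ 2 =
   2^-1 * \sum_i \sum_j G i * G j * (F i - F j) ^+ 2.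
  have E1 : (\sum_i G i) * (\sum_i F i ^+ 2 * G i) = \sum_i \sum_j G i * G j * F j ^+ 2.
    rewrite big_distrl; apply: eq_bigr => i _; rewrite big_distrr; apply: eq_bigr => j _ /=.
    by ring.
  have E1' : \sum_i \sum_j G i * G j * F i ^+ 2 = \sum_i \sum_j G i * G j * F j ^+ 2.
    by rewrite exchange_big; apply: eq_bigr => i _; apply: eq_bigr => j _ /=; ring.
  have E2 : (\sum_i F i * G i) ^+ 2 = \sum_i \sum_j G i * G j * (F i * F j).
    rewrite expr2 big_distrl; apply: eq_bigr => i _; rewrite big_distrr; apply: eq_bigr => j _ /=.
    by ring.
  rewrite E1 E2.
  transitivity (2^-1 * (\sum_i \sum_j G i * G j * F j ^+ 2 + \sum_i \sum_j G i * G j * F i ^+ 2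
      - 2 * \sum_i \sum_j G i * G j * (F i * F j))); first by rewrite E1'; field.
  congr (_ * _); rewrite big_distrr -big_split -sumrB; apply: eq_bigr => i _ /=.
  by rewrite big_distrr -big_split -sumrB; apply: eq_bigr => j _ /=; ring.
by nonneg; apply: sumr_ge0 => j _; rewrite mulr_ge0 ?sqr_ge0 ?mulr_ge0.
Qed.

Lemma norm_sub_le (u w M : R) : 0 <= u <= M -> 0 <= w <= M -> `|u - w| <= M.
Proof. by move=> /andP[? ?] /andP[? ?]; rewrite ler_norml; lra. Qed.

Lemma quadratic_coefs (u w : R) : 0 <= u -> 0 <= w -> w <= 1 ->
  18 * w + 12 * u + 2 * (w * w + u * w) <= 20 * w + 20 * u.
Proof. by move=> *; nra. Qed.

Lemma majorant_coefs (b1 b2 b3 b4 : R) :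
  0 <= b1 -> 0 <= b2 -> 0 <= b3 -> 0 <= b4 ->
  5 * (144 * b1 + 16 * b1 + (132 ^+ 2 * b2 + 132 ^+ 2 * b3) + 528 ^+ 2 * b3 +
       (20 * 1024 * b4 + 20 * 1024 * b1)) <=
  1500 * 1000 * b1 + 1500 * 1000 * b2 + 1500 * 1000 * b3 + 1500 * 1000 * b4.
Proof. by move=> *; lra. Qed.

End ScalarBounds.

Section Remainder.
Context {R : realFieldType} {n : nat} (q : 'M[R]_n) (p kap rho : R).
Local Notation config := {ffun 'I_n * 'I_n -> bool}.
Implicit Types (a : config) (F : config -> R) (i j k s t : 'I_n).
Local Notation x := (@adj R n).
Local Notation xi := (cadj q).
Local Notation N := (n%:R : R).
Local Notation m := (n%:R * p : R).
Local Notation tau := (triangle_mean q).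

Definition mean_deg i : R := \sum_j q i j.

Definition mean_paths i : R := \sum_j q i j * mean_deg j.

Local Notation mu := mean_deg.
Local Notation nu := mean_paths.

(** [n] times the coefficients of the approximating polynomial. The second sum
   in [lin_coef] is the mean effect of the new edge on the denominators. *)
Definition tri_coef s t k : R := 2 * ((nu s)^-1 + (nu t)^-1 + (nu k)^-1).

Definition lin_coef s t : R :=
  \sum_k tri_coef s t k * (q s k * q t k) -
  \sum_i tau i / nu i ^+ 2 *
    ((i == s)%:R * mu t + (i == t)%:R * mu s + q i s + q i t).

Definition tri_gain s t i a : R :=
  2 * ((i == s)%:R + (i == t)%:R) * common s t a + 2 * (x i s a * x i t a).

Definition path_gain s t i a : R :=
  (i == s)%:R * deg t a + (i == t)%:R * deg s a + x i s a + x i t a.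

(** What the increment contains beyond the approximating polynomial: the terms
   of first order in the edges at [s] and [t]. *)
Definition lin_noise1 s t a : R :=
  \sum_k tri_coef s t k * (xi s k a * q t k + q s k * xi t k a).

Definition lin_noise2 s t a : R :=
  \sum_i tau i / nu i ^+ 2 *
    ((i == s)%:R * (deg t a - mu t) + (i == t)%:R * (deg s a - mu s) + xi i s a + xi i t a).

(** When degrees are close to their means, the number of 2-paths from [i] is
   nearly [\sum_j x i j * mu j]; hence the second condition. *)
Definition typical a : bool :=
  [forall i, (`|\sum_j xi i j a| <= m * rho) &&
             (`|\sum_j xi i j a * mu j| <= m * rho * m)].

Hypothesis q_sym : forall i j, q i j = q j i.
Hypothesis q_diag : forall i, q i i = 0.
Hypothesis q01 : forall i j, 0 <= q i j <= 1.
Hypothesis q_le : forall i j, q i j <= p.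
Hypothesis p_ge0 : 0 <= p.
Hypothesis p_half : p <= 2^-1.
Hypothesis m_ge1 : 1 <= m.
Hypothesis kap_ge1 : 1 <= kap.
Hypothesis nu_ge : forall i, m ^+ 2 <= kap * nu i.
Hypothesis rho_ge : 1 <= m * rho.
Hypothesis rho_le : 22 * kap * rho <= 1.

Local Notation Eq := (Ex (edge_weight q)).
Local Notation v := (evar q).
Let ew01 := edge_weight01 q01.
Let v_ge0 i j : 0 <= v i j. Proof. exact: evar_ge0. Qed.
Let v_le i j : v i j <= p. Proof. by rewrite (le_trans (evar_le _ _ _ _ _)). Qed.
Let q_ge0 i j : 0 <= q i j. Proof. by have /andP[] := q01 i j. Qed.
Let m_gt0 : 0 < m. Proof. exact: lt_le_trans m_ge1. Qed.
Let kap_gt0 : 0 < kap. Proof. exact: lt_le_trans kap_ge1. Qed.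
Let rho_gt0 : 0 < rho. Proof. by rewrite -(pmulr_rgt0 _ m_gt0) (lt_le_trans _ rho_ge). Qed.
Let N_ge0 : 0 <= N. Proof. exact: ler0n. Qed.
Let N_gt0 : 0 < N.
Proof. by rewrite lt_neqAle N_ge0 eq_sym andbT; apply: contraTN m_gt0 => /eqP->; rewrite mul0r ltxx. Qed.
Let tau_ge0 i : 0 <= tau i. Proof. exact: triangle_mean_ge0. Qed.

Lemma mean_deg_ge0 i : 0 <= mu i. Proof. by apply: sumr_ge0. Qed.

Lemma mean_deg_le i : mu i <= m. Proof. exact: ler_sum_const. Qed.

Lemma mean_paths_gt0 i : 0 < nu i.
Proof. by rewrite -(pmulr_rgt0 _ kap_gt0) (lt_le_trans _ (nu_ge i))// exprn_gt0. Qed.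

Lemma inv_mean_paths_le i : (nu i)^-1 <= kap / m ^+ 2.
Proof.
by rewrite -[leLHS]mul1r ler_pdivrMr ?mean_paths_gt0// mulrAC ler_pdivlMr ?exprn_gt0// mul1r.
Qed.

Let inu_ge0 i : 0 <= (nu i)^-1. Proof. by rewrite invr_ge0 ltW ?mean_paths_gt0. Qed.

Lemma tri_coef_ge0 s t k : 0 <= tri_coef s t k.
Proof. by rewrite /tri_coef mulr_ge0// !addr_ge0. Qed.

Lemma tri_coef_le s t k : tri_coef s t k <= 6 * kap / m ^+ 2.
Proof.
rewrite /tri_coef; have := inv_mean_paths_le s; have := inv_mean_paths_le t.
by have := inv_mean_paths_le k; rewrite -mulrA; set K := kap / _; lra.
Qed.

Lemma tau_nu_ge0 i : 0 <= tau i / nu i ^+ 2.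
Proof. by rewrite mulr_ge0// invr_ge0 sqr_ge0. Qed.

Lemma tau_nu_le i : tau i / nu i ^+ 2 <= kap ^+ 2 / (N * m).
Proof.
have -> : kap ^+ 2 / (N * m) = N * (N * p ^+ 3) * (kap / m ^+ 2) ^+ 2.
  have p0 : p != 0 by move: m_gt0; rewrite pmulr_rgt0// => /gt_eqF->.
  by field; rewrite p0 gt_eqF.
apply: ler_pM; rewrite ?invr_ge0 ?sqr_ge0//; first exact: triangle_mean_le.
by rewrite -exprVn ler_pXn2r ?nnegrE ?divr_ge0 ?sqr_ge0 ?inv_mean_paths_le// ltW.
Qed.

(** Common neighbours are counted by products of indicators. Expanding these in
   centred indicators gives the constant term, the two linear terms and the
   quadratic one. *)
Lemma linearization s t a :
  \sum_i (tri_gain s t i a / nu i - tau i * path_gain s t i a / nu i ^+ 2) -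
  (lin_coef s t + \sum_k tri_coef s t k * (xi s k a * xi t k a)) =
  lin_noise1 s t a - lin_noise2 s t a.
Proof.
have -> : \sum_i (tri_gain s t i a / nu i - tau i * path_gain s t i a / nu i ^+ 2) =
   \sum_k tri_coef s t k * (x s k a * x t k a) -
   \sum_i tau i / nu i ^+ 2 * path_gain s t i a.
  rewrite sumrB; congr (_ - _); last by apply: eq_bigr => i _; ring.
  transitivity (\sum_i ((i == s)%:R * (2 * common s t a / nu i) +
     (i == t)%:R * (2 * common s t a / nu i) + 2 * (x s i a * x t i a) / nu i)).
    by apply: eq_bigr => i _; rewrite /tri_gain (adjC i s) (adjC i t); ring.
  rewrite !big_split/= !sum_indicator /common !big_distrr/= !big_distrl/= -!big_split/=.
  by apply: eq_bigr => k _; rewrite /tri_coef; ring.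
have -> : lin_noise1 s t a = \sum_k tri_coef s t k * (x s k a * x t k a) -
   \sum_k tri_coef s t k * (q s k * q t k) - \sum_k tri_coef s t k * (xi s k a * xi t k a).
  by rewrite -!sumrB; apply: eq_bigr => k _; rewrite /cadj; ring.
have -> : lin_noise2 s t a = \sum_i tau i / nu i ^+ 2 * path_gain s t i a -
   \sum_i tau i / nu i ^+ 2 * ((i == s)%:R * mu t + (i == t)%:R * mu s + q i s + q i t).
  by rewrite -sumrB; apply: eq_bigr => i _; rewrite /path_gain /cadj; ring.
by rewrite /lin_coef; ring.
Qed.

Lemma sum_tri_gain s t a : \sum_i tri_gain s t i a = 6 * common s t a.
Proof.
transitivity (\sum_i ((i == s)%:R * (2 * common s t a) +
     (i == t)%:R * (2 * common s t a) + 2 * (x s i a * x t i a))).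
  by apply: eq_bigr => i _; rewrite /tri_gain (adjC i s) (adjC i t); ring.
by rewrite !big_split/= !sum_indicator -big_distrr/= -/(common s t a); ring.
Qed.

Lemma sum_path_gain_weighted s t a (F : 'I_n -> R) :
  \sum_i F i * path_gain s t i a =
  F s * deg t a + F t * deg s a + \sum_i (x s i a + x t i a) * F i.
Proof.
transitivity (\sum_i ((i == s)%:R * (F i * deg t a) + (i == t)%:R * (F i * deg s a) +
    (x s i a + x t i a) * F i)).
  by apply: eq_bigr => i _; rewrite /path_gain (adjC i s) (adjC i t); ring.
by rewrite !big_split/= !sum_indicator.
Qed.

Lemma sum_path_gain s t a : \sum_i path_gain s t i a = 2 * (deg s a + deg t a).
Proof.
rewrite (eq_bigr (fun i => 1 * path_gain s t i a)) => [|i _]; last by rewrite mul1r.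
rewrite sum_path_gain_weighted; under eq_bigr => i _ do rewrite mulr1.
by rewrite big_split/= -/(deg s a) -/(deg t a); ring.
Qed.

Lemma tri_gain_ge0 s t i a : 0 <= tri_gain s t i a.
Proof.
rewrite /tri_gain; have := common_ge0 (R := R) s t a.
have := mulr_ge0 (adj_ge0 (R := R) i s a) (adj_ge0 (R := R) i t a).
move=> *; apply: addr_ge0; apply: mulr_ge0 => //.
Qed.

Lemma path_gain_ge0 s t i a : 0 <= path_gain s t i a.
Proof.
rewrite /path_gain; have := deg_ge0 (R := R) s a; have := deg_ge0 (R := R) t a.
by move=> *; rewrite !addr_ge0 ?mulr_ge0 ?adj_ge0.
Qed.

Section Typical.
Variable a : config.
Hypothesis atyp : typical a.

Let degB i : deg i a - mu i = \sum_j xi i j a.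
Proof. by rewrite -sumrB. Qed.

Let deg_close i : `|deg i a - mu i| <= m * rho.
Proof. by rewrite degB; have /forallP/(_ i)/andP[] := atyp. Qed.

Let rho_le1 : rho <= 1.
Proof. by have := ltW rho_gt0; move: rho_le kap_ge1; nra. Qed.

Lemma typical_deg_le i : deg i a <= 2 * m.
Proof.
have := deg_close i; have := mean_deg_le i; rewrite ler_norml => mm /andP[_].
by have : m * rho <= m * 1 := ler_wpM2l (ltW m_gt0) rho_le1; lra.
Qed.

Lemma typical_two_paths i : `|two_paths i a - nu i| <= 5 * m ^+ 2 * rho.
Proof.
have -> : two_paths i a - nu i =
    \sum_j x i j a * (deg j a - mu j) + \sum_j xi i j a * mu j - deg i a.
  rewrite two_pathsE /mean_paths addrAC; congr (_ - _).
  by rewrite -sumrB -big_split/=; apply: eq_bigr => j _; rewrite /cadj; ring.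
have dm := typical_deg_le i; have d0 := deg_ge0 (R := R) i a.
have mr0 : 0 <= m * rho by rewrite mulr_ge0 ?ltW.
have T1 : `|\sum_j x i j a * (deg j a - mu j)| <= 2 * m * (m * rho).
  rewrite (le_trans (ler_norm_sum _ _ _))//.
  apply: (@le_trans _ _ (deg i a * (m * rho))); last exact: ler_wpM2r.
  rewrite /deg big_distrl/=; apply: ler_sum => j _.
  by rewrite normrM (ger0_norm (adj_ge0 _ _ _)) ler_wpM2l ?adj_ge0// deg_close.
have T2 : `|\sum_j xi i j a * mu j| <= m * rho * m by have /forallP/(_ i)/andP[] := atyp.
rewrite (le_trans (ler_normB _ _))// (le_trans (lerD (ler_normD _ _) (lexx _)))//.
rewrite (ger0_norm d0).
have : m <= m * (m * rho) by have := ler_wpM2l (ltW m_gt0) rho_ge; rewrite mulr1.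
have -> : 5 * m ^+ 2 * rho = 5 * (m * (m * rho)) by ring.
move: T1 T2; have -> : 2 * m * (m * rho) = 2 * (m * (m * rho)) by ring.
have -> : m * rho * m = m * (m * rho) by ring.
by move: (m * (m * rho)) => M; lra.
Qed.

Lemma typical_path_gain s t i : path_gain s t i a <= 6 * m.
Proof.
have ds := typical_deg_le s; have dt := typical_deg_le t.
have ds0 := deg_ge0 (R := R) s a; have dt0 := deg_ge0 (R := R) t a.
have x1 := adj_le1 (R := R) i s a; have x2 := adj_le1 (R := R) i t a.
move: m_ge1; rewrite /path_gain; case: (i == s); case: (i == t); rewrite /= ?mul1r ?mul0r; lra.
Qed.

Variables (s t : 'I_n).
Hypotheses (st : s != t) (xst : x s t a = 0).

Let closure_diffE : N * diff (edge s t) (@mean_closure R n) a =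
  \sum_i ((triangles i a + tri_gain s t i a) / (two_paths i a + path_gain s t i a)
    - triangles i a / two_paths i a).
Proof.
have upd0 : upd (edge s t) false a = a.
  rewrite -[RHS](upd_id (edge s t) a); congr upd; apply/esym; move: xst.
  by rewrite /adj st; case: (a _) => // /eqP; rewrite oner_eq0.
rewrite /diff upd0 /mean_closure -mulrBr mulrA divff ?gt_eqF// mul1r -sumrB.
apply: eq_bigr => i _; congr (_ / _ - _).
- have := diff_triangles (R := R) i a st; rewrite /diff upd0 -/(tri_gain s t i a).
  by move=> <-; ring.
- have := diff_two_paths i st xst; rewrite /diff upd0 -/(path_gain s t i a).
  by move=> <-; ring.
Qed.

(** Taylor's formula for the quotient of triangles by 2-paths: the increments of
   both are divided by means, and each error term is an increment times a
   deviation from a mean. *)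
Lemma closure_diff_approx :
  `|N * diff (edge s t) (@mean_closure R n) a -
    \sum_i (tri_gain s t i a / nu i - tau i * path_gain s t i a / nu i ^+ 2)| <=
  132 * kap ^+ 2 * rho / m ^+ 2 * common s t a + 528 * kap ^+ 3 * rho / N +
  4 * kap ^+ 2 / m ^+ 4 * \sum_i `|triangles i a - tau i| * path_gain s t i a.
Proof.
pose c1 := 22 * kap ^+ 2 * rho / m ^+ 2.
pose c2 := 66 * kap ^+ 3 * rho / m ^+ 4.
pose c3 := 4 * kap ^+ 2 / m ^+ 4.
have p0 : p != 0 by move: m_gt0; rewrite pmulr_rgt0// => /gt_eqF->.
have n0 : N != 0 by rewrite gt_eqF.
have term i : `|(triangles i a + tri_gain s t i a) / (two_paths i a + path_gain s t i a)
    - triangles i a / two_paths i a -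
    (tri_gain s t i a / nu i - tau i * path_gain s t i a / nu i ^+ 2)| <=
    c1 * tri_gain s t i a + c2 * (tau i * path_gain s t i a) +
    c3 * (`|triangles i a - tau i| * path_gain s t i a).
  set T := triangles i a; set dT := tri_gain s t i a; set V := two_paths i a.
  set dV := path_gain s t i a; set ta := tau i.
  have dT0 : 0 <= dT by exact: tri_gain_ge0.
  have dV0 : 0 <= dV by exact: path_gain_ge0.
  have nu0 := mean_paths_gt0 i.
  have Vd : `|V - nu i| <= 11 * m ^+ 2 * rho.
    apply: (le_trans (typical_two_paths i)).
    have : 0 <= m ^+ 2 * rho by rewrite mulr_ge0 ?sqr_ge0// ltW.
    by rewrite -!mulrA; move: (m ^+ 2 * rho) => M; lra.
  have V1d : `|V + dV - nu i| <= 11 * m ^+ 2 * rho.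
    rewrite addrAC (le_trans (ler_normD _ _))// (ger0_norm dV0).
    have mmr : m <= m * (m * rho) by have := ler_wpM2l (ltW m_gt0) rho_ge; rewrite mulr1.
    have := typical_two_paths i; rewrite -/V; have := typical_path_gain s t i; rewrite -/dV.
    have -> : 5 * m ^+ 2 * rho = 5 * (m * (m * rho)) by ring.
    have -> : 11 * m ^+ 2 * rho = 11 * (m * (m * rho)) by ring.
    by move: mmr; move: (m * (m * rho)) => M; lra.
  have dnu : 11 * m ^+ 2 * rho <= nu i / 2.
    have mm : m ^+ 2 * (22 * kap * rho) <= m ^+ 2 * 1 by rewrite ler_wpM2l ?sqr_ge0.
    rewrite -(ler_pM2l kap_gt0); move: mm (nu_ge i); rewrite mulr1.
    have -> : kap * (11 * m ^+ 2 * rho) = 2^-1 * (m ^+ 2 * (22 * kap * rho)) by field.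
    by move: (m ^+ 2 * (22 * kap * rho)) (m ^+ 2) => M M'; lra.
  have [V0 V10 iV1 iVV] := inv_perturb nu0 dnu Vd V1d.
  have -> : (T + dT) / (V + dV) - T / V - (dT / nu i - ta * dV / nu i ^+ 2) =
    dT * ((V + dV)^-1 - (nu i)^-1) - T * dV * ((V * (V + dV))^-1 - (nu i)^-1 ^+ 2)
     - (T - ta) * dV * (nu i)^-1 ^+ 2.
    by field; rewrite !gt_eqF.
  have inu := inv_mean_paths_le i; have inu0 := inu_ge0 i.
  have km0 : 0 <= kap / m ^+ 2 by nonneg.
  have inu2 : (nu i)^-1 ^+ 2 <= (kap / m ^+ 2) ^+ 2 by rewrite ler_pXn2r ?nnegrE.
  have inu3 : (nu i)^-1 ^+ 3 <= (kap / m ^+ 2) ^+ 3 by rewrite ler_pXn2r ?nnegrE.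
  have m2r : 0 <= m ^+ 2 * rho by nonneg.
  have iV1' : `|(V + dV)^-1 - (nu i)^-1| <= c1.
    apply: (le_trans iV1); have -> : c1 = 22 * (m ^+ 2 * rho) * (kap / m ^+ 2) ^+ 2.
      by rewrite /c1; field; rewrite ?p0 ?n0.
    have -> : 2 * (11 * m ^+ 2 * rho) = 22 * (m ^+ 2 * rho) by ring.
    by apply: ler_wpM2l => //; nonneg.
  have iVV' : `|(V * (V + dV))^-1 - (nu i)^-1 ^+ 2| <= c2.
    apply: (le_trans iVV); have -> : c2 = 66 * (m ^+ 2 * rho) * (kap / m ^+ 2) ^+ 3.
      by rewrite /c2; field; rewrite ?p0 ?n0.
    have -> : 6 * (11 * m ^+ 2 * rho) = 66 * (m ^+ 2 * rho) by ring.
    by apply: ler_wpM2l => //; nonneg.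
  have T0 : 0 <= T by exact: triangles_ge0.
  have Tle : T <= ta + `|T - ta| by rewrite -lerBlDl ler_norm.
  have c20 : 0 <= c2 by rewrite /c2; nonneg.
  have c23 : c2 + (kap / m ^+ 2) ^+ 2 <= c3.
    have -> : c2 = 3 * (kap / m ^+ 2) ^+ 2 * (22 * kap * rho) by rewrite /c2; field; rewrite ?p0 ?n0.
    have -> : c3 = 3 * (kap / m ^+ 2) ^+ 2 * 1 + (kap / m ^+ 2) ^+ 2 by rewrite /c3; field; rewrite ?p0 ?n0.
    by rewrite lerD2r; apply: ler_wpM2l => //; nonneg.
  rewrite (le_trans (ler_normB _ _))//.
  apply: (le_trans (lerD (ler_normB _ _) (lexx _))).
  rewrite !normrM (ger0_norm dT0) (ger0_norm dV0) (ger0_norm T0).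
  rewrite (ger0_norm inu0).
  have E1 : dT * `|(V + dV)^-1 - (nu i)^-1| <= c1 * dT by rewrite mulrC ler_wpM2r.
  have E2 : T * dV * `|(V * (V + dV))^-1 - (nu i)^-1 ^+ 2| <= (ta + `|T - ta|) * dV * c2.
    by apply: ler_pM => //; [exact: mulr_ge0|exact: ler_wpM2r].
  have E3 : `|T - ta| * dV * (nu i)^-1 ^+ 2 <= `|T - ta| * dV * (kap / m ^+ 2) ^+ 2.
    by apply: ler_wpM2l => //; nonneg.
  have E4 : (`|T - ta| * dV) * (c2 + (kap / m ^+ 2) ^+ 2) <= (`|T - ta| * dV) * c3.
    by apply: ler_wpM2l => //; nonneg.
  apply: (le_trans (lerD (lerD E1 E2) E3)).
  rewrite -[leRHS]addr0 -[X in _ <= _ + X](subrr ((`|T - ta| * dV) * c3)).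
  rewrite -subr_ge0; move: E4; rewrite -subr_ge0.
  by congr (is_true (0 <= _)); ring.
rewrite closure_diffE -sumrB.
apply: (le_trans (ler_norm_sum _ _ _)); apply: (le_trans (ler_sum _ (fun i _ => term i))).
rewrite !big_split/= -!big_distrr/= sum_tri_gain lerD2r; apply: lerD.
  by apply: eq_ler; rewrite /c1; ring.
have c20 : 0 <= c2 by rewrite /c2; nonneg.
have tauB : \sum_i tau i * path_gain s t i a <= N * (N * p ^+ 3) * (8 * m).
  apply: (@le_trans _ _ (\sum_i N * (N * p ^+ 3) * path_gain s t i a)).
    by apply: ler_sum => i _; rewrite ler_wpM2r ?path_gain_ge0// triangle_mean_le.
  rewrite -big_distrr/=; apply: ler_wpM2l; first by nonneg.
  rewrite sum_path_gain; have := typical_deg_le s; have := typical_deg_le t; lra.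
apply: (le_trans (ler_wpM2l c20 tauB)); apply: eq_ler.
by rewrite /c2; field; rewrite p0 n0.
Qed.

End Typical.

Definition closure_l s t : R := N^-1 * lin_coef s t.

Definition closure_C s t k : R := N^-1 * tri_coef s t k.

Definition remainder a : R :=
  mean_closure a - chaos q closure_l closure_C a - Eq (@mean_closure R n).

Let m0 : m != 0. Proof. by rewrite gt_eqF. Qed.
Let p0 : p != 0. Proof. by move: m_gt0; rewrite pmulr_rgt0// => /gt_eqF->. Qed.
Let n0 : N != 0. Proof. by rewrite gt_eqF. Qed.

Lemma tri_coefC12 i j k : tri_coef i j k = tri_coef j i k.
Proof. by rewrite /tri_coef; ring. Qed.

Lemma tri_coefC23 i j k : tri_coef i j k = tri_coef i k j.
Proof. by rewrite /tri_coef; ring. Qed.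

Lemma lin_coefC i j : lin_coef i j = lin_coef j i.
Proof.
rewrite /lin_coef; congr (_ - _).
  by apply: eq_bigr => k _; rewrite tri_coefC12; ring.
by apply: eq_bigr => k _; ring.
Qed.

Lemma lin_coef_le s t : `|lin_coef s t| <= 10 * kap ^+ 2 / N.
Proof.
have k2 : kap <= kap ^+ 2 by rewrite expr2 ler_peMr// ltW.
have T1 : `|\sum_k tri_coef s t k * (q s k * q t k)| <= N * (6 * kap / m ^+ 2 * (p * p)).
  apply: ler_norm_sum_const => k; rewrite ger0_norm; last first.
    by apply: mulr_ge0; [exact: tri_coef_ge0|exact: mulr_ge0].
  by apply: ler_pM; [exact: tri_coef_ge0|exact: mulr_ge0|exact: tri_coef_le|exact: ler_pM].
pose w i := (i == s)%:R * mu t + (i == t)%:R * mu s + q i s + q i t.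
have w0 i : 0 <= w i by rewrite /w !addr_ge0 ?mulr_ge0 ?mean_deg_ge0.
have sw : \sum_i w i <= 4 * m.
  rewrite /w !big_split/= !sum_indicator.
  have -> : \sum_i q i s = mu s by apply: eq_bigr => i _; rewrite q_sym.
  have -> : \sum_i q i t = mu t by apply: eq_bigr => i _; rewrite q_sym.
  by have := mean_deg_le s; have := mean_deg_le t; lra.
have T2 : `|\sum_i tau i / nu i ^+ 2 * w i| <= kap ^+ 2 / (N * m) * (4 * m).
  rewrite ger0_norm; last by apply: sumr_ge0 => i _; rewrite mulr_ge0 ?tau_nu_ge0.
  apply: (@le_trans _ _ (\sum_i kap ^+ 2 / (N * m) * w i)).
    by apply: ler_sum => i _; rewrite ler_wpM2r ?tau_nu_le.
  by rewrite -big_distrr/= ler_wpM2l// divr_ge0 ?sqr_ge0// mulr_ge0// ltW.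
rewrite /lin_coef; apply: (le_trans (ler_normB _ _)); apply: (le_trans (lerD T1 T2)).
have -> : N * (6 * kap / m ^+ 2 * (p * p)) = 6 * kap / N by field; rewrite n0 p0.
have -> : kap ^+ 2 / (N * m) * (4 * m) = 4 * kap ^+ 2 / N by field; rewrite n0 p0.
by rewrite -mulrDl ler_wpM2r ?invr_ge0//; lra.
Qed.

Let Ex_star_const k (Y : 'I_n -> R) (B : R) : (forall t, Y t ^+ 2 <= B) ->
  Eq (fun a => (\sum_t xi k t a * Y t) ^+ 2) <= N * (p * B).
Proof.
move=> YB; rewrite (Ex_star_sqr q_sym q_diag (Y := fun t _ => Y t))//.
apply: ler_sum_const => t; rewrite Ex_cst; apply: ler_pM => //; exact: sqr_ge0.
Qed.

Lemma Ex_lin_noise1_sqr s t :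
  Eq (fun a => lin_noise1 s t a ^+ 2) <= 144 * kap ^+ 2 / (N ^+ 2 * m).
Proof.
pose B := (6 * kap / m ^+ 2 * p) ^+ 2.
have YB i u k : (tri_coef s t k * q i u) ^+ 2 <= B.
  apply: sqr_le_norm; rewrite ger0_norm; last by apply: mulr_ge0; [exact: tri_coef_ge0|].
  by apply: ler_pM => //; [exact: tri_coef_ge0|exact: tri_coef_le].
have -> : 144 * kap ^+ 2 / (N ^+ 2 * m) = 2 * (N * (p * B)) + 2 * (N * (p * B)).
  by rewrite /B; field; rewrite n0 p0.
have -> : Eq (fun a => lin_noise1 s t a ^+ 2) = Eq (fun a =>
   ((\sum_k xi s k a * (tri_coef s t k * q t k)) + (\sum_k xi t k a * (tri_coef s t k * q s k))) ^+ 2).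
  apply: eq_Ex => a; congr (_ ^+ 2); rewrite -big_split/=; apply: eq_bigr => k _.
  by ring.
apply: (le_trans (Ex_sqr_add2 ew01 _ _)); apply: lerD.
  by apply: ler_wpM2l => //; apply: Ex_star_const.
by apply: ler_wpM2l => //; apply: Ex_star_const.
Qed.

Lemma Ex_lin_noise2_sqr s t :
  Eq (fun a => lin_noise2 s t a ^+ 2) <= 16 * kap ^+ 4 / (N ^+ 2 * m).
Proof.
pose B := (kap ^+ 2 / (N * m)) ^+ 2.
have YB k : (tau k / nu k ^+ 2) ^+ 2 <= B.
  by apply: sqr_le_norm; rewrite (ger0_norm (tau_nu_ge0 k)) tau_nu_le.
pose st (F : 'I_n -> R) u a := \sum_k xi u k a * F k.
pose A1 := st (fun=> tau s / nu s ^+ 2) t; pose A2 := st (fun=> tau t / nu t ^+ 2) s.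
pose A3 := st (fun k => tau k / nu k ^+ 2) s; pose A4 := st (fun k => tau k / nu k ^+ 2) t.
apply: (@le_trans _ _ (Eq (fun a => 4 * (A1 a ^+ 2 + A2 a ^+ 2 + A3 a ^+ 2 + A4 a ^+ 2)))).
  apply: le_Ex => [|a]; first exact: ew01.
  rewrite [leLHS](_ : _ = (A1 a + A2 a + A3 a + A4 a) ^+ 2); first exact: sqr_add4.
  congr (_ ^+ 2); rewrite /lin_noise2.
  transitivity (\sum_i ((i == s)%:R * (tau i / nu i ^+ 2 * (deg t a - mu t)) +
    (i == t)%:R * (tau i / nu i ^+ 2 * (deg s a - mu s)) + xi s i a * (tau i / nu i ^+ 2) +
    xi t i a * (tau i / nu i ^+ 2))).
    by apply: eq_bigr => i _; rewrite (cadjC q_sym i s) (cadjC q_sym i t); ring.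
  rewrite !big_split/= !sum_indicator; congr (_ + _ + _ + _).
    by rewrite /A1 /st -big_distrl/= mulrC; congr (_ * _); rewrite -sumrB.
  by rewrite /A2 /st -big_distrl/= mulrC; congr (_ * _); rewrite -sumrB.
rewrite ExZ 3!ExD.
have E1 : Eq (fun a => A1 a ^+ 2) <= N * (p * B) by exact: Ex_star_const.
have E2 : Eq (fun a => A2 a ^+ 2) <= N * (p * B) by exact: Ex_star_const.
have E3 : Eq (fun a => A3 a ^+ 2) <= N * (p * B) by exact: Ex_star_const.
have E4 : Eq (fun a => A4 a ^+ 2) <= N * (p * B) by exact: Ex_star_const.
apply: (le_trans (ler_wpM2l (ler0n R 4) (lerD (lerD (lerD E1 E2) E3) E4))).
by apply: eq_ler; rewrite /B; field; rewrite n0 p0.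
Qed.

(** The last error term in [closure_diff_approx] is a sum with weights
   [path_gain], to which the Cauchy-Schwarz inequality is applied. The weights
   are of order [m] at [s] and [t] and at most 2 at their neighbours. *)
Definition triangle_noise s t a : R :=
  2 * m * ((triangles s a - tau s) ^+ 2 + (triangles t a - tau t) ^+ 2) +
  \sum_i (x s i a + x t i a) * (triangles i a - tau i) ^+ 2.

Lemma Ex_triangle_noise s t : Eq (triangle_noise s t) <=
  8 * m * @triangles_bound R n p + 16 * m * @common_bound R n p.
Proof.
have TB := variance_triangles q_sym q_diag q01 q_le p_ge0.
have xB u i : Eq (fun a => x u i a * (triangles i a - tau i) ^+ 2) <=
    2 * p * (@triangles_bound R n p + 4 * @common_bound R n p).
  have CB0 : 0 <= @common_bound R n p by exact: common_bound_ge0.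
  have TB0 : 0 <= @triangles_bound R n p.
    by apply: le_trans (TB u); apply: Ex_ge0 => // a; exact: sqr_ge0.
  have [<-|ui] := eqVneq u i.
    rewrite [Ex _ _](_ : _ = 0); first by nonneg.
    by rewrite -[RHS](Ex_cst (edge_weight q)); apply: eq_Ex => a; rewrite adj_irrefl mul0r.
  apply: (le_trans (Ex_adj_mul_sqr q_sym q_diag q01 (fun a => triangles i a - tau i) ui)).
  apply: ler_pM => //.
  - by rewrite mulr_ge0.
  - by apply: addr_ge0; apply: Ex_ge0 => // a; exact: sqr_ge0.
  - by rewrite ler_wpM2l.
  apply: lerD; first exact: TB.
  rewrite [Ex _ _](_ : _ = 4 * Eq (fun a => common u i a ^+ 2)).
    by rewrite ler_wpM2l// Ex_common_sqr.
  rewrite -ExZ; apply: eq_Ex => a.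
  have -> : diff (edge u i) (fun a => triangles i a - tau i) a = diff (edge u i) (triangles i) a.
    by rewrite /diff; ring.
  rewrite diff_triangles// eqxx (eq_sym i u) (negbTE ui) adj_irrefl mulr0 mulr0 /=; ring.
rewrite /triangle_noise ExD ExZ ExD Ex_sum.
have S : \sum_i Eq (fun a => (x s i a + x t i a) * (triangles i a - tau i) ^+ 2) <=
    N * (2 * (2 * p * (@triangles_bound R n p + 4 * @common_bound R n p))).
  apply: ler_sum_const => i.
  rewrite [Ex _ _](_ : _ = Eq (fun a => x s i a * (triangles i a - tau i) ^+ 2) +
      Eq (fun a => x t i a * (triangles i a - tau i) ^+ 2)).
    by have := xB s i; have := xB t i; lra.
  by rewrite -ExD; apply: eq_Ex => a; ring.
have m2 : 0 <= 2 * m by rewrite mulr_ge0// ltW.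
apply: (le_trans (lerD (ler_wpM2l m2 (lerD (TB s) (TB t))) S)).
by apply: eq_ler; ring.
Qed.

(** A polynomial bound, which has a computable expectation, in contrast to the
   increments of the quotients. *)
Definition majorant s t a : R :=
  5 * (lin_noise1 s t a ^+ 2 + lin_noise2 s t a ^+ 2 +
   (132 * kap ^+ 2 * rho / m ^+ 2) ^+ 2 * common s t a ^+ 2 +
   (528 * kap ^+ 3 * rho / N) ^+ 2 +
   (4 * kap ^+ 2 / m ^+ 4) ^+ 2 * (8 * m) * triangle_noise s t a).

Lemma triangle_noise_ge0 s t a : 0 <= triangle_noise s t a.
Proof.
rewrite /triangle_noise addr_ge0 ?mulr_ge0 ?addr_ge0 ?sqr_ge0//.
by apply: sumr_ge0 => i _; rewrite mulr_ge0 ?sqr_ge0// addr_ge0 ?adj_ge0.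
Qed.

Lemma majorant_ge0 s t a : 0 <= majorant s t a.
Proof.
have := triangle_noise_ge0 s t a; rewrite /majorant => ?; nonneg.
Qed.

Lemma diff_remainder s t a : s != t ->
  N * diff (edge s t) remainder a = N * diff (edge s t) (@mean_closure R n) a -
   (lin_coef s t + \sum_k tri_coef s t k * (xi s k a * xi t k a)).
Proof.
move=> st; have := diff_chaos q_sym q_diag (l := closure_l) (C := closure_C) _ _ _ a st.
rewrite /closure_l /closure_C => dchaos.
have -> : diff (edge s t) remainder a = diff (edge s t) (@mean_closure R n) a -
     diff (edge s t) (chaos q closure_l closure_C) a.
  exact: diff_sub_cst.
rewrite dchaos.
- rewrite [LHS]mulrBr; congr (_ - _); rewrite [LHS]mulrDr mulVKf//; congr (_ + _).
  rewrite /path_sum big_distrr/=; apply: eq_bigr => k _.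
  by rewrite -!mulrA mulVKf.
- by move=> i j; rewrite lin_coefC.
- by move=> i j k; rewrite tri_coefC12.
- by move=> i j k; rewrite tri_coefC23.
Qed.

Lemma remainder_diff_typical s t a : s != t -> typical a -> x s t a = 0 ->
  (N * diff (edge s t) remainder a) ^+ 2 <= majorant s t a.
Proof.
move=> st atyp xst; rewrite diff_remainder//.
have := closure_diff_approx atyp st xst; have := linearization s t a.
set S := \sum_i (_ - _); set U := N * _; set W := lin_coef s t + _.
set Z := \sum_i `|_| * _; set c1 := 132 * _ * _ / _; set c2 := 528 * _ * _ / _.
set c3 := 4 * _ / _; set y1 := lin_noise1 s t a; set y2 := lin_noise2 s t a.
move=> lin approx.
have -> : U - W = U - S + (y1 - y2) by rewrite -lin; ring.
have Z0 : 0 <= Z by apply: sumr_ge0 => i _; rewrite mulr_ge0 ?path_gain_ge0.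
have Z2 : Z ^+ 2 <= 8 * m * triangle_noise s t a.
  apply: (le_trans (sqr_weighted_sum _ (fun i => path_gain_ge0 s t i a))).
  have d1 := typical_deg_le atyp s; have d2 := typical_deg_le atyp t.
  apply: ler_pM.
  - by apply: sumr_ge0 => i _; exact: path_gain_ge0.
  - by apply: sumr_ge0 => i _; rewrite mulr_ge0 ?sqr_ge0 ?path_gain_ge0.
  - by rewrite sum_path_gain; lra.
  have -> : \sum_i `|triangles i a - tau i| ^+ 2 * path_gain s t i a =
      \sum_i (triangles i a - tau i) ^+ 2 * path_gain s t i a.
    by apply: eq_bigr => i _; rewrite real_normK ?num_real.
  rewrite sum_path_gain_weighted lerD2r mulrDr addrC [leLHS]addrC.
  by apply: lerD; rewrite mulrC; apply: ler_wpM2r => //; exact: sqr_ge0.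
have c10 : 0 <= c1 by rewrite /c1; nonneg.
have c20 : 0 <= c2 by rewrite /c2; nonneg.
have c30 : 0 <= c3 by rewrite /c3; nonneg.
have com0 := common_ge0 (R := R) s t a.
have le5 : `|U - S + (y1 - y2)| <= `|y1| + `|y2| + c1 * common s t a + c2 + c3 * Z.
  have := ler_normD (U - S) (y1 - y2); have := ler_normB y1 y2.
  by move: approx; lra.
apply: (le_trans (sqr_le_norm le5)); apply: (le_trans (sqr_add5 _ _ _ _ _)).
rewrite /majorant -/c1 -/c2 -/c3 -/y1 -/y2 !real_normK ?num_real//.
rewrite ler_wpM2l// [(c1 * _) ^+ 2]exprMn lerD2l [(c3 * _) ^+ 2]exprMn -mulrA.
by rewrite ler_wpM2l ?sqr_ge0.
Qed.

Definition majorant_bound : R :=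
  1500 * 1000 * kap ^+ 6 * (p + rho ^+ 2 + m * rho ^+ 2 * p + m^-1) / (N * m ^+ 2).

Lemma Ex_majorant s t : s != t -> Eq (majorant s t) <= majorant_bound.
Proof.
move=> st; rewrite /majorant ExZ !ExD !ExZ Ex_cst.
have E1 := Ex_lin_noise1_sqr s t; have E2 := Ex_lin_noise2_sqr s t.
have E3 := Ex_common_sqr q_sym q_diag q01 q_le st.
have E4 := Ex_triangle_noise s t.
set c1 := 132 * _ * _ / _; set c2 := 528 * _ * _ / _; set c3 := 4 * _ / _.
have F3 := ler_wpM2l (sqr_ge0 c1) E3.
have F4 : c3 ^+ 2 * (8 * m) * Eq (triangle_noise s t) <= c3 ^+ 2 * (8 * m) *
    (8 * m * @triangles_bound R n p + 16 * m * @common_bound R n p).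
  by apply: ler_wpM2l => //; rewrite mulr_ge0 ?sqr_ge0// mulr_ge0// ltW.
apply: (le_trans (ler_wpM2l (ler0n R 5) (lerD (lerD (lerD (lerD E1 E2) F3) (lexx _)) F4))).
have p2 : p ^+ 2 = p * p by ring.
have ik : 1 <= kap ^+ 2 by rewrite expr_ge1// ltW.
pose D := (N * m ^+ 2)^-1.
have D0 : 0 <= D by rewrite /D; nonneg.
have m1 : m^-1 <= 1 by rewrite invf_le1.
have im0 : 0 <= m^-1 by rewrite invr_ge0 ltW.
have r2 : 0 <= rho ^+ 2 by exact: sqr_ge0.
have K2 : kap ^+ 2 <= kap ^+ 6 by rewrite ler_weXn2l.
have K4 : kap ^+ 4 <= kap ^+ 6 by rewrite ler_weXn2l.
have K6 : 0 <= kap ^+ 6 by rewrite exprn_ge0 ?ltW.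
have G1 : 144 * kap ^+ 2 / (N ^+ 2 * m) <= 144 * kap ^+ 6 * (p * D).
  rewrite [leLHS](_ : _ = 144 * kap ^+ 2 * (p * D)); last by rewrite /D; field; rewrite n0 p0.
  by rewrite ler_wpM2r ?mulr_ge0// ler_wpM2l.
have G2 : 16 * kap ^+ 4 / (N ^+ 2 * m) <= 16 * kap ^+ 6 * (p * D).
  rewrite [leLHS](_ : _ = 16 * kap ^+ 4 * (p * D)); last by rewrite /D; field; rewrite n0 p0.
  by rewrite ler_wpM2r ?mulr_ge0// ler_wpM2l.
have G3 : c1 ^+ 2 * @common_bound R n p <= 132 ^+ 2 * kap ^+ 6 * ((rho ^+ 2 + m * rho ^+ 2 * p) * D).
  rewrite [leLHS](_ : _ = 132 ^+ 2 * kap ^+ 4 * ((rho ^+ 2 + m * rho ^+ 2 * p) * D)).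
    by apply: ler_wpM2r; [nonneg|apply: ler_wpM2l => //; nonneg].
  by rewrite /c1 /common_bound /D; field; rewrite n0 p0.
have G4 : c2 ^+ 2 <= 528 ^+ 2 * kap ^+ 6 * ((m * rho ^+ 2 * p) * D).
  apply: eq_ler.
  by rewrite /c2 /D; field; rewrite n0 p0.
have G5 : c3 ^+ 2 * (8 * m) * (8 * m * @triangles_bound R n p + 16 * m * @common_bound R n p) <=
    20 * 1024 * kap ^+ 6 * ((m^-1 + p) * D).
  rewrite [leLHS](_ : _ = 1024 * kap ^+ 4 * ((18 * m^-1 + 12 * p + 2 * (m^-1 * m^-1 + p * m^-1)) * D)).
    rewrite (_ : 20 * 1024 * _ * _ = 1024 * kap ^+ 6 * ((20 * m^-1 + 20 * p) * D)); last by ring.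
    apply: ler_pM.
    - exact: (mulr_ge0 (ler0n R 1024) (exprn_ge0 4 (ltW kap_gt0))).
    - by nonneg.
    - exact: (ler_wpM2l (ler0n R 1024) K4).
    rewrite ler_wpM2r//.
    exact: quadratic_coefs.
  by rewrite /c3 /common_bound /triangles_bound /common_bound /D; field; rewrite n0 p0.
apply: (le_trans (ler_wpM2l (ler0n R 5) (lerD (lerD (lerD (lerD G1 G2) G3) G4) G5))).
have -> : majorant_bound = 1500 * 1000 * (kap ^+ 6 * (p * D)) + 1500 * 1000 * (kap ^+ 6 * (rho ^+ 2 * D))
  + 1500 * 1000 * (kap ^+ 6 * (m * rho ^+ 2 * p * D)) + 1500 * 1000 * (kap ^+ 6 * (m^-1 * D)).
  by rewrite /majorant_bound -/D; ring.
have -> : 144 * kap ^+ 6 * (p * D) = 144 * (kap ^+ 6 * (p * D)) by ring.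
have -> : 16 * kap ^+ 6 * (p * D) = 16 * (kap ^+ 6 * (p * D)) by ring.
have -> : 132 ^+ 2 * kap ^+ 6 * ((rho ^+ 2 + m * rho ^+ 2 * p) * D) =
  132 ^+ 2 * (kap ^+ 6 * (rho ^+ 2 * D)) + 132 ^+ 2 * (kap ^+ 6 * (m * rho ^+ 2 * p * D)) by ring.
have -> : 528 ^+ 2 * kap ^+ 6 * (m * rho ^+ 2 * p * D) =
  528 ^+ 2 * (kap ^+ 6 * (m * rho ^+ 2 * p * D)) by ring.
have -> : 20 * 1024 * kap ^+ 6 * ((m^-1 + p) * D) =
  20 * 1024 * (kap ^+ 6 * (m^-1 * D)) + 20 * 1024 * (kap ^+ 6 * (p * D)) by ring.
have A1 : 0 <= kap ^+ 6 * (p * D) by nonneg.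
have A2 : 0 <= kap ^+ 6 * (rho ^+ 2 * D) by nonneg.
have A3 : 0 <= kap ^+ 6 * (m * rho ^+ 2 * p * D) by nonneg.
have A4 : 0 <= kap ^+ 6 * (m^-1 * D) by nonneg.
exact: majorant_coefs.
Qed.

(** A crude bound suffices on atypical graphs, which have an exponentially small
   probability. *)
Lemma remainder_diff_le s t a : s != t ->
  (N * diff (edge s t) remainder a) ^+ 2 <= (17 * kap ^+ 2 * N) ^+ 2.
Proof.
move=> st; apply: sqr_le_norm; rewrite diff_remainder//.
have N1 : 1 <= N.
  by rewrite ler1n lt0n; apply: contraTneq m_gt0 => ->; rewrite mul0r ltxx.
have iN : N^-1 <= 1 by rewrite invf_le1// N1.
have k2 : kap <= kap ^+ 2 by rewrite expr2 ler_peMr// ltW.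
have k21 : 1 <= kap ^+ 2 by rewrite expr_ge1// ltW.
have c01 b : 0 <= N * mean_closure (upd (edge s t) b a) <= N.
  rewrite /mean_closure mulrA divff// mul1r.
  rewrite sumr_ge0/=; last by move=> i _; have /andP[] := local_closure01 (R := R) i (upd (edge s t) b a).
  rewrite -[leRHS]mulr1; apply: ler_sum_const => i.
  by have /andP[] := local_closure01 (R := R) i (upd (edge s t) b a).
have T1 : `|N * diff (edge s t) (@mean_closure R n) a| <= N.
  by rewrite /diff mulrBr; apply: norm_sub_le.
have T2 : `|lin_coef s t| <= 10 * kap ^+ 2 * N.
  apply: (le_trans (lin_coef_le s t)); apply: ler_wpM2l; first by nonneg.
  exact: le_trans iN N1.
have T3 : `|\sum_k tri_coef s t k * (xi s k a * xi t k a)| <= N * (6 * kap).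
  apply: ler_norm_sum_const => k; rewrite normrM -[leRHS]mulr1; apply: ler_pM => //.
    rewrite (ger0_norm (tri_coef_ge0 s t k)); apply: (le_trans (tri_coef_le s t k)).
    apply: ler_piMr; first by nonneg.
    by rewrite invf_le1 ?exprn_gt0// expr_ge1// ltW.
  by rewrite normrM -[leRHS]mulr1; apply: ler_pM => //; exact: cadj_norm.
have T4 : N * (6 * kap) <= N * (6 * kap ^+ 2) by rewrite ler_wpM2l// ler_wpM2l.
have T5 : N * 1 <= N * kap ^+ 2 by rewrite ler_wpM2l.
apply: (le_trans (ler_normB _ _)).
have := ler_normD (lin_coef s t) (\sum_k tri_coef s t k * (xi s k a * xi t k a)).
have -> : 17 * kap ^+ 2 * N = N * kap ^+ 2 + 10 * kap ^+ 2 * N + N * (6 * kap ^+ 2) by ring.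
by move: T1 T2 T3 T4 T5; rewrite mulr1; lra.
Qed.

(** The Efron-Stein inequality for the remainder, which is centred. *)
Lemma Ex_remainder_sqr (PB : R) : Eq (fun a => (~~ typical a)%:R) <= PB ->
  Eq (fun a => remainder a ^+ 2) <=
  p * (majorant_bound + (17 * kap ^+ 2 * N) ^+ 2 * PB).
Proof.
move=> PBE.
have Erem : Eq remainder = 0.
  have -> : Eq remainder = Eq (@mean_closure R n) - Eq (chaos q closure_l closure_C) - Eq (@mean_closure R n).
    by rewrite /remainder !ExB Ex_cst.
  by rewrite Ex_chaos// subr0 subrr.
have -> : Eq (fun a => remainder a ^+ 2) = variance (edge_weight q) remainder.
  by rewrite /variance Erem expr0n subr0.
apply: (le_trans (poincare_edges q_sym q_diag q01 _)).
set B := majorant_bound + _.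
have PB0 : 0 <= PB by apply: le_trans PBE; apply: Ex_ge0 => // a; exact: ler0n.
have B0 : 0 <= B.
  have : 0 <= majorant_bound by rewrite /majorant_bound; nonneg; exact: ltW.
  by move=> ?; rewrite /B; nonneg.
have step s t : s != t -> Eq (fun a => diff (edge s t) remainder a ^+ 2) <= 2 * (N^-1 ^+ 2 * B).
  move=> st.
  (* The increment ignores the edge, which may thus be taken to be absent at
     the cost of a factor [1 - q s t], and this is at least 1/2. *)
  have Q2 : Eq (fun a => (1 - x s t a) * (N * diff (edge s t) remainder a) ^+ 2) <= B.
    apply: (@le_trans _ _ (Eq (fun a => majorant s t a + (17 * kap ^+ 2 * N) ^+ 2 * (~~ typical a)%:R))).
      apply: le_Ex => [|a]; first exact: ew01.
      have D2 := sqr_ge0 (N * diff (edge s t) remainder a).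
      have maj0 := majorant_ge0 s t a.
      have [atyp|atyp] /= := boolP (typical a); last first.
        rewrite mulr1 -[leLHS]add0r; apply: lerD => //.
        apply: le_trans (remainder_diff_le a st).
        rewrite ler_piMl// lerBlDr lerDl; exact: adj_ge0.
      rewrite mulr0 addr0.
      have [xst|xst] : x s t a = 0 \/ x s t a = 1.
        by rewrite /adj; case: (_ && _); [right|left].
      + rewrite xst subr0 mul1r; exact: remainder_diff_typical.
      + by rewrite xst subrr mul0r.
    rewrite ExD (ExZ _ ((17 * kap ^+ 2 * N) ^+ 2) (fun a => (~~ typical a)%:R)).
    apply: lerD; first exact: Ex_majorant.
    by apply: ler_wpM2l => //; exact: sqr_ge0.
  move: Q2; set dR := diff (edge s t) remainder.
  have -> : Eq (fun a => (1 - x s t a) * (N * dR a) ^+ 2) = (1 - q s t) * (N ^+ 2 * Eq (fun a => dR a ^+ 2)).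
    have E2 : Eq (fun a => x s t a * dR a ^+ 2) = q s t * Eq (fun a => dR a ^+ 2).
      by rewrite Ex_adj_mul// => b a; rewrite /dR ignores_diff.
    rewrite mulrBl mul1r [q s t * _]mulrCA -E2 -2!ExZ -ExB; apply: eq_Ex => a.
    by ring.
  set e := Eq _ => eB; have e0 : 0 <= e by apply: Ex_ge0 => // a; exact: sqr_ge0.
  have qh : 2^-1 <= 1 - q s t by have := q_le s t; move: p_half; lra.
  have : 2^-1 * (N ^+ 2 * e) <= B.
    by apply: le_trans eB; rewrite ler_wpM2r// mulr_ge0 ?sqr_ge0.
  have -> : 2^-1 * (N ^+ 2 * e) = (2^-1 * N ^+ 2) * e by rewrite mulrA.
  have i0 : 0 < 2^-1 * N ^+ 2 by rewrite mulr_gt0 ?invr_gt0// exprn_gt0.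
  move=> H; rewrite -(ler_pM2l i0); apply: (le_trans H).
  by apply: eq_ler; field.
rewrite (_ : p * B = 2^-1 * (N * (N * (p * (2 * (N^-1 ^+ 2 * B)))))); last by field.
rewrite ler_wpM2l ?invr_ge0//; apply: ler_sum_const => s; apply: ler_sum_const => t.
have [->|st] := eqVneq s t; first by rewrite evar_diag// mul0r; nonneg.
apply: ler_pM => //; last exact: step.
by apply: Ex_ge0 => [|a]; [exact: ew01|exact: sqr_ge0].
Qed.

End Remainder.

(** * Concentration of degrees and of numbers of 2-paths *)

Section Concentration.
Context {R : realType} {n : nat} (q : 'M[R]_n) (p rho : R).
Local Notation config := {ffun 'I_n * 'I_n -> bool}.
Implicit Types (a : config) (i j k : 'I_n).
Local Notation xi := (cadj q).
Local Notation N := (n%:R : R).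
Local Notation m := (n%:R * p : R).

Hypothesis q_sym : forall i j, q i j = q j i.
Hypothesis q_diag : forall i, q i i = 0.
Hypothesis q01 : forall i j, 0 <= q i j <= 1.
Hypothesis q_le : forall i j, q i j <= p.
Hypothesis p_ge0 : 0 <= p.
Hypothesis m_gt0 : 0 < m.
Hypothesis rho_ge0 : 0 <= rho.
Hypothesis rho_le1 : rho <= 1.

Local Notation Eq := (Ex (edge_weight q)).
Local Notation v := (evar q).
Let ew01 := edge_weight01 q01.

Lemma expR_le_quadratic (u : R) : u <= 2^-1 -> expR u <= 1 + u + 2 * u ^+ 2.
Proof.
move=> u2; have u1 : 0 < 1 - u by lra.
apply: (@le_trans _ _ (1 - u)^-1).
  by rewrite -[leLHS]invrK lef_pV2 ?posrE ?invr_gt0 ?expR_gt0// -expRN; exact: expR_ge1Dx.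
rewrite -[leLHS]mul1r ler_pdivrMr//.
have -> : (1 + u + 2 * u ^+ 2) * (1 - u) = 1 + u ^+ 2 * (1 - 2 * u) by ring.
by rewrite lerDl mulr_ge0 ?sqr_ge0//; lra.
Qed.

(** Bernstein's bound for a Laplace transform, one independent factor at a
   time. *)
Lemma Ex_exp_star k (y : 'I_n -> R) (lam : R) (s : seq 'I_n) :
  (forall j, `|y j| <= 1) -> 0 <= lam -> lam <= 2^-1 -> uniq s ->
  Eq (fun a => expR (lam * \sum_(j <- s) xi k j a * y j)) <=
  expR (2 * lam ^+ 2 * \sum_(j <- s) v k j).
Proof.
move=> y1 lam0 lam2; elim: s => [_|j s IHs /= /andP[js us]].
  rewrite big_nil mulr0 expR0 (eq_Ex _ (_ : _ =1 (fun=> 1))) ?Ex_cst// => a.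
  by rewrite big_nil mulr0 expR0.
pose F a := expR (lam * \sum_(i <- s) xi k i a * y i).
have EF := IHs us; have F0 a : 0 <= F a by exact: expR_ge0.
rewrite big_cons mulrDr expRD.
apply: (@le_trans _ _ ((1 + 2 * lam ^+ 2 * v k j) * Eq F)); last first.
  apply: ler_pM => //; last exact: expR_ge1Dx.
    by nonneg; exact: evar_ge0.
  by apply: Ex_ge0.
have [jk|jk] := eqVneq k j.
  rewrite -jk evar_diag// mulr0 addr0 mul1r; apply: eq_ler.
  by apply: eq_Ex => a; rewrite big_cons cadj_irrefl// mul0r add0r.
have FI : ignores (edge k j) F.
  move=> b a; rewrite /F; congr (expR (_ * _)).
  elim: s js {IHs us F EF F0} => [|i s IHs]; first by rewrite !big_nil.
  rewrite inE negb_or => /andP[ji js]; rewrite !big_cons IHs// cadj_upd//.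
  by rewrite edge_eq eqxx (eq_sym i j) (negbTE ji) (negbTE jk).
apply: (@le_trans _ _ (Eq (fun a => F a + (lam * y j) * (xi k j a * F a) +
    2 * lam ^+ 2 * (xi k j a ^+ 2 * F a)))).
  apply: le_Ex => // a; rewrite big_cons mulrDr expRD -/(F a).
  have yx : `|xi k j a * y j| <= 1.
    by rewrite normrM -[leRHS]mulr1; apply: ler_pM => //; exact: cadj_norm.
  apply: (@le_trans _ _ ((1 + lam * (xi k j a * y j) + 2 * (lam * (xi k j a * y j)) ^+ 2) * F a)).
    apply: ler_wpM2r => //; apply: expR_le_quadratic.
    rewrite (le_trans _ lam2)// -[leRHS]mulr1 ler_wpM2l//.
    by rewrite (le_trans (ler_norm _)).
  rewrite -subr_ge0.
  have -> : F a + lam * y j * (xi k j a * F a) + 2 * lam ^+ 2 * (xi k j a ^+ 2 * F a) -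
    (1 + lam * (xi k j a * y j) + 2 * (lam * (xi k j a * y j)) ^+ 2) * F a =
    2 * lam ^+ 2 * xi k j a ^+ 2 * F a * (1 - y j ^+ 2) by ring.
  apply: mulr_ge0; first by apply: mulr_ge0 => //; nonneg.
  by rewrite subr_ge0 -(expr1n _ 2) sqr_le_norm.
rewrite 2!ExD (ExZ _ (lam * y j) (fun a => xi k j a * F a)).
rewrite (ExZ _ (2 * lam ^+ 2) (fun a => xi k j a ^+ 2 * F a)).
rewrite Ex_cadj_ignores// Ex_cadj_sqr//; move: (Eq F) => e.
by apply: eq_ler; ring.
Qed.

Lemma star_tail k (y : 'I_n -> R) : (forall j, `|y j| <= 1) ->
  Eq (fun a => (m * rho < \sum_j xi k j a * y j)%R%:R) <= expR (- (m * rho ^+ 2 / 8)).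
Proof.
(* This value minimizes [2 * lam ^+ 2 * m - lam * m * rho]. *)
move=> y1; pose lam := rho / 4.
have lam0 : 0 <= lam by rewrite /lam; move: rho_ge0; lra.
have lam2 : lam <= 2^-1 by rewrite /lam; move: rho_le1; lra.
apply: (@le_trans _ _ (Eq (fun a => expR (- (lam * (m * rho))) * expR (lam * \sum_j xi k j a * y j)))).
  apply: le_Ex => // a; rewrite -expRD; case: ltP => /= [H|_]; last exact: expR_ge0.
  rewrite -[leLHS]expR0 ler_expR addrC subr_ge0 ler_wpM2l// ltW//.
rewrite (ExZ _ _ (fun a => expR (lam * \sum_j xi k j a * y j))).
have := Ex_exp_star k y1 lam0 lam2 (index_enum_uniq 'I_n).
move=> /(ler_wpM2l (expR_ge0 (- (lam * (m * rho))))) /le_trans; apply.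
rewrite -expRD ler_expR.
have S : \sum_j v k j <= m.
  by apply: ler_sum_const => j; rewrite (le_trans (evar_le _ _ _ _ _)).
have : 2 * lam ^+ 2 * \sum_j v k j <= 2 * lam ^+ 2 * m by rewrite ler_wpM2l// mulr_ge0// sqr_ge0.
move: (2 * lam ^+ 2 * \sum_j v k j) => E EB.
apply: (le_trans (lerD (lexx _) EB)); apply: eq_ler.
by rewrite /lam; field.
Qed.

(** A union bound over the vertices, the two conditions and the two signs. *)
Lemma atypical_prob :
  Eq (fun a => (~~ typical q p rho a)%:R) <= N * (4 * expR (- (m * rho ^+ 2 / 8))).
Proof.
set E := expR _.
pose B i (y : 'I_n -> R) a : R := (m * rho < \sum_j xi i j a * y j)%R%:R.
pose z j := mean_deg q j / m.
have z1 j : `|z j| <= 1.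
  rewrite ger0_norm; last by rewrite divr_ge0 ?mean_deg_ge0 ?ltW.
  by rewrite ler_pdivrMr// mul1r mean_deg_le.
have two (y : 'I_n -> R) i : (forall j, `|y j| <= 1) ->
    Eq (fun a => (m * rho < `|\sum_j xi i j a * y j|)%R%:R) <= 2 * E.
  move=> y1; have y1' j : `|- y j| <= 1 by rewrite normrN.
  apply: (@le_trans _ _ (Eq (fun a => B i y a + B i (fun j => - y j) a))).
    apply: le_Ex => // a; rewrite /B; under [X in _ <= _ + (_ < X)%R%:R]eq_bigr do rewrite mulrN.
    rewrite sumrN lter_normr; case: (_ < _) => /=; last by rewrite add0r.
    by rewrite lerDl ler0n.
  rewrite ExD; have := star_tail i y1; have := star_tail i y1'.
  by rewrite -/E /B => H1 H2; rewrite (_ : 2 * E = E + E); [exact: lerD H2 H1|ring].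
apply: (@le_trans _ _ (\sum_i (Eq (fun a => (m * rho < `|\sum_j xi i j a * 1|)%R%:R) +
    Eq (fun a => (m * rho < `|\sum_j xi i j a * z j|)%R%:R)))); last first.
  apply: ler_sum_const => i; have H1 := two (fun=> 1) i; have H2 := two z i z1.
  rewrite (_ : 4 * E = 2 * E + 2 * E); last by ring.
  by apply: lerD => //; apply: H1 => j; rewrite normr1.
under eq_bigr => i _ do rewrite -ExD.
rewrite -Ex_sum; apply: le_Ex => // a.
have [//|] /= := boolP (typical q p rho a).
  by move=> _; apply: sumr_ge0 => i _; rewrite addr_ge0 ?ler0n.
rewrite negb_forall => /existsP[i bad].
rewrite (bigD1 i)//= -[leLHS]addr0; apply: lerD; last first.
  by apply: sumr_ge0 => j _; rewrite addr_ge0 ?ler0n.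
have E1 : \sum_j xi i j a * 1 = \sum_j xi i j a by apply: eq_bigr => j _; rewrite mulr1.
have E2 : \sum_j xi i j a * z j = (\sum_j xi i j a * mean_deg q j) / m.
  by rewrite big_distrl/=; apply: eq_bigr => j _; rewrite /z mulrA.
have im0 : 0 <= m^-1 by rewrite invr_ge0 ltW.
rewrite E1 E2 normrM (ger0_norm im0) ltr_pdivlMr//.
move: bad; rewrite negb_and -!ltNge => /orP[]->.
  by rewrite lerDl ler0n.
by rewrite lerDr ler0n.
Qed.

End Concentration.

(** * Stein's equation for the normal law *)

Section MeanValue.
Context {R : realType}.
Implicit Types (F : R -> R) (a b : R).

Lemma mean_value F (F' : R -> R) a b : a <= b ->
  (forall x : R, a <= x <= b -> is_derive x 1 F (F' x)) ->
  exists2 c, a <= c <= b & F b - F a = F' c * (b - a).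
Proof.
move=> ab dF; have [||c cab E] := @MVT_segment R F F' a b ab.
- by move=> x; rewrite in_itv/= => /andP[/ltW ax /ltW xb]; apply: dF; rewrite ax.
- apply: derivable_within_continuous => x; rewrite in_itv/= => xab.
  by have := dF x xab => -[].
by exists c => //; move: cab; rewrite in_itv.
Qed.

Lemma derive_ge0_le F (F' : R -> R) a b : a <= b ->
  (forall x : R, a <= x <= b -> is_derive x 1 F (F' x)) ->
  (forall x, a <= x <= b -> 0 <= F' x) -> F a <= F b.
Proof.
move=> ab dF F'0; have [c cab E] := mean_value ab dF.
by rewrite -subr_ge0 E mulr_ge0 ?F'0// subr_ge0.
Qed.

Lemma derive_bounded_lipschitz F (F' : R -> R) (K : R) :
  (forall x : R, is_derive x 1 F (F' x)) -> (forall x, `|F' x| <= K) ->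
  forall x y, `|F y - F x| <= K * `|y - x|.
Proof.
move=> dF F'K x y; wlog xy : x y / x <= y.
  move=> W; have [|/ltW] := leP x y; first exact: W.
  by move=> yx; rewrite distrC [ `|y - x|]distrC; exact: W.
have [c _ ->] := mean_value xy (fun z _ => dF z).
by rewrite normrM ler_wpM2r.
Qed.

Lemma derive_lipschitz_taylor F (F' : R -> R) (K : R) :
  (forall x : R, is_derive x 1 F (F' x)) ->
  (forall x y, `|F' y - F' x| <= K * `|y - x|) ->
  forall x y, `|F y - F x - F' x * (y - x)| <= K * (y - x) ^+ 2.
Proof.
move=> dF F'K.
have K0 : 0 <= K.
  by have := F'K 0 1; rewrite subr0 normr1 mulr1; apply: le_trans.
have main x y z : `|z - x| <= `|y - x| -> F y - F x = F' z * (y - x) ->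
    `|F y - F x - F' x * (y - x)| <= K * (y - x) ^+ 2.
  move=> zx ->; rewrite -mulrBl normrM -(real_normK (num_real (y - x))) expr2 mulrA.
  rewrite ler_wpM2r// (le_trans (F'K x z))// ler_wpM2l//.
move=> x y; have [xy|/ltW yx] := leP x y.
  have [c /andP[xc cy] E] := mean_value xy (fun z _ => dF z).
  by apply: (main _ _ c) => //; rewrite !ger0_norm ?subr_ge0// lerD2r.
have [c /andP[xc cy] E] := mean_value yx (fun z _ => dF z).
apply: (main _ _ c); last by rewrite -opprB E; ring.
by rewrite !ler0_norm ?subr_le0// lerN2 lerD2r.
Qed.

End MeanValue.

Section StandardNormal.
Context {R : realType}.
Local Notation phi := (normal_pdf (0 : R) 1).
Local Notation mu := (@lebesgue_measure R).

Lemma normal_pdf01E (x : R) : phi x = normal_peak 1 * expR (- x ^+ 2 / 2).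
Proof. by rewrite normal_pdfE ?oner_neq0// /normal_fun subr0 expr1n. Qed.

Lemma normal_pdf_gt0 (x : R) : 0 < phi x.
Proof. by rewrite normal_pdf01E mulr_gt0 ?expR_gt0// normal_peak_gt0 ?oner_neq0. Qed.

Lemma is_derive_normal_pdf (x : R) : is_derive x 1 phi (- x * phi x).
Proof.
have -> : phi = fun x => normal_peak 1 * expR (- x ^+ 2 / 2).
  by apply/funext => y; exact: normal_pdf01E.
apply: is_derive_eq.
by rewrite /GRing.scale /=; field.
Qed.

(** Mills' ratio: a function with derivative [- phi] that vanishes at infinity
   is squeezed by two explicit functions, because the differences are monotone
   and vanish at infinity too. *)
Lemma mills_ratio (T : R -> R) : (forall x : R, is_derive x 1 T (- phi x)) ->
  T x @[x --> +oo] --> (0 : R) ->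
  forall y : R, 0 < y -> phi y * (y / (1 + y ^+ 2)) <= T y <= phi y / y.
Proof.
move=> dT T0 y y0.
have far (e : R) : 0 < e -> exists2 z : R, y <= z & `|T z| < e /\ phi z / z < e.
  move=> e0; have : \forall z \near +oo, `|T z| < e.
    by move/cvgr0Pnorm_lt : T0; apply.
  move=> Te; pose M := Num.max y (1 + normal_peak 1 / e).
  have : \forall z \near +oo, `|T z| < e /\ M <= z.
    near=> z; split; near: z => //.
    by apply: nbhs_pinfty_ge; exact: num_real.
  move=> [A [_ /(_ (A + 1))]]; rewrite ltrDl ltr01 => /(_ isT)[TA MA].
  exists (A + 1); first by apply: le_trans MA; rewrite /M le_max lexx.
  split=> //; have pA : 1 + normal_peak 1 / e <= A + 1.
    by apply: le_trans MA; rewrite /M le_max lexx orbT.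
  have k0 : 0 < normal_peak 1 / e :> R by rewrite divr_gt0 ?normal_peak_gt0 ?oner_neq0.
  have A0 : 0 < A + 1 by lra.
  rewrite ltr_pdivrMr// mulrC; apply: le_lt_trans (normal_pdf_ub _ _ _) _; first exact: oner_neq0.
  by rewrite -ltr_pdivrMr//; lra.
have phi0 z : 0 < phi z := normal_pdf_gt0 z.
have dphi z := is_derive_normal_pdf z.
have invd (z : R) : 0 < z -> is_derive z 1 (fun x => x^-1 : R) (- z ^- 2).
  move=> z0; have zn0 : z != 0 by rewrite gt_eqF.
  have := @is_deriveV R id z 1 1 zn0 (is_derive_id _ _).
  by rewrite /GRing.scale/= mulr1.
apply/andP; split; last first.
  rewrite leNgt; apply/negP => H.
  have dpos : 0 < T y - phi y / y by rewrite subr_gt0.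
  have [z yz [Tz _]] := far _ dpos.
  pose U x := T x - phi x * x^-1.
  have : U y <= U z.
    apply: (@derive_ge0_le _ U (fun x => phi x / x ^+ 2)) => // x /andP[yx xz].
      have x0 : 0 < x := lt_le_trans y0 yx.
      have dI := invd x x0; have dTx := dT x; have dp := dphi x.
      apply: is_derive_eq; rewrite /GRing.scale/=; field.
      by rewrite gt_eqF.
    by rewrite divr_ge0 ?sqr_ge0// ltW.
  have z0 : 0 < z := lt_le_trans y0 yz.
  have : 0 <= phi z / z by rewrite divr_ge0 ?ltW.
  by move: Tz; rewrite /U ltr_norml; lra.
rewrite leNgt; apply/negP => H.
pose g (x : R) := x / (1 + x ^+ 2).
pose d := phi y * g y - T y.
have d0 : 0 < d by rewrite subr_gt0.
have [z yz [Tz pz]] := far (d / 2) (divr_gt0 d0 (ltr0n _ 2)).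
have z0 : 0 < z := lt_le_trans y0 yz.
pose W x := phi x * g x - T x.
have : W y <= W z.
  apply: (@derive_ge0_le _ W (fun x => 2 * phi x / (1 + x ^+ 2) ^+ 2)) => // x /andP[yx xz].
    have x20 : 0 < 1 + x ^+ 2 by rewrite ltr_pwDl// sqr_ge0.
    have dTx := dT x; have dp := dphi x.
    have dI : is_derive x 1 (fun x : R => (1 + x ^+ 2)^-1) (- (1 + x ^+ 2) ^- 2 * (2 * x)).
      have dq : is_derive x 1 (fun x : R => 1 + x ^+ 2) (2 * x).
        by apply: is_derive_eq; rewrite /GRing.scale/=; ring.
      by apply: (is_deriveV _ dq); rewrite gt_eqF.
    rewrite /W /g; apply: is_derive_eq; rewrite /GRing.scale/=; field.
    by rewrite gt_eqF.
  by rewrite divr_ge0 ?sqr_ge0// mulr_ge0// ltW.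
have gz : phi z * g z <= phi z / z.
  have z20 : 0 < 1 + z ^+ 2 by rewrite ltr_pwDl// sqr_ge0.
  apply: ler_wpM2l; first exact: ltW.
  rewrite /g ler_pdivrMr//.
  by rewrite mulrDr mulr1 expr2 mulKf ?gt_eqF// lerDr invr_ge0 ltW.
by rewrite -/d /W; move: Tz pz gz; rewrite ltr_norml -/d; lra.
Unshelve. all: by end_near. Qed.

End StandardNormal.

Section SteinEquation.
Context {R : realType}.
Local Notation phi := (normal_pdf (0 : R) 1).
Local Notation mu := (@lebesgue_measure R).

(** A Lipschitz function between the indicators of [t <= u] and of
   [t <= u + eps]. *)
Definition ramp (u eps t : R) : R := Num.max 0 (Num.min 1 ((u + eps - t) / eps)).

Lemma ramp01 u eps t : 0 <= ramp u eps t <= 1.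
Proof. by rewrite /ramp le_max lexx/= ge_max ler01/= ge_min lexx. Qed.

Lemma ramp_eq1 u eps t : 0 < eps -> t <= u -> ramp u eps t = 1.
Proof.
move=> e0 tu; rewrite /ramp (min_idPl _).
  by rewrite (max_idPr _)// ler01.
by rewrite ler_pdivlMr// mul1r; lra.
Qed.

Lemma ramp_eq0 u eps t : 0 < eps -> u + eps <= t -> ramp u eps t = 0.
Proof.
move=> e0 tu; rewrite /ramp (max_idPl _)// ge_min; apply/orP; right.
by rewrite ler_pdivrMr// mul0r; lra.
Qed.

Lemma ramp_lipschitz u eps x y : 0 < eps ->
  `|ramp u eps y - ramp u eps x| <= eps^-1 * `|y - x|.
Proof.
move=> e0.
have -> : eps^-1 * `|y - x| = `|(u + eps - y) / eps - (u + eps - x) / eps|.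
  rewrite -mulrBl normrM [ `|eps^-1|]ger0_norm ?invr_ge0 ?ltW// mulrC; congr (_ * _).
  by rewrite -normrN; congr `|_|; ring.
rewrite /ramp; set z := _ / eps; set w := _ / eps.
have := ler_norm (z - w); have := ler_norm (w - z); rewrite (distrC w z).
have := normr_ge0 (z - w); move: `|z - w| => d d0 H1 H2.
have clip (s t : R) : s <= d + t ->
    Num.max 0 (Num.min 1 s) <= d + Num.max 0 (Num.min 1 t).
  move=> st; rewrite ge_max addr_ge0 ?le_max ?lexx//=.
  have [t1|t1] := leP 1 t; first by rewrite (max_idPr ler01) ge_min lerDr d0.
  have [t0|t0] := leP 0 t; first by rewrite ge_min st orbT.
  by rewrite ge_min; apply/orP; right; lra.
have zw : z <= d + w by lra.
have wz : w <= d + z by lra.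
have := clip z w zw; have := clip w z wz; rewrite ler_norml => A B.
by apply/andP; split; [rewrite lerBrDl lerBlDr addrC|rewrite lerBlDr].
Qed.

Lemma ramp_continuous u eps : continuous (ramp u eps).
Proof.
move=> t; pose g (s : R) : R := (u + eps - s) / eps.
have cg : {for t, continuous g}.
  apply: (@cvgM _ _ _ _ (fun s : R => u + eps - s) (fun=> eps^-1)); last exact: cvg_cst.
  by apply: (@cvgB _ R^o) => //; exact: cvg_cst.
have c1 : {for t, continuous (fun=> 1 : R)} by exact: cvg_cst.
have c0 : {for t, continuous (fun=> 0 : R)} by exact: cvg_cst.
exact: (continuous_max c0 (continuous_min c1 cg)).
Qed.

Definition weighted_cdf (h : R -> R) (x : R) : R :=
  \int[mu]_(t in `]-oo, x]) (h t * phi t).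

Definition normal_cdf (x : R) : R := fine (normal_prob 0 1 `]-oo, x]).

Lemma normal_cdfE x : normal_cdf x = weighted_cdf (fun=> 1) x.
Proof.
rewrite /normal_cdf /weighted_cdf /normal_prob /Rintegral; congr fine.
by apply: eq_integral => t _; rewrite mul1r.
Qed.

Lemma is_derive_weighted_cdf (h : R -> R) (x : R) : continuous h -> (forall t, 0 <= h t <= 1) ->
  is_derive x 1 (weighted_cdf h) (h x * phi x).
Proof.
move=> ch h01.
have cphi : continuous phi by apply: continuous_normal_pdf; exact: oner_neq0.
have ci : continuous (fun t => h t * phi t).
  by move=> t; apply: cvgM; [exact: ch|exact: cphi].
have int : mu.-integrable [set` `]-oo, x + 1]] (EFin \o (fun t => h t * phi t)).
  apply: (@le_integrable _ _ _ mu _ _ _ (EFin \o phi)) => //.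
  - apply/measurable_EFinP; apply: measurable_funTS; exact: continuous_measurable_fun.
  - move=> t _ /=; rewrite lee_fin normrM ler_piMl//.
    by have /andP[? ?] := h01 t; rewrite ger0_norm.
  - apply: (integrableS measurableT) => //; exact: integrable_normal_pdf.
have xx : x < x + 1 by rewrite ltrDl.
have [] := @continuous_FTC1 R (fun t => h t * phi t) (BInfty _ true) x _ xx int _ (ci x).
  by rewrite ltNyr.
rewrite -/(weighted_cdf h) => dF EF.
by apply: (DeriveDef dF); rewrite -derive1E; exact: EF.
Qed.

Lemma is_derive_normal_cdf (x : R) : is_derive x 1 normal_cdf (phi x).
Proof.
have -> : normal_cdf = weighted_cdf (fun=> 1) by apply/funext => y; exact: normal_cdfE.
rewrite -[phi x]mul1r; apply: is_derive_weighted_cdf => [t|t].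
  exact: cvg_cst.
by rewrite ler01 lexx.
Qed.

Let idTR : measurableTypeR R -> R := idfun.

#[local] HB.instance Definition _ :=
  @isMeasurableFun.Build _ _ _ _ idTR (@measurable_id _ _ setT).

Let cdf_id x : cdf (idTR : {RV (normal_prob 0 1) >-> R}) x = normal_prob 0 1 `]-oo, x].
Proof. by rewrite /cdf /distribution /pushforward preimage_id. Qed.

Lemma normal_cdf_y : normal_cdf x @[x --> +oo] --> (1 : R).
Proof.
have := cvg_cdfy1 (idTR : {RV (normal_prob 0 1) >-> R}) => /fine_cvg.
by apply: cvg_trans; apply: near_eq_cvg; near=> x; rewrite /= -cdf_id.
Unshelve. all: by end_near. Qed.

Lemma normal_cdf_Ny : normal_cdf (- x) @[x --> +oo] --> (0 : R).
Proof.
have := cvg_cdfNy0 (idTR : {RV (normal_prob 0 1) >-> R}) => /fine_cvg H.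
apply/(@cvgNy_compNP _ R normal_cdf); apply: cvg_trans H.
by apply: near_eq_cvg; near=> x; rewrite /= -cdf_id.
Unshelve. all: by end_near. Qed.

Lemma normal_cdf01 x : 0 <= normal_cdf x <= 1.
Proof.
rewrite fine_ge0//= -lee_fin fineK; first exact: probability_le1.
by rewrite fin_num_measure.
Qed.

Lemma normal_pdfN (x : R) : phi (- x) = phi x.
Proof. by rewrite !normal_pdf01E sqrrN. Qed.

Lemma mills_right (y : R) : 0 < y ->
  phi y * (y / (1 + y ^+ 2)) <= 1 - normal_cdf y <= phi y / y.
Proof.
move=> y0; apply: (@mills_ratio R (fun x => 1 - normal_cdf x)) => // [x|].
  by have dp := is_derive_normal_cdf x; apply: is_derive_eq; rewrite ?add0r mul1r.
have := @cvgB _ R^o _ _ _ (fun=> 1) normal_cdf 1 1 (cvg_cst _) normal_cdf_y.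
by rewrite subrr; apply.
Qed.

Lemma mills_left (y : R) : 0 < y ->
  phi y * (y / (1 + y ^+ 2)) <= normal_cdf (- y) <= phi y / y.
Proof.
move=> y0; apply: (@mills_ratio R (fun x => normal_cdf (- x))) => // [x|].
  have dp := is_derive_normal_cdf (- x).
  have := @is_derive1_comp R normal_cdf (fun x => - x) x _ _ dp (is_deriveNid _ _).
  by rewrite normal_pdfN mulrN1.
exact: normal_cdf_Ny.
Qed.

(** The solution of Stein's equation is [(G - c Phi) / phi], with [G] the
   primitive of [ramp * phi] and [c] its limit, the normal mean of the ramp.
   Where the ramp is constant, it is a multiple of Mills' ratio, which bounds
   its derivatives on both tails; in between they are continuous. *)
Lemma stein_equation (u eps : R) : 0 < eps -> exists f f' : R -> R, exists K c : R,
  [/\ normal_cdf u <= c <= normal_cdf (u + eps), forall x, `|f' x| <= K,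
      forall x y, `|f y - f x - f' x * (y - x)| <= K * (y - x) ^+ 2 &
      forall x, f' x - x * f x = ramp u eps x - c].
Proof.
move=> e0; pose h := ramp u eps; pose G := weighted_cdf h; pose b := u + eps.
have ub : u <= b by rewrite /b lerDl ltW.
have h01 t : 0 <= h t <= 1 := ramp01 u eps t.
have dG (x : R) : is_derive x 1 G (h x * phi x).
  by apply: is_derive_weighted_cdf => //; exact: ramp_continuous.
have dPhi (x : R) := is_derive_normal_cdf x.
have phi0 (x : R) : 0 < phi x := normal_pdf_gt0 x.
have phi0' (x : R) : 0 <= phi x := ltW (phi0 x).
pose c := G b.
have Gu x : x <= u -> G x = normal_cdf x.
  move=> xu; rewrite normal_cdfE; apply: eq_Rintegral => t.
  rewrite inE/= in_itv/= => tx; by rewrite /h ramp_eq1// (le_trans tx).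
have Gb : forall y, b <= y -> G y = c.
  move=> x bx; have [z /andP[bz zx]] := mean_value bx (fun s _ => dG s).
  by rewrite /h ramp_eq0// !mul0r => /eqP; rewrite subr_eq0 => /eqP.
have cge : normal_cdf u <= c.
  rewrite -Gu// /c; apply: (derive_ge0_le ub (fun s _ => dG s)) => x _.
  by rewrite mulr_ge0//; have /andP[] := h01 x.
have cle : c <= normal_cdf b.
  have : normal_cdf u - G u <= normal_cdf b - G b.
    apply: (@derive_ge0_le R (fun x => normal_cdf x - G x) (fun x => phi x - h x * phi x)) => //.
    move=> x _; rewrite -[X in X - _]mul1r -mulrBl mulr_ge0// subr_ge0.
    by have /andP[] := h01 x.
  by rewrite Gu// subrr subr_ge0.
have /andP[Pu0 _] := normal_cdf01 u; have /andP[_ Pb1] := normal_cdf01 b.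
have c0 : 0 <= c by exact: le_trans cge.
have c1 : c <= 1 by exact: le_trans Pb1.
pose f x := (G x - c * normal_cdf x) / phi x.
pose f' x := h x - c + x * f x.
have df (x : R) : is_derive x 1 f (f' x).
  have dGx := dG x; have dPx := dPhi x; have dp := is_derive_normal_pdf x.
  have pn : phi x != 0 by rewrite gt_eqF.
  have dI := is_deriveV pn dp.
  rewrite /f; apply: is_derive_eq; rewrite /GRing.scale/= /f' /f; field.
  exact: pn.
(* By the equation, [f'] is Lipschitz as soon as [x * f x] is, and this function
   is differentiable while [f'] need not be. *)
pose g (x : R) := x * f x; pose g' x := f x + x * f' x.
have dg (x : R) : is_derive x 1 g (g' x).
  by have dfx := df x; apply: is_derive_eq; rewrite /GRing.scale/= /g'; ring.
pose M := Num.max 1 (Num.max `|u| `|b|).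
have M1 : 1 <= M by rewrite /M le_max lexx.
have uM : `|u| <= M by rewrite /M !le_max lexx orbT.
have bM : `|b| <= M by rewrite /M !le_max lexx !orbT.
have tail (y r : R) : 0 < y -> 1 <= y -> y / (1 + y ^+ 2) <= r <= y^-1 ->
    `|1 - y * r| <= 1 /\ `|(1 + y ^+ 2) * r - y| <= 1.
  move=> y0 y1 /andP[r1 r2].
  have y20 : 0 < 1 + y ^+ 2 by rewrite ltr_pwDl// sqr_ge0.
  have r0 : 0 <= r by apply: le_trans r1; rewrite divr_ge0// ltW.
  have yr : y * r <= 1 by rewrite mulrC -ler_pdivlMr// mul1r.
  have yr0 : 0 <= y * r by rewrite mulr_ge0// ltW.
  have yr1 : y <= (1 + y ^+ 2) * r by rewrite mulrC -ler_pdivrMr.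
  have iy : y^-1 <= 1 by rewrite invf_le1.
  have yr2 : (1 + y ^+ 2) * r <= y + 1.
    have -> : (1 + y ^+ 2) * r = r + y * (y * r) by ring.
    by rewrite addrC lerD//; [rewrite ler_piMr// ltW|apply: le_trans iy].
  by split; rewrite ler_norml; lra.
have right x : M <= x -> `|f' x| <= 1 /\ `|g' x| <= 1.
  move=> Mx; have x1 : 1 <= x by exact: le_trans Mx.
  have x0 : 0 < x by lra.
  have bx : b <= x by rewrite (le_trans _ Mx)// (le_trans (ler_norm b)).
  pose r := (1 - normal_cdf x) / phi x.
  have rb : x / (1 + x ^+ 2) <= r <= x^-1.
    have /andP[r1 r2] := mills_right x0.
    by rewrite /r ler_pdivlMr// ler_pdivrMr// mulrC r1 mulrC.
  have [T1 T2] := tail x r x0 x1 rb.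
  have fE : f x = c * r by rewrite /f Gb// /r; ring.
  have hE : h x = 0 by rewrite /h ramp_eq0.
  rewrite /g' /f' fE hE; split.
    have -> : 0 - c + x * (c * r) = - (c * (1 - x * r)) by ring.
    by rewrite normrN normrM ger0_norm// -[leRHS]mulr1; apply: ler_pM.
  have -> : c * r + x * (0 - c + x * (c * r)) = c * ((1 + x ^+ 2) * r - x) by ring.
  by rewrite normrM ger0_norm// -[leRHS]mulr1; apply: ler_pM.
have left x : x <= - M -> `|f' x| <= 1 /\ `|g' x| <= 1.
  move=> xM; pose y := - x; have xE : x = - y by rewrite /y opprK.
  have y1 : 1 <= y by rewrite /y; lra.
  have y0 : 0 < y by lra.
  have xu : x <= u.
    by rewrite (le_trans xM)// lerNl (le_trans _ uM)// -normrN ler_norm.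
  pose r := normal_cdf x / phi x.
  have rb : y / (1 + y ^+ 2) <= r <= y^-1.
    have /andP[r1 r2] := mills_left y0.
    by rewrite /r xE normal_pdfN ler_pdivlMr// ler_pdivrMr// mulrC r1 mulrC.
  have [T1 T2] := tail y r y0 y1 rb.
  have fE : f x = (1 - c) * r by rewrite /f Gu// /r; ring.
  have hE : h x = 1 by rewrite /h ramp_eq1.
  have c10 : 0 <= 1 - c by rewrite subr_ge0.
  have c11 : 1 - c <= 1 by lra.
  rewrite /g' /f' fE hE xE; split.
    have -> : 1 - c + - y * ((1 - c) * r) = (1 - c) * (1 - y * r) by ring.
    by rewrite normrM ger0_norm// -[leRHS]mulr1; apply: ler_pM.
  have -> : (1 - c) * r + - y * (1 - c + - y * ((1 - c) * r)) = (1 - c) * ((1 + y ^+ 2) * r - y) by ring.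
  by rewrite normrM ger0_norm// -[leRHS]mulr1; apply: ler_pM.
have cf : {within `[(- M), M], continuous f}.
  by apply: derivable_within_continuous => x _; have [] := df x.
have MM : - M <= M by lra.
have [F fF] : exists F, forall x, - M <= x <= M -> `|f x| <= F.
  have [z1 _ H1] := EVT_max MM cf; have [z2 _ H2] := EVT_min MM cf.
  exists (`|f z1| + `|f z2|) => x xM; rewrite ler_norml.
  have := H1 x; have := H2 x; rewrite !in_itv/= => /(_ xM) A /(_ xM) B.
  have := ler_norm (f z1); have := ler_norm (- f z2); rewrite normrN.
  have := normr_ge0 (f z1); have := normr_ge0 (f z2); lra.
have F0 : 0 <= F by apply: le_trans (fF 0 _) => //; lra.
pose K1 := 1 + M * F; pose K2 := 1 + F + M * K1.
have K10 : 1 <= K1 by rewrite /K1 lerDl mulr_ge0//; lra.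
have MK : 0 <= M * K1 by rewrite mulr_ge0//; lra.
have mid x : - M <= x <= M -> `|f' x| <= K1 /\ `|g' x| <= K2.
  move=> xM; have xn : `|x| <= M by rewrite ler_norml.
  have E1 : `|f' x| <= K1.
    rewrite /f' (le_trans (ler_normD _ _))// lerD//.
      by have /andP[? ?] := h01 x; rewrite ler_norml; lra.
    by rewrite normrM; apply: ler_pM => //; exact: fF.
  split=> //; rewrite /g' (le_trans (ler_normD _ _))// /K2.
  have := fF x xM; have : `|x * f' x| <= M * K1 by rewrite normrM; apply: ler_pM.
  lra.
have f'K x : `|f' x| <= K1.
  have [/left[]|xM] := leP x (- M); first by move=> /le_trans + _; apply.
  have [/right[]|Mx] := leP M x; first by move=> /le_trans + _; apply.
  have xI : - M <= x <= M by rewrite (ltW xM) (ltW Mx).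
  by have [] := mid x xI.
have g'K x : `|g' x| <= K2.
  have K21 : 1 <= K2 by rewrite /K2; lra.
  have [/left[]|xM] := leP x (- M); first by move=> _ /le_trans; apply.
  have [/right[]|Mx] := leP M x; first by move=> _ /le_trans; apply.
  have xI : - M <= x <= M by rewrite (ltW xM) (ltW Mx).
  by have [] := mid x xI.
pose K := K1 + (eps^-1 + K2).
have ie : 0 <= eps^-1 by rewrite invr_ge0 ltW.
have K20 : 0 <= K2 by rewrite /K2; lra.
exists f, f', K, c; split.
- by rewrite cge.
- by move=> x; rewrite (le_trans (f'K x))// /K; lra.
- apply: derive_lipschitz_taylor => // x y.
  have -> : f' y - f' x = (h y - h x) + (g y - g x) by rewrite /f' /g; ring.
  rewrite (le_trans (ler_normD _ _))//.
  have := derive_bounded_lipschitz dg g'K x y; have := ramp_lipschitz u x y e0.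
  rewrite -/h => A B; apply: (le_trans (lerD A B)).
  by rewrite -mulrDl ler_wpM2r// /K; lra.
- by move=> x; rewrite /f' /h; ring.
Qed.

End SteinEquation.

(** * The variance as a function of the weights *)

Section Identification.
Context {R : realType} {n : nat} (q : 'M[R]_n).
Hypothesis q_sym : forall i j, q i j = q j i.
Hypothesis q_diag : forall i, q i i = 0.
Local Notation N := (n%:R : R).
Implicit Types (i j k s t : 'I_n).

Lemma nuE i : nu q i = mean_paths q i.
Proof. by apply: eq_bigr => j _; rewrite /mean_deg mulr_sumr. Qed.

Lemma coef_aE s : coef_a q s = \sum_i triangle_mean q i / mean_paths q i ^+ 2 * q i s.
Proof.
apply: eq_bigr => i _; rewrite -nuE /triangle_mean !mulr_suml; apply: eq_bigr => j _.
by rewrite !mulr_suml; apply: eq_bigr => k _; rewrite -!mulrA; congr (_ * (_ * (_ * _))); rewrite mulrC.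
Qed.

Lemma coef_eE i s : coef_e q i s = triangle_mean q i / mean_paths q i ^+ 2 * mean_deg q s.
Proof.
rewrite -nuE /triangle_mean !mulr_suml; apply: eq_bigr => j _.
rewrite !mulr_suml; apply: eq_bigr => k _.
by rewrite /mean_deg mulr_sumr; apply: eq_bigr => t _; rewrite mulrAC.
Qed.

Lemma lin_coefE s t : lin_coef q s t =
  2 * coef_b q s t + 2 * coef_c q s t + 2 * coef_c q t s
    - (coef_a q s + coef_a q t) - (coef_e q s t + coef_e q t s).
Proof.
have -> : lin_coef q s t = 2 * coef_b q s t + 2 * coef_c q s t + 2 * coef_c q t s -
    (coef_e q s t + coef_e q t s + coef_a q s + coef_a q t).
  rewrite /lin_coef; congr (_ - _).
    rewrite !mulr_sumr -!big_split/=; apply: eq_bigr => k _.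
    by rewrite /tri_coef !nuE; ring.
  transitivity (\sum_i ((i == s)%:R * (triangle_mean q i / mean_paths q i ^+ 2 * mean_deg q t) +
      (i == t)%:R * (triangle_mean q i / mean_paths q i ^+ 2 * mean_deg q s) +
      triangle_mean q i / mean_paths q i ^+ 2 * q i s +
      triangle_mean q i / mean_paths q i ^+ 2 * q i t)).
    by apply: eq_bigr => i _; ring.
  by rewrite !big_split/= !sum_indicator !coef_aE !coef_eE.
ring.
Qed.

(** Sums over increasing indices are a half and a sixth of the symmetric sums in
   the variance of [chaos]. *)
Lemma sigma_sqE : sigma1_sq q + sigma2_sq q = chaos_var q (closure_l q) (closure_C q).
Proof.
rewrite addrC /chaos_var; congr (_ + _).
  have H := @sum_lt_half R n (fun i j => lin_coef q i j ^+ 2 * evar q i j).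
  transitivity (1 / N ^+ 2 * \sum_(i < n) \sum_(j < n | (i < j)%N)
      lin_coef q i j ^+ 2 * evar q i j).
    by congr (_ * _); apply: eq_bigr => i _; apply: eq_bigr => j _; rewrite lin_coefE.
  rewrite H => [|i j|i]; last 2 first.
  - by rewrite lin_coefC (evarC q_sym).
  - by rewrite (evar_diag q_diag) mulr0.
  rewrite mulrCA; congr (_ * _); rewrite mulr_sumr; apply: eq_bigr => i _.
  rewrite mulr_sumr; apply: eq_bigr => j _.
  by rewrite /closure_l exprMn exprVn; ring.
pose G i j k := tri_coef q i j k ^+ 2 * (evar q i j * evar q i k * evar q j k).
have H := @sum_lt_sixth R n G.
transitivity (1 / N ^+ 2 * \sum_(i < n) \sum_(j < n | (i < j)%N) \sum_(k < n | (j < k)%N) G i j k).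
  have E (x y : R) : 4 / x * y = 1 / x * (4 * y) by ring.
  rewrite /sigma1_sq E; congr (_ * _).
  rewrite mulr_sumr; apply: eq_bigr => i _; rewrite mulr_sumr; apply: eq_bigr => j _.
  rewrite mulr_sumr; apply: eq_bigr => k _.
  by rewrite /G /tri_coef !nuE /evar (q_sym k i); ring.
rewrite H => [|i j k|i j k|i j]; last 3 first.
- by rewrite /G tri_coefC12 (evarC q_sym i j); ring.
- by rewrite /G tri_coefC23 (evarC q_sym j k); ring.
- by rewrite /G (evar_diag q_diag) !mul0r mulr0.
rewrite mulrCA; congr (_ * _); rewrite mulr_sumr; apply: eq_bigr => i _.
rewrite mulr_sumr; apply: eq_bigr => j _; rewrite mulr_sumr; apply: eq_bigr => k _.
by rewrite /closure_C exprMn exprVn /G; ring.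
Qed.

Lemma average_closureE (a : {ffun 'I_n * 'I_n -> bool}) (b : 'I_n -> 'I_n -> bool) :
  (forall i j, (b i j)%:R = adj i j a :> R) -> average_closure b = mean_closure a :> R.
Proof.
move=> bE; have b0 i : (b i i)%:R = 0 :> R by rewrite bE adj_irrefl.
congr (_ * _); apply: eq_bigr => i _; congr (_ / _).
  rewrite [LHS]big_mkcond; apply: eq_bigr => j _.
  have [->|ji]/= := eqVneq j i; first by rewrite big1// => k _; rewrite adj_irrefl !mul0r.
  rewrite [LHS]big_mkcond; apply: eq_bigr => k _; rewrite !bE.
  have [->|ki]/= := eqVneq k i; first by rewrite adj_irrefl mulr0.
  by have [->|//] := eqVneq j k; rewrite adj_irrefl mulr0 mul0r.
rewrite [LHS]big_mkcond; apply: eq_bigr => j _.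
have [->|ji]/= := eqVneq j i; first by rewrite big1// => k _; rewrite adj_irrefl !mul0r.
rewrite [LHS]big_mkcond [RHS]big_mkcond; apply: eq_bigr => k _; rewrite !bE.
have [->|ki]//= := eqVneq k i.
by have [->|//] := eqVneq j k; rewrite adj_irrefl mulr0.
Qed.

End Identification.

(** * From the random graph to independent Bernoulli variables *)

Section Transfer.
Context {R : realType} {d} {Omega : measurableType d} {P : probability Omega R}.
Context {n : nat} (q : 'M[R]_n) (A : 'I_n -> 'I_n -> {RV P >-> bool}).
Hypothesis hA : heterogeneous_random_graph q A.
Local Notation config := {ffun 'I_n * 'I_n -> bool}.

(** Entries that are not above the diagonal are false, in accordance with their
   weight 0. *)
Definition edge_config (o : Omega) : config := [ffun e : 'I_n * 'I_n => (e.1 < e.2)%N && A e.1 e.2 o].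

Lemma adjacencyE i j o : (A i j o)%:R = adj i j (edge_config o) :> R.
Proof.
rewrite /adj /edge ffunE; have [ij|ji|ij] := ltngtP i j.
- by rewrite /= ij/= -val_eqE/= ltn_eqF.
- by rewrite /= ji/= -val_eqE/= gtn_eqF// (adjacency_sym hA).
- by rewrite (val_inj ij) eqxx (adjacency_irrefl hA).
Qed.

Let S : {set 'I_n * 'I_n} := [set e : 'I_n * 'I_n | (e.1 < e.2)%N]%SET.

Let edge_configP a o :
  (edge_config o = a) <-> (forall e, e \in S -> A e.1 e.2 o = a e) /\ (forall e, e \notin S -> a e = false).
Proof.
split=> [<-|[H1 H2]].
  by split=> e; rewrite inE ffunE; [move=> ->|move=> /negbTE ->].
apply/ffunP => e; rewrite ffunE; have [eS|eS] := boolP (e \in S).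
  by have := eS; rewrite inE => ->; rewrite H1.
by have := eS; rewrite inE => /negbTE->; rewrite H2.
Qed.

Let preim_edge e b : e \in S ->
  P (A e.1 e.2 @^-1` [set b]) = (if b then edge_weight q e else 1 - edge_weight q e)%:E.
Proof.
rewrite inE => e12; have H := adjacency_prob hA e12.
have mA c : measurable (A e.1 e.2 @^-1` [set c]).
  by rewrite -[X in measurable X]setTI; exact: measurable_funP.
rewrite /edge_weight e12; case: b => //.
have -> : A e.1 e.2 @^-1` [set false] = ~` (A e.1 e.2 @^-1` [set true]).
  by apply/seteqP; split=> o /=; case: (A _ _ o).
by rewrite probability_setC// H.
Qed.

(** Independence of the entries above the diagonal is the product formula for
   the probability of a configuration. *)
Lemma edge_config_preimage a :
  measurable (edge_config @^-1` [set a]) /\ P (edge_config @^-1` [set a]) = (weight (edge_weight q) a)%:E.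
Proof.
have [H|] := pselect (forall e, e \notin S -> a e = false); last first.
  move=> /existsNP[e /not_implyP[eS ae]].
  have -> : edge_config @^-1` [set a] = set0.
    by apply/seteqP; split=> o //= /edge_configP[_ /(_ e eS)].
  split=> //; rewrite measure0 /weight (bigD1 e)//=; case: (a e) ae => // _.
  by move: eS; rewrite inE /edge_weight => /negbTE->; rewrite mul0r.
pose B e : set bool := [set a e].
have E : edge_config @^-1` [set a] = \bigcap_(e in [set` S]) A e.1 e.2 @^-1` B e.
  by apply/seteqP; split=> o /=; rewrite edge_configP => // -[].
split.
  rewrite E; apply: fin_bigcap_measurable => // e _.
  by rewrite -[X in measurable X]setTI; exact: measurable_funP.
rewrite E (adjacency_indep hA)//.
rewrite (eq_bigr (fun e => (if a e then edge_weight q e else 1 - edge_weight q e)%:E)); last first.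
  by move=> e eS; rewrite preim_edge.
rewrite prodEFin; congr (_%:E).
rewrite /weight [RHS](bigID (mem S))/= [X in _ * X]big1 ?mulr1// => e eS.
by rewrite H// /edge_weight; move: eS; rewrite inE => /negbTE->; rewrite subr0.
Qed.

Lemma integral_edge_config (F : config -> R) : (forall a, 0 <= F a) ->
  (\int[P]_o (F (edge_config o))%:E = (Ex (edge_weight q) F)%:E)%E.
Proof.
move=> F0.
transitivity (\int[P]_o (\sum_a (F a * \1_(edge_config @^-1` [set a]) o)%:E))%E.
  apply: eq_integral => o _; rewrite sumEFin (bigD1 (edge_config o))//= big1 => [|a].
    by rewrite indicE mem_set// mulr1 addr0.
  by rewrite eq_sym indicE => /eqP H; rewrite memNset// mulr0.
rewrite ge0_integral_sum//.
- rewrite -sumEFin; apply: eq_bigr => a _.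
  have [ma Pa] := edge_config_preimage a.
  rewrite (@integralZl_indic _ _ _ _ _ _ (fun=> edge_config @^-1` [set a]))// => [|/lt_geF].
    have -> : (\int[P]_o (\1_(edge_config @^-1` [set a]) o)%:E)%E = P (edge_config @^-1` [set a]).
      by rewrite integral_indic// setIT.
    by rewrite Pa -EFinM mulrC.
  by rewrite F0.
- move=> a; have [ma _] := edge_config_preimage a.
  by apply/measurable_EFinP; apply: measurable_funM.
- by move=> a o _; rewrite lee_fin mulr_ge0.
Qed.

Lemma expectation_average_closure :
  fine 'E_P[average_closure_rv A] = Ex (edge_weight q) (@mean_closure R n).
Proof.
rewrite unlock -[RHS]/(fine (_%:E)) -integral_edge_config.
  by congr fine; apply: eq_integral => o _; rewrite /average_closure_rv (average_closureE (fun i j => adjacencyE i j o)).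
move=> a; apply: mulr_ge0; first by rewrite invr_ge0 ler0n.
apply: sumr_ge0 => i _.
by have /andP[] := @local_closure01 R n i a.
Qed.

Lemma cdf_standardize (s x : R) :
  cdf (standardize (average_closure_rv A : {RV P >-> R}) s : {RV P >-> R}) x =
  (Ex (edge_weight q) (fun a =>
    ((mean_closure a - Ex (edge_weight q) (@mean_closure R n)) / s <= x)%R%:R))%:E.
Proof.
rewrite -integral_edge_config// /cdf /distribution /pushforward.
set B := _ @^-1` _.
have mB : measurable B by rewrite -[X in measurable X]setTI; exact: measurable_funP.
have -> : P B = (\int[P]_o (\1_B o)%:E)%E by rewrite integral_indic// setIT.
apply: eq_integral => o _; rewrite indicE; congr (_%:R%:E).
have XE : standardize (P := P) (average_closure_rv A : {RV P >-> R}) s o =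
    (mean_closure (edge_config o) - Ex (edge_weight q) (@mean_closure R n)) / s.
  rewrite -expectation_average_closure -(average_closureE (fun i j => adjacencyE i j o)).
  by [].
by congr nat_of_bool; apply/idP/idP; rewrite inE /B/= in_itv/= XE.
Qed.

End Transfer.

(** * Orders of magnitude *)

Section ClosureScalars.
Context {R : realFieldType}.

(** The bounds inserted for [c] and [L] are those for the coefficients of the
   polynomial that approximates the closure coefficient. The variance of the kernel is smaller by a factor [n^-1] than the lower bound
   [b^2 / (n^4 m^2)] for the square of the variance. *)
Lemma kernel_variance_scalar (n : nat) (p kap : R) (m := n%:R * p) :
  0 < p -> p <= 1 -> 1 <= m -> 1 <= kap ->
  2 * n%:R ^+ 2 * p * @kernel_diff_bound R n p (6 * kap / (n%:R * m ^+ 2)) (10 * kap ^+ 2 / n%:R ^+ 2)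
    <= 123 * 1000 * kap ^+ 6 / (n%:R ^+ 5 * m ^+ 2).
Proof.
move=> p0 p1 m1 k1; have m0 : 0 < m by lra.
have N0 : 0 < n%:R :> R by rewrite -(pmulr_lgt0 _ p0).
have N1 : 1 <= n%:R :> R by rewrite ler1n; move: N0; rewrite ltr0n.
have pE : p = m / n%:R by rewrite /m mulrAC divff ?mul1r// gt_eqF.
have mN : m / n%:R <= 1 by rewrite -pE.
rewrite /kernel_diff_bound pE; clear pE.
move: m m0 m1 mN => m m0 m1 mN; move: (n%:R : R) N0 N1 mN => N N0 N1 mN.
have Nn : N != 0 by rewrite gt_eqF.
have mn : m != 0 by rewrite gt_eqF.
have iN : N^-1 <= 1 by rewrite invf_le1.
have im : m^-1 <= 1 by rewrite invf_le1.
have iN0 : 0 <= N^-1 by rewrite invr_ge0 ltW.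
have im0 : 0 <= m^-1 by rewrite invr_ge0 ltW.
rewrite [leLHS](_ : _ = (864 * 100 * kap ^+ 6 * (m / N) ^+ 2 +
  kap ^+ 4 * (15552 * (N^-1 + m^-1 * m^-1) + 5184 * m^-1)) / (N ^+ 5 * m ^+ 2)); last first.
  by field; rewrite Nn mn.
rewrite ler_wpM2r//; first by nonneg.
have im2 : m^-1 * m^-1 <= 1 by rewrite mulr_ile1.
have im20 : 0 <= m^-1 * m^-1 by rewrite mulr_ge0.
have k46 : kap ^+ 4 <= kap ^+ 6 by rewrite ler_weXn2l.
have k6 : 0 <= kap ^+ 6 by apply: exprn_ge0; lra.
have A : kap ^+ 6 * (m / N) ^+ 2 <= kap ^+ 6.
  by rewrite ler_piMr// expr_le1// divr_ge0// ltW.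
have B : kap ^+ 4 * (15552 * (N^-1 + m^-1 * m^-1) + 5184 * m^-1) <= kap ^+ 6 * (366 * 100).
  have k4 : 0 <= kap ^+ 4 by apply: exprn_ge0; lra.
  have C0 : 0 <= 15552 * (N^-1 + m^-1 * m^-1) + 5184 * m^-1 by clear -iN0 im0 im20; lra.
  have C1 : 15552 * (N^-1 + m^-1 * m^-1) + 5184 * m^-1 <= 366 * 100 by clear -iN im im2; lra.
  exact: ler_pM k4 C0 k46 C1.
rewrite -[_ * kap ^+ 6 * (m / N) ^+ 2]mulrA; move: A B k6; clear.
move: (kap ^+ 6 * (m / N) ^+ 2) (kap ^+ 4 * _) (kap ^+ 6) => x y z A B z0.
have -> : 123 * 1000 * z = 864 * 100 * z + (366 * 100) * z by ring.
by rewrite lerD//; lra.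
Qed.

(** The weight [s / m] in [cubic_bound] makes both resulting error terms small
   compared with [s^3]. *)
Lemma third_order_scalar (n : nat) (p kap b s eta : R) (m := n%:R * p)
    (c := 6 * kap / (n%:R * m ^+ 2)) (L := 10 * kap ^+ 2 / n%:R ^+ 2) (T : R) :
  0 < p -> p <= 1 -> 1 <= m -> 1 <= kap -> 0 < b -> b <= 1 -> 0 < s -> 0 < eta -> eta <= 1 ->
  b / (n%:R ^+ 2 * m) <= s ^+ 2 ->
  T <= (4 * L + 6 * (s / m)) * s ^+ 2 +
    n%:R ^+ 2 * p * (c ^+ 4 * (17 * n%:R ^+ 2 * p ^+ 4 + 4 * n%:R * p ^+ 2)) / (s / m) ->
  T / s ^+ 3 <= 2 * eta + 275 * 100 * kap ^+ 4 / b ^+ 2 * (m^-1 / eta).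
Proof.
move=> p0 p1 m1 k1 b0 b1 s0 e0 e1; have m0 : 0 < m by lra.
have N0 : 0 < n%:R :> R by rewrite -(pmulr_lgt0 _ p0).
have N1 : 1 <= n%:R :> R by rewrite ler1n; move: N0; rewrite ltr0n.
have pE : p = m / n%:R by rewrite /m mulrAC divff ?mul1r// gt_eqF.
have mN : m / n%:R <= 1 by rewrite -pE.
rewrite /c /L pE; clear c L pE.
move: m m0 m1 mN => m m0 m1 mN; move: (n%:R : R) N0 N1 mN => N N0 N1 mN sb TB.
have Nn : N != 0 by rewrite gt_eqF.
have mn : m != 0 by rewrite gt_eqF.
have sn : s != 0 by rewrite gt_eqF.
have bn : b != 0 by rewrite gt_eqF.
have en : eta != 0 by rewrite gt_eqF.
have mN' : m <= N by rewrite ler_pdivrMr// mul1r in mN.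
have iNm : N^-1 <= m^-1 by rewrite lef_pV2.
have im0 : 0 < m^-1 by rewrite invr_gt0.
have im1 : m^-1 <= 1 by rewrite invf_le1.
have is2 : s ^- 2 <= N ^+ 2 * m / b.
  rewrite -[leRHS]invrK lef_pV2 ?posrE ?exprn_gt0//; last first.
    by rewrite invr_gt0 divr_gt0// mulr_gt0// exprn_gt0.
  by rewrite invf_div.
have is20 : 0 <= s ^- 2 by rewrite invr_ge0 exprn_ge0// ltW.
pose L := 10 * kap ^+ 2 / N ^+ 2.
have LB : 4 * (L / s) <= 2 * eta + 200 * kap ^+ 4 / b * (m^-1 / eta).
  have A : L / s <= 2^-1 * (eta + (L / s) ^+ 2 / eta).
    by rewrite (le_trans (ler_norm _))// norm_le_sqr.
  have B : (L / s) ^+ 2 <= 100 * kap ^+ 4 / b * m^-1.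
    have -> : (L / s) ^+ 2 = L ^+ 2 * s ^- 2 by rewrite exprMn exprVn.
    apply: (le_trans (ler_wpM2l (sqr_ge0 L) is2)).
    rewrite [leLHS](_ : _ = 100 * kap ^+ 4 / b * (m / N) / N); last by rewrite /L; field; rewrite Nn bn.
    have K0 : 0 <= 100 * kap ^+ 4 / b by nonneg.
    rewrite -mulrA ler_wpM2l// (le_trans _ iNm)// ler_piMl// invr_ge0 ltW//.
  have B' : (L / s) ^+ 2 / eta <= 100 * kap ^+ 4 / b * (m^-1 / eta).
    by rewrite mulrA ler_wpM2r// invr_ge0 ltW.
  lra.
pose V := m * (N * m) * (1296 * kap ^+ 4 / (N ^+ 4 * m ^+ 8)) * (17 * m ^+ 4 / N ^+ 2 + 4 * m ^+ 2 / N).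
have CB : V * (s ^- 2 * s ^- 2) <= 1296 * 21 * kap ^+ 4 / b ^+ 2 * m^-1.
  have V0 : 0 <= V by rewrite /V; nonneg.
  have s4 : s ^- 2 * s ^- 2 <= (N ^+ 2 * m / b) * (N ^+ 2 * m / b) by apply: ler_pM.
  apply: (le_trans (ler_wpM2l V0 s4)).
  rewrite [leLHS](_ : _ = 1296 * kap ^+ 4 / b ^+ 2 * (17 * N^-1 + 4 * (m^-1 * m^-1))); last first.
    by rewrite /V; field; rewrite Nn bn mn.
  have K0 : 0 <= 1296 * kap ^+ 4 / b ^+ 2 by nonneg.
  rewrite [leRHS](_ : _ = 1296 * kap ^+ 4 / b ^+ 2 * (21 * m^-1)); last by field; rewrite bn mn.
  rewrite ler_wpM2l//; have := ler_wpM2l (ltW im0) im1; lra.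
have D : m^-1 <= m^-1 / eta by apply: ler_peMr; [exact: ltW|rewrite invf_ge1].
have k40 : 0 <= kap ^+ 4 by nonneg.
have kb : kap ^+ 4 / b <= kap ^+ 4 / b ^+ 2.
  by rewrite ler_wpM2l// lef_pV2 ?posrE ?exprn_gt0// expr2 ler_piMl// ltW.
have k1' : 1 <= kap ^+ 4 / b ^+ 2.
  by rewrite ler_pdivlMr ?exprn_gt0// mul1r (le_trans _ (exprn_ege1 4 k1))// expr_le1// ltW.
have T3 : T / s ^+ 3 <= 4 * (L / s) + 6 * m^-1 + V * (s ^- 2 * s ^- 2).
  apply: (le_trans (ler_wpM2r _ TB)); first by rewrite invr_ge0 exprn_ge0// ltW.
  apply: eq_ler; rewrite /V /L; field.
  by rewrite Nn mn sn.
apply: (le_trans T3).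
pose k2 := kap ^+ 4 / b ^+ 2; pose k3 := kap ^+ 4 / b; pose z := m^-1 / eta.
have LB' : 4 * (L / s) <= 2 * eta + 200 * (k3 * z).
  by rewrite (le_trans LB)// lerD2l /k3 /z !mulrA.
have CB' : V * (s ^- 2 * s ^- 2) <= 1296 * 21 * (k2 * m^-1).
  by rewrite (le_trans CB)// /k2 !mulrA.
have -> : 275 * 100 * kap ^+ 4 / b ^+ 2 * (m^-1 / eta) = 275 * 100 * (k2 * z).
  by rewrite /k2 /z !mulrA.
have z0 : 0 <= z by rewrite divr_ge0// ltW.
have E1 : k3 * z <= k2 * z by rewrite ler_wpM2r.
have E2 : m^-1 <= k2 * z by rewrite (le_trans D)// ler_peMl.
have E3 : k2 * m^-1 <= k2 * z by rewrite ler_wpM2l// (le_trans ler01).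
have fin (x1 x2 x3 x4 x5 x6 : R) : 4 * x6 <= 2 * eta + 200 * x3 -> x5 <= 1296 * 21 * x1 ->
    x3 <= x2 -> x4 <= x2 -> x1 <= x2 -> 0 <= x2 -> 4 * x6 + 6 * x4 + x5 <= 2 * eta + 275 * 100 * x2.
  by clear=> A1 A2 A3 A4 A5 A6; lra.
by apply: (fin _ _ _ _ _ _ LB' CB' E1 E2 E3); rewrite mulr_ge0// (le_trans ler01).
Qed.

Lemma remainder_scalar (n : nat) (p kap b s2 e rho : R) (m := n%:R * p) :
  0 < p -> p <= 1 -> 1 <= m -> 1 <= kap -> 0 < b -> 0 <= rho -> 0 <= e ->
  b / (n%:R ^+ 2 * m) <= s2 ->
  p * (@majorant_bound R n p kap rho + (17 * kap ^+ 2 * n%:R) ^+ 2 * (n%:R * (4 * e))) / s2 <=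
  1500 * 1000 * kap ^+ 6 / b * (p + rho ^+ 2 + m * rho ^+ 2 * p + m^-1 + n%:R ^+ 6 * e).
Proof.
move=> p0 p1 m1 k1 b0 r0 e0; have m0 : 0 < m by lra.
have k0 : 0 <= kap by lra.
have N0 : 0 < n%:R :> R by rewrite -(pmulr_lgt0 _ p0).
have pE : p = m / n%:R by rewrite /m mulrAC divff ?mul1r// gt_eqF.
have mN : m / n%:R <= 1 by rewrite -pE.
rewrite /majorant_bound -/m; set X := p + _ + _ + _ => sb.
have X0 : 0 <= X by rewrite /X; nonneg.
have {pE} : p = m / n%:R by [].
move: X X0 => X X0 ->; move: m m0 m1 mN sb => m m0 m1 mN; move: (n%:R : R) N0 mN => N N0 mN sb.
have Nn : N != 0 by rewrite gt_eqF.
have mn : m != 0 by rewrite gt_eqF.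
have bn : b != 0 by rewrite gt_eqF.
have mN' : m <= N by rewrite ler_pdivrMr// mul1r in mN.
have is2 : s2^-1 <= N ^+ 2 * m / b.
  rewrite -[leRHS]invrK lef_pV2 ?invf_div//.
    by rewrite posrE (lt_le_trans _ sb)// divr_gt0// mulr_gt0// exprn_gt0.
  by rewrite posrE divr_gt0// mulr_gt0// exprn_gt0.
set Y := m / N * _.
have Y0 : 0 <= Y by rewrite /Y; nonneg.
apply: (le_trans (ler_wpM2l Y0 is2)).
rewrite /Y [leLHS](_ : _ = 1500 * 1000 * kap ^+ 6 / b * X + 1156 * kap ^+ 4 / b * (N ^+ 4 * m ^+ 2 * e)); last first.
  by field; rewrite Nn mn bn.
rewrite [leRHS]mulrDr lerD2l.
have ib : 0 <= b^-1 by rewrite invr_ge0 ltW.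
have k46 : kap ^+ 4 <= kap ^+ 6 by rewrite ler_weXn2l.
have k4 : 0 <= kap ^+ 4 by nonneg.
have H1 : 1156 * kap ^+ 4 / b <= 1500 * 1000 * kap ^+ 6 / b.
  by rewrite ler_wpM2r//; move: k4 k46; move: (kap ^+ 4) (kap ^+ 6); clear=> x y; lra.
have H2 : N ^+ 4 * m ^+ 2 * e <= N ^+ 6 * e.
  have -> : N ^+ 6 = N ^+ 4 * N ^+ 2 by rewrite -exprD.
  rewrite ler_wpM2r// ler_wpM2l//; first by nonneg.
  by rewrite ler_pXn2r// nnegrE ltW.
by apply: (ler_pM _ _ H1 H2); nonneg.
Qed.
End ClosureScalars.

Section LowerBounds.
Context {R : realFieldType} {n : nat} (q : 'M[R]_n) (p beta : R).
Local Notation N := (n%:R : R).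
Local Notation m := (n%:R * p : R).
Hypothesis q_sym : forall i j, q i j = q j i.
Hypothesis q_diag : forall i, q i i = 0.
Hypothesis q01 : forall i j, 0 <= q i j <= 1.
Hypothesis q_le : forall i j, q i j <= p.
Hypothesis q_ge : forall i j, i != j -> beta * p <= q i j.
Hypothesis p_gt0 : 0 < p.
Hypothesis p_half : p <= 2^-1.
Hypothesis beta_gt0 : 0 < beta.
Hypothesis n_ge4 : (4 <= n)%N.

Let N4 : 4 <= N :> R. Proof. by rewrite ler_nat. Qed.
Let N_gt0 : 0 < N. Proof. by have := N4; lra. Qed.
Let q_ge0 i j : 0 <= q i j. Proof. by have /andP[] := q01 i j. Qed.

(** For [n >= 4], two excluded indices cost at most half of the sum. *)
Lemma sum_but2_ge (F : 'I_n -> R) (B : R) (s t : 'I_n) : 0 <= B ->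
  (forall k, 0 <= F k) -> (forall k, k != s -> k != t -> B <= F k) ->
  N / 2 * B <= \sum_k F k.
Proof.
move=> B0 F0 FB.
have H k : B - (k == s)%:R * B - (k == t)%:R * B <= F k.
  have := F0 k; have := FB k; case: (k == s); case: (k == t) => //= H1 H2; rewrite ?mul1r ?mul0r.
  - by move: H2; lra.
  - by move: H2; lra.
  - by move: H2; lra.
  - by have := H1 isT isT; lra.
apply: le_trans (ler_sum _ (fun k _ => H k)).
rewrite !sumrB !sum_indicator/= sumr_const card_ord -mulr_natl.
by have := ler_wpM2r B0 N4; lra.
Qed.

Lemma mean_deg_lower i : N / 2 * (beta * p) <= mean_deg q i.
Proof.
apply: (@sum_but2_ge _ _ i i) => // [|k ki _]; first by rewrite mulr_ge0// ltW.
by rewrite q_ge// eq_sym.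
Qed.

Lemma mean_paths_lower i : m ^+ 2 <= 4 / beta ^+ 2 * mean_paths q i.
Proof.
have b0 : 0 <= beta * p by rewrite mulr_ge0// ltW.
have : N / 2 * (beta * p * (N / 2 * (beta * p))) <= mean_paths q i.
  apply: (@sum_but2_ge _ _ i i) => [|k|k ki _].
  - by nonneg.
  - by rewrite mulr_ge0//; apply: sumr_ge0.
  - apply: ler_pM => //; first by nonneg.
    by rewrite q_ge// eq_sym.
    exact: mean_deg_lower.
have b20 : 0 <= 4 / beta ^+ 2 by nonneg.
move=> /(ler_wpM2l b20); apply: le_trans; apply: eq_ler.
by field; rewrite gt_eqF.
Qed.

Lemma mean_paths_upper i : mean_paths q i <= m ^+ 2.
Proof.
rewrite expr2 -mulrA; apply: ler_sum_const => j.
by apply: ler_pM => //; [apply: sumr_ge0|apply: ler_sum_const].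
Qed.

Lemma mean_paths_pos i : 0 < mean_paths q i.
Proof.
have m0 : 0 < m by rewrite mulr_gt0.
have := lt_le_trans (exprn_gt0 2 m0) (mean_paths_lower i).
by rewrite pmulr_rgt0// divr_gt0// exprn_gt0.
Qed.

(** The cubic part alone has this variance: it has about [n^3] monomials with
   coefficients of order at least [(n m^2)^-1], and variances of order [p^3]. *)
Lemma chaos_var_lower :
  beta ^+ 3 / 6 / (N ^+ 2 * m) <= chaos_var q (closure_l q) (closure_C q).
Proof.
have m0 : 0 < m by rewrite mulr_gt0.
have v0 i j : 0 <= evar q i j by exact: evar_ge0.
pose V := beta * p / 2.
have V0 : 0 <= V by rewrite /V; nonneg.
have vV i j : i != j -> V <= evar q i j.
  move=> ij; rewrite /V /evar; apply: ler_pM => //; first by nonneg.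
    exact: q_ge.
  by have := q_le i j; move: p_half; lra.
pose G s t k := closure_C q s t k ^+ 2 * (evar q s t * evar q s k * evar q t k).
have G0 s t k : 0 <= G s t k by rewrite /G; nonneg.
pose C := 6 / (N * m ^+ 2).
have C0 : 0 <= C by rewrite /C; nonneg.
have CC s t k : C <= closure_C q s t k.
  have nu1 i : (m ^+ 2)^-1 <= (mean_paths q i)^-1.
    by rewrite lef_pV2 ?mean_paths_upper// posrE ?exprn_gt0// mean_paths_pos.
  rewrite /C /closure_C /tri_coef invfM mulrCA ler_wpM2l ?invr_ge0 ?ler0n//.
  have fin (w x y z : R) : w <= x -> w <= y -> w <= z -> 6 * w <= 2 * (x + y + z).
    by move=> *; lra.
  exact: fin.
pose B := C ^+ 2 * (V * V * V).
have B0 : 0 <= B by rewrite /B; nonneg.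
have GB s t k : s != t -> k != s -> k != t -> B <= G s t k.
  move=> st ks kt; apply: ler_pM; [exact: sqr_ge0|by nonneg| |].
    by rewrite ler_pXn2r// nnegrE ?(le_trans C0).
  by apply: ler_pM; [nonneg|nonneg| apply: ler_pM; rewrite ?vV// eq_sym|rewrite vV// eq_sym].
have S3 : N * (N / 2 * (N / 2 * B)) <= \sum_s \sum_t \sum_k G s t k.
  rewrite mulr_natl -[X in _ *+ X](card_ord n) -sumr_const; apply: ler_sum => s _.
  apply: (@sum_but2_ge _ _ s s) => [|t|t ts _]; [by nonneg|by nonneg|].
  by apply: (@sum_but2_ge _ _ s t) => // k ks kt; rewrite GB// eq_sym.
have L0 : 0 <= 2^-1 * \sum_s \sum_t evar q s t * closure_l q s t ^+ 2.
  by nonneg.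
rewrite /chaos_var (le_trans _ (lerD L0 (lexx _)))// add0r.
have i6 : 0 <= 6^-1 :> R by [].
apply: (le_trans _ (ler_wpM2l i6 S3)).
have b30 : 0 <= beta ^+ 3 / (N ^+ 2 * m) by nonneg.
rewrite [leRHS](_ : _ = 3 / 16 * (beta ^+ 3 / (N ^+ 2 * m))); last first.
  rewrite /B /C /V; field.
  by rewrite !gt_eqF.
by rewrite mulrAC; lra.
Qed.

End LowerBounds.

(** * Normal approximation for a fixed number of vertices *)

Lemma kernel_ratio_scalar (R : realFieldType) (N m k6 b s2 V : R) :
  0 < m -> 1 <= N -> m <= N -> 0 < b -> 0 <= k6 -> b / (N ^+ 2 * m) <= s2 ->
  V <= k6 / (N ^+ 5 * m ^+ 2) -> V / s2 ^+ 2 <= k6 / b ^+ 2 * m^-1.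
Proof.
move=> m0 N1 mN b0 k0 sb VB; have N0 : 0 < N by lra.
have l0 : 0 < b / (N ^+ 2 * m) by rewrite divr_gt0// mulr_gt0// exprn_gt0.
have s0 : 0 < s2 := lt_le_trans l0 sb.
have E : k6 / (N ^+ 5 * m ^+ 2) / (b / (N ^+ 2 * m)) ^+ 2 = k6 / b ^+ 2 * N^-1.
  by field; rewrite !gt_eqF.
have V0 : 0 <= k6 / (N ^+ 5 * m ^+ 2) by nonneg.
have i0 : 0 <= s2 ^- 2 by rewrite invr_ge0 sqr_ge0.
apply: (le_trans (ler_wpM2r i0 VB)); apply: (@le_trans _ _ (k6 / b ^+ 2 * N^-1)).
  by rewrite -E ler_wpM2l// lef_pV2 ?posrE ?exprn_gt0// ler_pXn2r// nnegrE ltW.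
by rewrite ler_wpM2l//; [nonneg|rewrite lef_pV2].
Qed.

Lemma clt_combine (R : realFieldType) (A B c lip K eta k6 k4 kb y z : R) :
  0 < eta -> 0 <= lip -> 0 <= K -> k4 <= k6 -> 0 <= k6 -> 0 <= k4 -> 0 <= kb -> 0 <= z -> y <= z ->
  `|A - B| <= lip * (2^-1 * (eta + 1500 * 1000 * kb * z)) ->
  `|B - c| <= K * (2^-1 * (eta + 123 * 1000 * k6 * y) + (2 * eta + 275 * 100 * k4 * y)) ->
  `|A - c| <= (lip + 3 * K) * eta + (lip * (1500 * 1000 * kb) + K * (1000 * 100 * k6)) * z.
Proof.
move=> e0 l0 K0 k46 k60 k40 kb0 z0 yz H1 H2.
have k6y : k6 * y <= k6 * z by rewrite ler_wpM2l.
have k4y : k4 * y <= k6 * z by rewrite (@le_trans _ _ (k4 * z))// ?ler_wpM2l// ler_wpM2r.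
have k6z : 0 <= k6 * z by rewrite mulr_ge0.
have kbz : 0 <= kb * z by rewrite mulr_ge0.
have T1 : 2^-1 * (eta + 1500 * 1000 * kb * z) <= eta + 1500 * 1000 * (kb * z).
  by rewrite -(mulrA _ kb); move: kbz; move: (kb * z); clear -e0 => w w0; lra.
have T2 : 2^-1 * (eta + 123 * 1000 * k6 * y) + (2 * eta + 275 * 100 * k4 * y) <=
    3 * eta + 1000 * 100 * (k6 * z).
  rewrite -(mulrA _ k6) -(mulrA _ k4); move: k6y k4y k6z.
  by move: (k6 * y) (k4 * y) (k6 * z); clear -e0 => w1 w2 w3; lra.
have -> : A - c = (A - B) + (B - c) by ring.
apply: (le_trans (ler_normD _ _)); apply: (le_trans (lerD H1 H2)).
apply: (le_trans (lerD (ler_wpM2l l0 T1) (ler_wpM2l K0 T2))).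
by apply: eq_ler; ring.
Qed.

Section CLTBound.
Context {R : realType} {n : nat} (q : 'M[R]_n) (p beta rho : R).
Local Notation N := (n%:R : R).
Local Notation m := (n%:R * p : R).
Local Notation kap := (4 / beta ^+ 2).
Local Notation b := (beta ^+ 3 / 6).
Local Notation config := {ffun 'I_n * 'I_n -> bool}.
Local Notation Eq := (Ex (edge_weight q)).
Hypothesis q_sym : forall i j, q i j = q j i.
Hypothesis q_diag : forall i, q i i = 0.
Hypothesis q01 : forall i j, 0 <= q i j <= 1.
Hypothesis q_le : forall i j, q i j <= p.
Hypothesis q_ge : forall i j, i != j -> beta * p <= q i j.
Hypothesis p_half : p <= 2^-1.
Hypothesis beta_gt0 : 0 < beta.
Hypothesis beta_le1 : beta <= 1.
Hypothesis n_ge4 : (4 <= n)%N.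
Hypothesis m_ge1 : 1 <= m.
Hypothesis rho_ge : 1 <= m * rho.
Hypothesis rho_le : 22 * kap * rho <= 1.

Let N4 : 4 <= N :> R. Proof. by rewrite ler_nat. Qed.
Let N_gt0 : 0 < N. Proof. by have := N4; lra. Qed.
Let m_gt0 : 0 < m. Proof. exact: lt_le_trans m_ge1. Qed.
Let p_gt0 : 0 < p. Proof. by have := m_gt0; rewrite pmulr_rgt0. Qed.
Let p_le1 : p <= 1. Proof. by move: p_half; lra. Qed.
Let kap_ge1 : 1 <= kap.
Proof. rewrite ler_pdivlMr ?exprn_gt0// mul1r; have : beta ^+ 2 <= 1 by rewrite expr_le1// ltW. lra. Qed.
Let b_gt0 : 0 < b. Proof. by rewrite divr_gt0// exprn_gt0. Qed.
Let b_le1 : b <= 1.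
Proof. rewrite ler_pdivrMr// mul1r; have : beta ^+ 3 <= 1 by rewrite expr_le1// ltW. lra. Qed.
Let rho_gt0 : 0 < rho.
Proof. by rewrite -(pmulr_rgt0 _ m_gt0) (lt_le_trans _ rho_ge). Qed.
Let rho_le1 : rho <= 1.
Proof. by have := ltW rho_gt0; move: rho_le kap_ge1; move: (4 / _) => k; nra. Qed.
Let nu_ge i : m ^+ 2 <= kap * mean_paths q i.
Proof. exact: (mean_paths_lower q01 q_ge p_gt0 beta_gt0 n_ge4). Qed.
Let ew01 := edge_weight01 q01.
Let mN : m <= N. Proof. by rewrite ler_piMr// ltW. Qed.

(** A bound, up to a constant, for the second moment of the remainder relative
   to the variance and for the errors in Stein's method. *)
Definition error_rate : R :=
  p + rho ^+ 2 + m * rho ^+ 2 * p + m^-1 + N ^+ 6 * expR (- (m * rho ^+ 2 / 8)).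

Local Notation V := (chaos_var q (closure_l q) (closure_C q)).
Local Notation Z := (chaos q (closure_l q) (closure_C q)).
Local Notation rem := (remainder q).

Let V_ge : b / (N ^+ 2 * m) <= V.
Proof. exact: (chaos_var_lower q_sym q_diag q01 q_le q_ge). Qed.

Let V_gt0 : 0 < V.
Proof. by apply: lt_le_trans V_ge; rewrite divr_gt0// mulr_gt0// exprn_gt0. Qed.

Let l_sym i j : closure_l q i j = closure_l q j i.
Proof. by rewrite /closure_l lin_coefC. Qed.
Let C_sym12 i j k : closure_C q i j k = closure_C q j i k.
Proof. by rewrite /closure_C tri_coefC12. Qed.
Let C_sym23 i j k : closure_C q i j k = closure_C q i k j.
Proof. by rewrite /closure_C tri_coefC23. Qed.

Let l_le i j : `|closure_l q i j| <= 10 * kap ^+ 2 / N ^+ 2.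
Proof.
have H := lin_coef_le q_sym q01 q_le m_ge1 kap_ge1 nu_ge i j.
have iN0 : 0 <= N^-1 by rewrite invr_ge0 ltW.
rewrite /closure_l normrM (ger0_norm iN0) (le_trans (ler_wpM2l iN0 H))//.
by apply: eq_ler; field; rewrite !gt_eqF.
Qed.

Let C_le i j k : `|closure_C q i j k| <= 6 * kap / (N * m ^+ 2).
Proof.
have iN0 : 0 <= N^-1 by rewrite invr_ge0 ltW.
have C0 := tri_coef_ge0 m_ge1 kap_ge1 nu_ge i j k.
have T0 := mulr_ge0 iN0 C0.
rewrite /closure_C (ger0_norm T0) (le_trans (ler_wpM2l iN0 (tri_coef_le m_ge1 kap_ge1 nu_ge i j k)))//.
by apply: eq_ler; field; rewrite !gt_eqF.
Qed.

Let s := Num.sqrt V.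
Let s_gt0 : 0 < s. Proof. by rewrite sqrtr_gt0. Qed.
Let sE : s ^+ 2 = V. Proof. by rewrite sqr_sqrtr// ltW. Qed.

Let kernel_close (eta : R) : 0 < eta ->
  Eq (fun a => `|stein_kernel q (closure_l q) (closure_C q) a - V|) / s ^+ 2 <=
  2^-1 * (eta + 123 * 1000 * kap ^+ 6 / b ^+ 2 * (m^-1 / eta)).
Proof.
move=> e0; set k := stein_kernel _ _ _.
have eV : 0 < eta * V by rewrite mulr_gt0.
have H1 : Eq (fun a => `|k a - V|) <= 2^-1 * (eta * V + variance (edge_weight q) k / (eta * V)).
  rewrite varianceE (Ex_stein_kernel _ _ q_sym q_diag) -ExZr -(@Ex_cst _ _ (edge_weight q) (eta * V)).
  rewrite -ExD -ExZ; apply: (le_Ex ew01) => a.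
  by rewrite Ex_cst; exact: norm_le_sqr.
have H2 : variance (edge_weight q) k / V ^+ 2 <= 123 * 1000 * kap ^+ 6 / b ^+ 2 * m^-1.
  have k0 : 0 <= kap ^+ 6 by apply: exprn_ge0; exact: le_trans ler01 kap_ge1.
  have k60 := mulr_ge0 (mulr_ge0 (ler0n R 123) (ler0n R 1000)) k0.
  have N1 : 1 <= N by have := N4; lra.
  have H := @variance_stein_kernel R n q (closure_l q) (closure_C q) p _ _ q_sym q_diag q01 q_le (ltW p_gt0) l_sym C_sym12 l_le C_le.
  exact: (kernel_ratio_scalar m_gt0 N1 mN b_gt0 k60 V_ge (le_trans H (kernel_variance_scalar p_gt0 p_le1 m_ge1 kap_ge1))).
rewrite sE ler_pdivrMr//; apply: (le_trans H1).
rewrite [leRHS](_ : _ = 2^-1 * (eta * V + 123 * 1000 * kap ^+ 6 / b ^+ 2 * m^-1 * (V / eta))); last first.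
  by move: (kap ^+ 6 / b ^+ 2) => *; ring.
rewrite ler_wpM2l// lerD2l.
have -> : variance (edge_weight q) k / (eta * V) = variance (edge_weight q) k / V ^+ 2 * (V / eta).
  by field; rewrite !gt_eqF.
by apply: ler_wpM2r H2; rewrite divr_ge0// ltW.
Qed.

Let third_close (eta : R) : 0 < eta -> eta <= 1 ->
  2^-1 * (\sum_i \sum_j evar q i j * Eq (fun a =>
    `|closure_l q i j + 3^-1 * path_sum q (closure_C q) i j a| *
     (closure_l q i j + path_sum q (closure_C q) i j a) ^+ 2)) / s ^+ 3 <=
  2 * eta + 275 * 100 * kap ^+ 4 / b ^+ 2 * (m^-1 / eta).
Proof.
move=> e0 e1.
have V_ge' : b / (N ^+ 2 * m) <= s ^+ 2 by rewrite sE.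
have L0 : 0 <= 10 * kap ^+ 2 / N ^+ 2.
  by apply: divr_ge0; [apply: mulr_ge0 => //; exact: sqr_ge0|exact: sqr_ge0].
have H := chaos_third_order q_sym q_diag q01 q_le (ltW p_gt0) C_sym12 l_le C_le
  sE L0 (divr_gt0 s_gt0 m_gt0).
exact: third_order_scalar p_gt0 p_le1 m_ge1 kap_ge1 b_gt0 b_le1 s_gt0 e0 e1 V_ge' H.
Qed.

Let remainder_close :
  Eq (fun a => rem a ^+ 2) / V <= 1500 * 1000 * kap ^+ 6 / b * error_rate.
Proof.
have PB := atypical_prob q_sym q_diag q01 q_le m_gt0 (ltW rho_gt0) rho_le1.
have H := Ex_remainder_sqr q_sym q_diag q01 q_le (ltW p_gt0) p_half m_ge1 kap_ge1 nu_ge rho_ge rho_le PB.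
have iV : 0 <= V^-1 by rewrite invr_ge0 ltW.
apply: (le_trans (ler_wpM2r iV H)).
exact: (remainder_scalar p_gt0 p_le1 m_ge1 kap_ge1 b_gt0 (ltW rho_gt0) (expR_ge0 _) V_ge).
Qed.

(** Stein's method for [chaos], and a Lipschitz test function to absorb the
   remainder. The parameter [eta] comes from [norm_le_sqr]. *)
Lemma clt_bound (h f f' : R -> R) (lip K c eta : R) : 0 < eta -> eta <= 1 ->
  0 <= lip -> (forall x y, `|h y - h x| <= lip * `|y - x|) ->
  (forall x, `|f' x| <= K) ->
  (forall x y, `|f y - f x - f' x * (y - x)| <= K * (y - x) ^+ 2) ->
  (forall x, f' x - x * f x = h x - c) ->
  `|Eq (fun a => h ((mean_closure a - Eq (@mean_closure R n)) / s)) - c| <=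
  (lip + 3 * K) * eta +
  (lip * (1500 * 1000 * kap ^+ 6 / b) + K * (1000 * 100 * kap ^+ 6 / b ^+ 2)) * (error_rate / eta).
Proof.
move=> e0 e1 lip0 hlip f'K fT stein.
have K0 : 0 <= K by apply: le_trans (normr_ge0 _) (f'K 0).
have XE a : (mean_closure a - Eq (@mean_closure R n)) / s = Z a / s + rem a / s.
  by rewrite /remainder; ring.
have part1 : `|Eq (fun a => h ((mean_closure a - Eq (@mean_closure R n)) / s) - h (Z a / s))| <=
    lip * (2^-1 * (eta + 1500 * 1000 * kap ^+ 6 / b * (error_rate / eta))).
  apply: (le_trans (Ex_norm ew01 _)).
  apply: (@le_trans _ _ (Eq (fun a => lip * (2^-1 * (eta + (rem a ^+ 2) * (V * eta)^-1))))).
    apply: (le_Ex ew01) => a; rewrite XE (le_trans (hlip _ _))// ler_wpM2l//.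
    have -> : Z a / s + rem a / s - Z a / s = rem a / s by ring.
    apply: (le_trans (norm_le_sqr (rem a / s) e0)).
    by rewrite exprMn exprVn sE invfM mulrA.
  rewrite ExZ ler_wpM2l// ExZ ler_wpM2l// ExD Ex_cst lerD2l ExZr invfM mulrA.
  rewrite (mulrA _ error_rate); apply: ler_wpM2r; first by rewrite invr_ge0 ltW.
  exact: remainder_close.
have part2 : `|Eq (fun a => h (Z a / s)) - c| <=
    K * (2^-1 * (eta + 123 * 1000 * kap ^+ 6 / b ^+ 2 * (m^-1 / eta)) +
         (2 * eta + 275 * 100 * kap ^+ 4 / b ^+ 2 * (m^-1 / eta))).
  have -> : Eq (fun a => h (Z a / s)) - c = Eq (fun a => f' (Z a / s) - Z a / s * f (Z a / s)).
    by rewrite -[c](Ex_cst (edge_weight q)) -ExB; apply: eq_Ex => a; rewrite stein.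
  have H := chaos_stein q_sym q_diag q01 l_sym C_sym12 C_sym23 s_gt0 sE f'K fT.
  apply: (le_trans H); apply: (ler_wpM2l K0); apply: lerD; [exact: kernel_close|exact: third_close].
have e_inv : 0 <= eta^-1 by rewrite invr_ge0 ltW.
have X0 : 0 <= p + rho ^+ 2 + m * rho ^+ 2 * p by rewrite !addr_ge0 ?sqr_ge0 ?(ltW p_gt0)// mulr_ge0 ?(ltW p_gt0)// mulr_ge0 ?sqr_ge0// ltW.
have E0 : 0 <= N ^+ 6 * expR (- (m * rho ^+ 2 / 8)).
  by rewrite mulr_ge0// expR_ge0.
have im_r : m^-1 <= error_rate by rewrite /error_rate; lra.
have z0 : 0 <= error_rate / eta.
  by rewrite mulr_ge0//; apply: le_trans im_r; rewrite invr_ge0 ltW.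
have yz : m^-1 / eta <= error_rate / eta by apply: ler_wpM2r.
have k46 : kap ^+ 4 / b ^+ 2 <= kap ^+ 6 / b ^+ 2.
  rewrite ler_wpM2r ?invr_ge0 ?sqr_ge0//.
  by rewrite ler_weXn2l.
have k60 : 0 <= kap ^+ 6 / b ^+ 2.
  by rewrite divr_ge0 ?sqr_ge0// exprn_ge0// (le_trans ler01).
have k40 : 0 <= kap ^+ 4 / b ^+ 2.
  by rewrite divr_ge0 ?sqr_ge0// exprn_ge0// (le_trans ler01).
have k6b : 0 <= kap ^+ 6 / b by rewrite divr_ge0 ?(ltW b_gt0)// exprn_ge0// (le_trans ler01).
rewrite ExB in part1.
rewrite -!(mulrA _ (kap ^+ 6)) -!(mulrA _ (kap ^+ 4)) in part1 part2 *.
move: k46 k60 k40 k6b z0 yz part1 part2.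
exact: clt_combine.
Qed.

End CLTBound.

(** * Rates *)

Section Rates.
Context {R : realType} (alpha : R).
Hypothesis alpha01 : 0 < alpha < 1.

Definition rate_exponent : R := Num.min alpha (1 - alpha) / 4.
Local Notation theta := rate_exponent.

(** With this relative deviation, [m * rho ^+ 2] is a positive power of [n], so
   that atypical graphs are exponentially rare, and yet [rho] and
   [m * rho ^+ 2 * p] tend to 0. *)
Definition deviation_scale (n : nat) : R := n%:R `^ (theta - (1 - alpha) / 2).

Lemma rate_exponent_bounds : [/\ 0 < theta, 4 * theta <= alpha & 4 * theta <= 1 - alpha].
Proof.
have /andP[a0 a1] := alpha01.
rewrite /theta; split.
- by rewrite divr_gt0// lt_min a0 subr_gt0.
- by rewrite mulrC divfK// ge_min lexx.
- by rewrite mulrC divfK// ge_min lexx orbT.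
Qed.

Lemma exp_decay_powR : exists2 D : R, 0 <= D & forall x : R, 1 <= x ->
  x ^+ 6 * expR (- ((x `^ theta) ^+ 2 / 8)) <= D / x `^ theta.
Proof.
have [t0 _ _] := rate_exponent_bounds.
(* [x ^+ 6 <= y ^+ (2 * k)], which the term of order [k.+1] of the exponential
   series of [y ^+ 2 / 8] beats. *)
pose K := Num.bound theta^-1; pose k := (3 * K)%N.
pose D : R := 8 ^+ k.+1 * k.+1`!%:R.
have Dp : 0 < D by rewrite mulr_gt0 ?exprn_gt0// ltr0n fact_gt0.
have D0 := ltW Dp.
exists D => // x x1; set y := x `^ theta.
have y1 : 1 <= y by rewrite -(powRr0 x) ler_powR// ltW.
have y0 : 0 < y by lra.
have xy : x <= y ^+ K.
  have x0 : 0 <= x := le_trans ler01 x1.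
  rewrite -powR_mulrn ?powR_ge0// -powRrM -[X in X <= _](powRr1 x0) ler_powR//.
  rewrite mulrC -ler_pdivrMr//.
  have it0 : 0 <= theta^-1 by rewrite invr_ge0 ltW.
  by rewrite mul1r; apply/ltW/archi_boundP.
have x6 : x ^+ 6 <= y ^+ (2 * k).
  rewrite /k mulnA -[(2 * 3)%N]/6%N mulnC exprM ler_pXn2r// nnegrE.
    by rewrite (le_trans ler01).
  by rewrite exprn_ge0// ltW.
have f0 : 0 < k.+1`!%:R :> R by rewrite ltr0n fact_gt0.
have E : (y ^+ 2 / 8) ^+ k.+1 / k.+1`!%:R <= expR (y ^+ 2 / 8).
  have z0 : 0 <= y ^+ 2 / 8 by rewrite divr_ge0// sqr_ge0.
  by have := @expR_ge1Dxn R _ k z0; lra.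
have E0 : 0 < (y ^+ 2 / 8) ^+ k.+1 / k.+1`!%:R.
  by rewrite divr_gt0// exprn_gt0// divr_gt0// exprn_gt0.
have E1 : expR (- (y ^+ 2 / 8)) <= D / (y ^+ (2 * k) * y ^+ 2).
  rewrite expRN -[leRHS]invrK lef_pV2 ?posrE ?expR_gt0//; last first.
    by rewrite invr_gt0 divr_gt0// mulr_gt0// exprn_gt0.
  rewrite (le_trans _ E)//; apply: eq_ler.
  have -> : y ^+ (2 * k) * y ^+ 2 = (y ^+ 2) ^+ k.+1 by rewrite [RHS]exprSr -exprM.
  by rewrite invf_div /D expr_div_n invfM mulrA.
have x60 : 0 <= x ^+ 6 by rewrite exprn_ge0// (le_trans ler01).
apply: (le_trans (ler_pM x60 (expR_ge0 _) x6 E1)).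
have yk : y ^+ (2 * k) != 0 by rewrite expf_eq0 (gt_eqF y0) andbF.
have -> : y ^+ (2 * k) * (D / (y ^+ (2 * k) * y ^+ 2)) = D / y / y.
  by field; rewrite yk gt_eqF.
by rewrite ler_piMr ?invf_le1// divr_ge0// ltW.
Qed.

Lemma rate_bounds (n : nat) (x := n%:R : R) (y := x `^ theta) (p := x `^ (- alpha)) (m := x * p)
    (rho := deviation_scale n) : (0 < n)%N ->
  [/\ 1 <= y, p <= y^-1, m^-1 <= y^-1, rho <= y^-1 &
   [/\ 1 <= m, 1 <= m * rho, m * rho ^+ 2 = y ^+ 2, rho ^+ 2 <= y^-1 & m * rho ^+ 2 * p <= y^-1]].
Proof.
move=> n0; have [t0 ta tb] := rate_exponent_bounds.
have x1 : 1 <= x by rewrite ler1n.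
have x0 : 0 < x by exact: lt_le_trans x1.
have xn : x != 0 by rewrite gt_eqF.
have D r s : x `^ r * x `^ s = x `^ (r + s) by rewrite powRD// xn implybT.
have mE : m = x `^ (1 - alpha) by rewrite /m /p -[X in X * _](powRr1 (ltW x0)) D.
have yV : y^-1 = x `^ (- theta) by rewrite powRN.
have le r s : r <= s -> x `^ r <= x `^ s by apply: ler_powR.
have ge1 r : 0 <= r -> 1 <= x `^ r by move=> r0; rewrite -(powRr0 x); apply: le.
have m2 : m * rho ^+ 2 = y ^+ 2.
  rewrite mE /rho /deviation_scale /y !expr2 !D; congr (_ `^ _); lra.
split; [by apply: ge1; lra|by rewrite yV; apply: le; lra|
  by rewrite mE -powRN yV; apply: le; lra|by rewrite yV; apply: le; lra|].
split; [by rewrite mE; apply: ge1; lra| |by []| |].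
- by rewrite mE /rho /deviation_scale D; apply: ge1; lra.
- by rewrite /rho /deviation_scale expr2 D yV; apply: le; lra.
- by rewrite m2 /y /p expr2 !D -powRN; apply: le; lra.
Qed.

Lemma error_rate_le : exists2 D : R, 0 <= D & forall n, (0 < n)%N ->
  @error_rate R n (n%:R `^ (- alpha)) (deviation_scale n) <= D / n%:R `^ theta.
Proof.
have [D D0 HD] := exp_decay_powR; exists (4 + D); first lra.
move=> n n0; have [y1 py my _ [_ _ m2 r2 mp]] := rate_bounds n0.
have x1 : 1 <= n%:R :> R by rewrite ler1n.
have := HD _ x1; rewrite /error_rate -m2; move: py my r2 mp.
rewrite mulrDl; move: (_ / _ `^ _) => z; lra.
Qed.

Lemma rate_cvgy (M : R) : \forall n \near \oo, M <= n%:R `^ theta.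
Proof.
have [t0 _ _] := rate_exponent_bounds.
have H := @nbhs_infty_ger R (Num.max M 0 `^ theta^-1).
near=> n; have Hn : Num.max M 0 `^ theta^-1 <= n%:R by near: n.
have M0 : 0 <= Num.max M 0 by rewrite le_max lexx orbT.
apply: (@le_trans _ _ (Num.max M 0)); first by rewrite le_max lexx.
have -> : Num.max M 0 = (Num.max M 0 `^ theta^-1) `^ theta.
  by rewrite -powRrM mulVf ?gt_eqF// powRr1.
by apply: ge0_ler_powR => //; rewrite ?nnegrE ?powR_ge0// ltW.
Unshelve. all: by end_near. Qed.

End Rates.

(** * The limit *)

Section Limit.
Context {R : realType} (alpha beta : R).
Hypothesis alpha01 : 0 < alpha < 1.
Hypothesis beta01 : 0 < beta < 1.
Variable w : forall n, 'M[R]_n.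
Hypothesis hw : forall n (i j : 'I_n), i != j ->
  w n i j = w n j i /\ beta <= w n i j <= 1.
Hypothesis hw0 : forall n (i : 'I_n), w n i i = 0.

Local Notation q n := (edge_prob alpha (w n)).
Local Notation p n := (n%:R `^ (- alpha)).
Local Notation kap := (4 / beta ^+ 2).
Local Notation closure_mean n := (Ex (edge_weight (q n)) (@mean_closure R n)).
Local Notation X n a := ((mean_closure a - closure_mean n) / sigma (q n)).

Let beta_gt0 : 0 < beta. Proof. by have /andP[] := beta01. Qed.
Let beta_le1 : beta <= 1. Proof. by have /andP[_ /ltW] := beta01. Qed.

Lemma edge_prob_sym n i j : q n i j = q n j i.
Proof.
rewrite !mxE; have [->//|ij] := eqVneq i j.
by have [-> _] := hw ij.
Qed.

Lemma edge_prob_diag n i : q n i i = 0.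
Proof. by rewrite mxE hw0 mulr0. Qed.

Lemma edge_prob_le n i j : q n i j <= p n.
Proof.
rewrite mxE; have [->|ij] := eqVneq i j; first by rewrite hw0 mulr0 powR_ge0.
by have [_ /andP[_ w1]] := hw ij; rewrite ler_piMr// powR_ge0.
Qed.

Lemma edge_prob01 n i j : 0 <= q n i j <= 1.
Proof.
apply/andP; split.
  rewrite mxE mulr_ge0 ?powR_ge0//; have [->|ij] := eqVneq i j; first by rewrite hw0.
  by have [_ /andP[w1 _]] := hw ij; rewrite (le_trans _ w1)// ltW.
apply: (le_trans (edge_prob_le i j)).
have n1 : 1 <= n%:R :> R by rewrite ler1n (leq_ltn_trans _ (ltn_ord i)).
rewrite -[leRHS](powRr0 n%:R) ler_powR// oppr_le0 ltW//.
by have /andP[] := alpha01.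
Qed.

Lemma edge_prob_ge n i j : i != j -> beta * p n <= q n i j.
Proof.
move=> ij; have [_ /andP[w1 _]] := hw ij.
by rewrite mxE mulrC ler_wpM2l// powR_ge0.
Qed.

Let good n : Prop := [/\ (4 <= n)%N, 2 <= n%:R `^ rate_exponent alpha &
  22 * kap <= n%:R `^ rate_exponent alpha].

Let near_good : \forall n \near \oo, good n.
Proof.
have H1 := rate_cvgy alpha01 2; have H2 := rate_cvgy alpha01 (22 * kap).
near=> n; split; near: n => //; exact: nbhs_infty_ge.
Unshelve. all: by end_near. Qed.

Let goodP n : good n -> [/\ p n <= 2^-1, 1 <= n%:R * p n, 0 < p n &
  1 <= n%:R * p n * deviation_scale alpha n /\ 22 * kap * deviation_scale alpha n <= 1].
Proof.
move=> [n4 y2 yk].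
have n0 : (0 < n)%N by apply: leq_trans n4.
have [y1 py my ry [m1 mr _ _ _]] := rate_bounds alpha01 n0.
have y0 : 0 < n%:R `^ rate_exponent alpha by exact: lt_le_trans y1.
split=> //.
- by apply: (le_trans py); rewrite lef_pV2 ?posrE.
- by rewrite powR_gt0// ltr0n.
- split=> //; apply: (@le_trans _ _ (22 * kap * (n%:R `^ rate_exponent alpha)^-1)).
    by rewrite ler_wpM2l//; apply: mulr_ge0 => //; rewrite divr_ge0// sqr_ge0.
  by rewrite ler_pdivrMr// mul1r.
Qed.

Let sigmaE n : sigma (q n) = Num.sqrt (chaos_var (q n) (closure_l (q n)) (closure_C (q n))).
Proof. by rewrite /sigma (sigma_sqE (@edge_prob_sym n) (@edge_prob_diag n)). Qed.

Lemma sigma_gt0 : \forall n \near \oo, 0 < sigma (q n).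
Proof.
near=> n; have gn : good n by near: n; exact: near_good.
have [p2 m1 p0 _] := goodP gn; have [n4 _ _] := gn.
rewrite sigmaE sqrtr_gt0; apply: lt_le_trans (chaos_var_lower (@edge_prob_sym n) (@edge_prob_diag n)
  (@edge_prob01 n) (@edge_prob_le n) (@edge_prob_ge n) p0 p2 beta_gt0 n4).
have N0 : 0 < n%:R :> R by rewrite ltr0n (leq_trans _ n4).
by apply: divr_gt0; [apply: divr_gt0 => //; exact: exprn_gt0|rewrite !mulr_gt0// exprn_gt0].
Unshelve. all: by end_near. Qed.

(** [clt_bound] with [eta] small enough for the first term, and then [n] large
   enough for the second one. *)
Lemma ramp_clt (u eps : R) : 0 < eps -> exists2 c, normal_cdf u <= c <= normal_cdf (u + eps) &
  forall e, 0 < e -> \forall n \near \oo,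
    `|Ex (edge_weight (q n)) (fun a => ramp u eps (X n a)) - c| <= e.
Proof.
move=> eps0; have [f [f' [K [c [cu f'K fT stein]]]]] := @stein_equation R u eps eps0.
exists c => // e e0.
have K0 : 0 <= K by apply: le_trans (normr_ge0 _) (f'K 0).
have l0 : 0 <= eps^-1 by rewrite invr_ge0 ltW.
have [D D0 HD] := error_rate_le alpha01.
pose A := eps^-1 + 3 * K.
pose B := eps^-1 * (1500 * 1000 * kap ^+ 6 / (beta ^+ 3 / 6)) + K * (1000 * 100 * kap ^+ 6 / (beta ^+ 3 / 6) ^+ 2).
have A0 : 0 < A by rewrite /A ltr_pwDl ?invr_gt0// mulr_ge0.
pose eta := Num.min 1 (e / (2 * A)).
have eta0 : 0 < eta by rewrite lt_min ltr01 divr_gt0// mulr_gt0.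
have eta1 : eta <= 1 by rewrite ge_min lexx.
have Aeta : A * eta <= e / 2.
  have : eta <= e / (2 * A) by rewrite ge_min lexx orbT.
  move=> /(ler_wpM2l (ltW A0)) H; apply: (le_trans H).
  by apply: eq_ler; field; rewrite gt_eqF.
pose M := Num.max 1 (`|B| * (D / eta) / (e / 2)).
near=> n.
have gn : good n by near: n; exact: near_good.
have yM : M <= n%:R `^ rate_exponent alpha by near: n; exact: rate_cvgy.
have [p2 m1 p0 [mr rk]] := goodP gn; have [n4 _ _] := gn.
have n0 : (0 < n)%N by apply: leq_trans n4.
have H := clt_bound (@edge_prob_sym n) (@edge_prob_diag n) (@edge_prob01 n) (@edge_prob_le n)
  (@edge_prob_ge n) p2 beta_gt0 beta_le1 n4 m1 mr rk eta0 eta1 l0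
  (fun x y => ramp_lipschitz u x y eps0) f'K fT stein.
rewrite -sigmaE in H; apply: (le_trans H); rewrite -/A -/B.
have y0 : 0 < n%:R `^ rate_exponent alpha by rewrite (lt_le_trans _ yM)// lt_max ltr01.
suff T : B * (@error_rate R n (p n) (deviation_scale alpha n) / eta) <= e / 2.
  by rewrite [e]splitr lerD.
have E0 : 0 <= @error_rate R n (p n) (deviation_scale alpha n) / eta.
  apply: divr_ge0; last exact: ltW.
  have m0 := le_trans ler01 m1.
  have T3 := mulr_ge0 (mulr_ge0 m0 (sqr_ge0 (deviation_scale alpha n))) (ltW p0).
  have T4 : 0 <= (n%:R * p n)^-1 by rewrite invr_ge0.
  have T5 := mulr_ge0 (exprn_ge0 6 (ler0n R n)) (expR_ge0 (- (n%:R * p n * deviation_scale alpha n ^+ 2 / 8))).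
  exact: (addr_ge0 (addr_ge0 (addr_ge0 (addr_ge0 (ltW p0) (sqr_ge0 _)) T3) T4) T5).
apply: (le_trans (ler_wpM2r E0 (ler_norm B))).
have E1 : @error_rate R n (p n) (deviation_scale alpha n) / eta <= D / eta / n%:R `^ rate_exponent alpha.
  by rewrite mulrAC ler_wpM2r ?invr_ge0 ?(ltW eta0)//; exact: HD.
apply: (le_trans (ler_wpM2l (normr_ge0 B) E1)).
rewrite mulrA ler_pdivrMr// [leRHS]mulrC -ler_pdivrMr ?divr_gt0//.
by apply: le_trans yM; rewrite le_max lexx orbT.
Unshelve. all: by end_near. Qed.

Lemma normal_cdf_lipschitz (x y : R) : `|normal_cdf y - normal_cdf x| <= normal_peak 1 * `|y - x|.
Proof.
apply: (derive_bounded_lipschitz (fun z => is_derive_normal_cdf z)) => z.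
by rewrite ger0_norm ?normal_pdf_ge0// normal_pdf_ub// oner_neq0.
Qed.

(** The indicator of [t <= x] lies between the ramps that start to decrease at
   [x - eps] and at [x]; the limits of their means differ by [O(eps)] since the
   normal distribution function is Lipschitz. *)
Lemma cdf_clt (x : R) :
  Ex (edge_weight (q n)) (fun a => (X n a <= x)%R%:R) @[n --> \oo] --> normal_cdf x.
Proof.
apply/cvgrPdist_le => e e0.
have k0 : 0 < normal_peak 1 :> R by rewrite normal_peak_gt0// oner_neq0.
pose eps := e / (2 * normal_peak 1).
have eps0 : 0 < eps by rewrite divr_gt0// mulr_gt0.
have lipE : normal_peak 1 * eps = e / 2 by rewrite /eps; field; rewrite gt_eqF.
have [c1 /andP[_ c1u] H1] := ramp_clt x eps0.
have [c2 /andP[c2l _] H2] := ramp_clt (x - eps) eps0.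
have L1 := normal_cdf_lipschitz x (x + eps); have L2 := normal_cdf_lipschitz (x - eps) x.
rewrite addrAC subrr add0r (gtr0_norm eps0) lipE in L1.
have xE : x - (x - eps) = eps by ring.
rewrite xE (gtr0_norm eps0) lipE in L2.
have e2 : 0 < e / 2 by rewrite divr_gt0.
near=> n.
have B1 : `|Ex (edge_weight (q n)) (fun a => ramp x eps (X n a)) - c1| <= e / 2.
  by near: n; exact: H1.
have B2 : `|Ex (edge_weight (q n)) (fun a => ramp (x - eps) eps (X n a)) - c2| <= e / 2.
  by near: n; exact: H2.
have ew := edge_weight01 (@edge_prob01 n).
have U : Ex (edge_weight (q n)) (fun a => (X n a <= x)%R%:R) <=
    Ex (edge_weight (q n)) (fun a => ramp x eps (X n a)).
  apply: (le_Ex ew) => a; have [Xx|_] := leP (X n a) x; first by rewrite ramp_eq1.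
  by have /andP[] := ramp01 x eps (X n a).
have Lo : Ex (edge_weight (q n)) (fun a => ramp (x - eps) eps (X n a)) <=
    Ex (edge_weight (q n)) (fun a => (X n a <= x)%R%:R).
  apply: (le_Ex ew) => a; have [Xx|Xx] := leP (X n a) x.
    by have /andP[] := ramp01 (x - eps) eps (X n a).
  by rewrite ramp_eq0// subrK ltW.
move: U Lo B1 B2 L1 L2 c1u c2l.
rewrite !ler_norml => U Lo /andP[_ B1] /andP[B2 _] /andP[_ L1] /andP[_ L2] c1u c2l.
by apply/andP; split; lra.
Unshelve. all: by end_near. Qed.

End Limit.

Theorem theorem2p2 (R : realType) (alpha beta : R)
  (halpha : 0 < alpha < 1) (hbeta : 0 < beta < 1)
  (w : forall n, 'M[R]_n)
  (hw : forall n (i j : 'I_n), i != j ->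
    w n i j = w n j i /\ beta <= w n i j <= 1)
  (hw0 : forall n (i : 'I_n), w n i i = 0)
  (d : nat -> measure_display) (Omega : forall n, measurableType (d n))
  (P : forall n, probability (Omega n) R)
  (A : forall n, 'I_n -> 'I_n -> {RV (P n) >-> bool})
  (hA : forall n, heterogeneous_random_graph (edge_prob alpha (w n)) (A n)) :
  (\forall n \near \oo, 0 < sigma (edge_prob alpha (w n))) /\
  converges_in_distribution
    (fun n => standardize (average_closure_rv (A n) : {RV (P n) >-> R})
                (sigma (edge_prob alpha (w n))) : {RV (P n) >-> R})
    (normal_prob (0 : R) 1).
Proof.
split; first exact: (sigma_gt0 halpha hbeta hw hw0).
move=> x _.
rewrite -[X in _ --> X]fineK ?fin_num_measure//; apply: cvg_EFin.
  by near=> n; rewrite (cdf_standardize (hA n)).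
apply: cvg_trans (cdf_clt halpha hbeta hw hw0 (x := x)).
apply: near_eq_cvg; near=> n.
by rewrite /= (cdf_standardize (hA n)).
Unshelve. all: by end_near. Qed.
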